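(* Let $K$ be a number field and let $A$ be a non-commutative central simple $K$-algebra. Then $A$ is a Schur algebra of Kleinian type if and only if $A$ is isomorphic to one of the following algebras: (1) $M_2(K)$, for $K=\mathbb{Q}$ or $K=\mathbb{Q}(\sqrt{d})$ for $d$ a square-free negative integer. (2) $\left(\frac{-1,-1}{\mathbb{Q}(\sqrt{d})}\right)$, for $d$ a square-free negative integer such that $d\equiv 1 \bmod 8$. (3) $\left(\frac{-1,-3}{\mathbb{Q}(\sqrt{d})}\right)$, for $d$ a square-free negative integer such that $d\equiv 1 \bmod 3$. (4) $\left(\frac{\lambda_n^2,-1}{K}\right)$, where $n\ge 3$, $\eta_n\in K$ and $K$ has at least one real embedding and at most one pair of complex (non-real) embeddings.
   Context: A Schur algebra over a number field $K$ is a central simple $K$-algebra $A$ which is generated over $K$ by a finite subgroup of the unit group $A^*$. Let $K$ be a number field, $A$ a central simple $K$-algebra of degree $m$, $R$ a $\mathbb{Z}$-order in $A$, and $R^1$ the group of units of $R$ of reduced norm $1$. Every embedding $\sigma:K\to\mathbb{C}$ induces an embedding $\overline{\sigma}:A\to M_m(\mathbb{C})$ with $\overline{\sigma}(R^1)\subseteq \mathrm{SL}_m(\mathbb{C})$. The algebra $A$ is of Kleinian type if either $A=K$, or $A$ is a quaternion algebra over $K$ and $\overline{\sigma}(R^1)$ is a discrete subgroup of $\mathrm{SL}_2(\mathbb{C})$ for some embedding $\sigma$ of $K$ in $\mathbb{C}$. For $a,b\in K^*$, $\left(\frac{a,b}{K}\right)=K[i,j\mid i^2=a,\ j^2=b,\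 ji=-ij]$. For a positive integer $n$, $\zeta_n$ is a complex primitive $n$-th root of unity, $\eta_n=\zeta_n+\zeta_n^{-1}$ and $\lambda_n=\zeta_n-\zeta_n^{-1}$; note that $\lambda_n^2=\eta_n^2-4$. A real embedding of $K$ is a field homomorphism $K\to\mathbb{R}$, and a pair of complex embeddings of $K$ is a pair of conjugate field homomorphisms $K\to\mathbb{C}$ whose images are not contained in $\mathbb{R}$. *)

(* Defs.v *)
From HB Require Import structures.
From mathcomp Require Import all_boot all_order all_algebra all_field.
From mathcomp Require Import complex ring.
From mathcomp Require Import classical_sets reals topology normedtype.

Set Implicit Arguments.
Unset Strict Implicit.
Unset Printing Implicit Defensive.

Import Order.TTheory GRing.Theory Num.Theory.
Import numFieldNormedType.Exports.

Local Open Scope ring_scope.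
Local Open Scope complex_scope.

HB.instance Definition _ (R : realType) :=
  PseudoPointedMetric.copy R[i] (R[i])^o.

(* The quaternion algebra (a, b / K) = K[i, j | i^2 = a, j^2 = b, ji = -ij];
   Quat x0 x1 x2 x3 is x0 + x1 i + x2 j + x3 ij, cf. quat_coords below. *)
Record quat (K : fieldType) (a b : K) : Type :=
  Quat { qcoef0 : K; qcoef1 : K; qcoef2 : K; qcoef3 : K }.

Section QuatTheory.
Variables (K : fieldType) (a b : K).
Local Notation Q := (quat a b).
Local Notation mkQ := (@Quat K a b).

Definition qtuple (x : Q) : K * K * K * K :=
  (qcoef0 x, qcoef1 x, qcoef2 x, qcoef3 x).
Definition qoftuple (t : K * K * K * K) : Q :=
  mkQ t.1.1.1 t.1.1.2 t.1.2 t.2.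

Lemma qtupleK : cancel qtuple qoftuple. Proof. by case. Qed.

HB.instance Definition _ := Choice.copy Q (can_type qtupleK).

Definition qzero : Q := mkQ 0 0 0 0.
Definition qopp (x : Q) : Q :=
  let: Quat x0 x1 x2 x3 := x in mkQ (- x0) (- x1) (- x2) (- x3).
Definition qadd (x y : Q) : Q :=
  let: Quat x0 x1 x2 x3 := x in
  let: Quat y0 y1 y2 y3 := y in
  mkQ (x0 + y0) (x1 + y1) (x2 + y2) (x3 + y3).
Definition qscale (k : K) (x : Q) : Q :=
  let: Quat x0 x1 x2 x3 := x in mkQ (k * x0) (k * x1) (k * x2) (k * x3).
Definition qone : Q := mkQ 1 0 0 0.
Definition qmul (x y : Q) : Q :=
  let: Quat x0 x1 x2 x3 := x in
  let: Quat y0 y1 y2 y3 := y in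
  mkQ (x0 * y0 + a * (x1 * y1) + b * (x2 * y2) - a * b * (x3 * y3))
      (x0 * y1 + x1 * y0 - b * (x2 * y3) + b * (x3 * y2))
      (x0 * y2 + x2 * y0 + a * (x1 * y3) - a * (x3 * y1))
      (x0 * y3 + x3 * y0 + x1 * y2 - x2 * y1).

Local Lemma qaddA : associative qadd.
Proof. by move=> [? ? ? ?] [? ? ? ?] [? ? ? ?]; congr Quat; ring. Qed.
Local Lemma qaddC : commutative qadd.
Proof. by move=> [? ? ? ?] [? ? ? ?]; congr Quat; ring. Qed.
Local Lemma qadd0 : left_id qzero qadd.
Proof. by move=> [? ? ? ?]; congr Quat; ring. Qed.
Local Lemma qaddN : left_inverse qzero qopp qadd.
Proof. by move=> [? ? ? ?]; congr Quat; ring. Qed.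

HB.instance Definition _ := GRing.isZmodule.Build Q qaddA qaddC qadd0 qaddN.

Local Lemma qscaleA (k l : K) (x : Q) : qscale k (qscale l x) = qscale (k * l) x.
Proof. by case: x => ? ? ? ?; congr Quat; ring. Qed.
Local Lemma qscale1 : left_id 1 qscale.
Proof. by move=> [? ? ? ?]; congr Quat; ring. Qed.
Local Lemma qscaleDr : right_distributive qscale +%R.
Proof. by move=> ? [? ? ? ?] [? ? ? ?]; congr Quat; ring. Qed.
Local Lemma qscaleDl (x : Q) : {morph qscale^~ x : k l / k + l}.
Proof. by case: x => ? ? ? ? k l; congr Quat; ring. Qed.

HB.instance Definition _ :=
  GRing.Zmodule_isLmodule.Build K Q qscaleA qscale1 qscaleDr qscaleDl.

Local Lemma qmulA : associative qmul.
Proof. by move=> [? ? ? ?] [? ? ? ?] [? ? ? ?]; congr Quat; ring. Qed.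
Local Lemma qmul1l : left_id qone qmul.
Proof. by move=> [? ? ? ?]; congr Quat; ring. Qed.
Local Lemma qmul1r : right_id qone qmul.
Proof. by move=> [? ? ? ?]; congr Quat; ring. Qed.
Local Lemma qmulDl : left_distributive qmul +%R.
Proof. by move=> [? ? ? ?] [? ? ? ?] [? ? ? ?]; congr Quat; ring. Qed.
Local Lemma qmulDr : right_distributive qmul +%R.
Proof. by move=> [? ? ? ?] [? ? ? ?] [? ? ? ?]; congr Quat; ring. Qed.
Local Lemma qone_neq0 : qone != 0 :> Q.
Proof. by apply/eqP => -[] /eqP; rewrite oner_eq0. Qed.

HB.instance Definition _ :=
  GRing.Zmodule_isNzRing.Build Q qmulA qmul1l qmul1r qmulDl qmulDr qone_neq0.

Local Lemma qscaleAl (k : K) (x y : Q) : k *: (x * y) = (k *: x) * y.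
Proof. by move: x y => [? ? ? ?] [? ? ? ?]; congr Quat; ring. Qed.
HB.instance Definition _ := GRing.Lmodule_isLalgebra.Build K Q qscaleAl.

Local Lemma qscaleAr (k : K) (x y : Q) : k *: (x * y) = x * (k *: y).
Proof. by move: x y => [? ? ? ?] [? ? ? ?]; congr Quat; ring. Qed.
HB.instance Definition _ := GRing.Lalgebra_isAlgebra.Build K Q qscaleAr.

Definition qi : Q := mkQ 0 1 0 0.
Definition qj : Q := mkQ 0 0 1 0.

Lemma qi_sqr : qi * qi = a%:A.
Proof. by congr Quat; ring. Qed.
Lemma qj_sqr : qj * qj = b%:A.
Proof. by congr Quat; ring. Qed.
Lemma qji : qj * qi = - (qi * qj).
Proof. by congr Quat; ring. Qed.
Lemma quat_coords (x0 x1 x2 x3 : K) :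
  mkQ x0 x1 x2 x3 = x0%:A + x1 *: qi + x2 *: qj + x3 *: (qi * qj).
Proof. by congr Quat; ring. Qed.

End QuatTheory.

Definition alg_isom (K : fieldType) (A B : algType K) : Prop :=
  exists f : {lrmorphism A -> B}, bijective f.

(* A two-sided ideal of a unital K-algebra is a K-subspace. *)
Definition simple_alg (K : fieldType) (A : falgType K) : Prop :=
  forall I : {vspace A},
    ({:A} * I <= I)%VS -> (I * {:A} <= I)%VS -> I = 0%VS \/ I = {:A}%VS.

Definition central_simple (K : fieldType) (A : falgType K) : Prop :=
  'Z({:A})%VS = 1%VS /\ simple_alg A.

Definition finite_unit_subgroup (K : fieldType) (A : falgType K) (G : seq A) :
    Prop :=
  [/\ 1 \in G,
      {in G &, forall x y, x * y \in G} &
      {in G, forall x, x \is a GRing.unit /\ x^-1 \in G}].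

Definition schur_algebra (K : fieldType) (A : falgType K) : Prop :=
  central_simple A /\
  exists G : seq A, finite_unit_subgroup G /\ (<<1 & G>>)%VS = {:A}%VS.

Definition Z_order (K : fieldExtType rat) (A : falgType K) (O : set A) : Prop :=
  [/\ O 1,
      forall x y, O x -> O y -> O (x - y) /\ O (x * y),
      exists s : seq A, forall x,
        O x <-> exists c : 'I_(size s) -> int, x = \sum_(i < size s) s`_i *~ c i &
      forall x : A, exists n : nat, (0 < n)%N /\ O (x *+ n)].

(* phi is the embedding of A into the matrices over L induced by iota,
   which is unique up to conjugation. *)
Definition extends_embedding (K L : fieldType) (A : falgType K) (m : nat)
    (iota : {rmorphism K -> L}) (phi : {rmorphism A -> 'M[L]_m}) : Prop :=
  forall k : K, phi k%:A = (iota k)%:M.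

(* For A central simple of degree m: the value of the reduced norm at x is
   the determinant of x in any splitting A -> 'M[L]_m. *)
Definition is_reduced_norm (K : fieldType) (A : falgType K) (m : nat)
    (x : A) (n : K) : Prop :=
  (m ^ 2)%N = \dim {:A} /\
  exists (L : fieldType) (iota : {rmorphism K -> L})
         (phi : {rmorphism A -> 'M[L]_m}),
    extends_embedding iota phi /\ iota n = \det (phi x).

Definition norm1_units (K : fieldType) (A : falgType K) (m : nat) (O : set A) :
    set A :=
  [set x | [/\ O x, x \is a GRing.unit, O x^-1 & is_reduced_norm m x 1]]%classic.

Definition discrete_set (T : topologicalType) (S : set T) : Prop :=
  (S `<=` isolated S)%classic.

Definition quaternion_algebra (K : fieldType) (A : falgType K) : Prop :=
  exists a b : K, [/\ a != 0, b != 0 & alg_isom A (quat a b)].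

(* The choice of the order O and of phi above sigma is immaterial. *)
Definition kleinian_type (R : realType) (K : fieldExtType rat) (A : falgType K) :
    Prop :=
  {:A}%VS = 1%VS \/
  quaternion_algebra A /\
  exists (O : set A) (sigma : {rmorphism K -> R[i]})
         (phi : {rmorphism A -> 'M[R[i]]_2}),
    [/\ Z_order O, extends_embedding sigma phi &
        discrete_set (phi @` norm1_units 2 O)%classic].

Definition is_rational_field (K : fieldExtType rat) : Prop :=
  {:K}%VS = 1%VS.

Definition is_quadratic_field (K : fieldExtType rat) (d : int) : Prop :=
  exists s : K, s ^+ 2 = d%:~R /\ <<1; s>>%VS = {:K}%VS.

Definition squarefree (d : int) : Prop :=
  forall m : int, (m ^+ 2 %| d)%Z -> m \is a GRing.unit.

Definition has_real_embedding (R : realType) (K : fieldExtType rat) : Prop :=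
  inhabited {rmorphism K -> R}.

Definition nonreal_embedding (R : realType) (K : fieldExtType rat)
    (sigma : {rmorphism K -> R[i]}) : Prop :=
  exists x : K, sigma x \isn't Num.real.

Definition at_most_one_complex_pair (R : realType) (K : fieldExtType rat) :
    Prop :=
  forall sigma tau : {rmorphism K -> R[i]},
    nonreal_embedding sigma -> nonreal_embedding tau ->
    sigma =1 tau \/ forall x : K, sigma x = (tau x)^*.

(* K is abstract, so eta_n \in K is read through an embedding of K in the
   complex numbers; l then stands for lambda_n^2. *)
Definition lambda_sqr_in (R : realType) (K : fieldExtType rat) (n : nat)
    (l : K) : Prop :=
  exists (iota : {rmorphism K -> R[i]}) (zeta : R[i]) (eta : K),
    [/\ n.-primitive_root zeta, iota eta = zeta + zeta^-1 &
        iota l = (zeta - zeta^-1) ^+ 2].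

(* Main.v *)
(* A non-commutative algebra of Kleinian type is a quaternion algebra (a, b / K) whose norm one
   units form a discrete group at some complex embedding of K.

   If A is a matrix algebra, the unipotents 1 + x E with x in a lattice of K show that K embeds
   discretely, so K is rational or imaginary quadratic.  If A is a division algebra, a pigeonhole
   construction of units in K(i), in the style of Dirichlet, shows that every complex place of K
   is the discrete one.  A non-commutative finite subgroup of A^* contains, by counting
   centralizers, a noncentral x and some y with y x y^-1 the conjugate of x; normalized to
   y^2 = -1 and norm 1, this pair gives A = (lambda_n^2, -1).  When K has no real embedding it is
   imaginary quadratic and lambda_n^2 is -4 or -3; then d = 1 modulo 8 or 3, because for all
   other d a Hilbert symbol argument represents -d by x^2 + y^2 + z^2 or x^2 + 3 y^2 + 3 z^2
   over Q, so that the norm form is isotropic.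

   Conversely, the algebras listed are generated by dihedral-type groups, and the unit group of
   an order is discrete at the given place because the reduced norm is definite at all other
   places. *)
Require Import Defs.
From HB Require Import structures.
From mathcomp Require Import all_boot all_order all_fingroup all_algebra all_field all_solvable.
From mathcomp Require Import ring lra zify.
From mathcomp Require boolp.
From mathcomp Require Import complex.
From mathcomp Require Import classical_sets reals topology normedtype.

Set Implicit Arguments.
Unset Strict Implicit.
Unset Printing Implicit Defensive.

Import Order.TTheory GRing.Theory Num.Theory.
Import numFieldNormedType.Exports.

Local Open Scope ring_scope.

(** * Tame Hilbert symbols over Q *)

(** The delicate arithmetic is the passage from local conditions to ternary forms over Q. Descent on
    (a, b / Q) shows that an algebra with trivial symbols at all primes above 3 is one of four
    explicit algebras, told apart by the sign and the symbol at 3; this finite list absorbs the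
    reciprocity law and the symbol at 2. To represent -d one needs an auxiliary integer c whose
    symbols with d are prescribed. It is sought among the products of 2, the odd prime divisors of d
    and the small split primes, and the existence of enough symbol patterns is a rank bound over
    F_2, in the manner of genus theory: kernel vectors give norms of bounded denominator, and too
    many of these would be multiplicatively dependent modulo squares. When 2 splits the bound loses
    one dimension; for x^2 + 3 y^2 + 3 z^2 the loss is repaired by excluding two of three candidate
    patterns modulo 8. For units, an element of K(i) that is unbalanced at a second complex place is
    divided by a congruent one close to it at the discrete place; the quotient u yields the norm one
    unit u / conj(u), which discreteness forces to be 1. *)

Lemma Euclid_dvdzM (p : nat) (a b : int) :
  prime p -> (p %| a * b)%Z = (p %| a)%Z || (p %| b)%Z.
Proof. by move=> pr; rewrite !dvdzE abszM Euclid_dvdM. Qed.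

Lemma Euclid_dvdzX2 (p : nat) (a : int) :
  prime p -> (p %| a ^+ 2)%Z = (p %| a)%Z.
Proof. by move=> pr; rewrite expr2 Euclid_dvdzM // orbb. Qed.

(** Euler's criterion as an additive character: [true] stands for -1, so products of symbols become
    [(+)]. For odd p the multiples of p also give [true], hence the nondivisibility hypotheses
    below. *)
Definition nonres (p : nat) (a : int) : bool :=
  (a%:~R : 'F_p) ^+ p.-1./2 != 1.

Section QuadraticCharacter.
Variable p : nat.
Hypotheses (pr : prime p) (odd_p : odd p).

Let half_p : (p.-1 = (p.-1)./2 + (p.-1)./2)%N.
Proof. have := prime_gt1 pr; lia. Qed.

Lemma Fp_eq0 (a : int) : ((a%:~R : 'F_p) == 0) = (p %| a)%Z.
Proof. by rewrite (dvdz_pcharf (pchar_Fp pr)). Qed.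

Lemma Fp_fermat (x : 'F_p) : x != 0 -> x ^+ p.-1 = 1.
Proof.
move=> x0; apply: (mulfI x0); rewrite -exprS prednK ?prime_gt0 // mulr1.
by have := expf_card x; rewrite card_Fp.
Qed.

Lemma nonresM (a b : int) : ~~ (p %| a)%Z -> ~~ (p %| b)%Z ->
  nonres p (a * b) = nonres p a (+) nonres p b.
Proof.
have h x : ~~ (p %| x)%Z ->
    (x%:~R : 'F_p) ^+ p.-1./2 = if nonres p x then -1 else 1.
  rewrite -Fp_eq0 => x0; rewrite /nonres; case: eqP => //= /eqP n1.
  have := Fp_fermat x0; rewrite [X in _ ^+ X = _]half_p exprD -expr2 => /eqP.
  by rewrite sqrf_eq1 (negPf n1) => /eqP.
have m1 : (-1 : 'F_p) != 1.
  rewrite -subr_eq0 -opprD oppr_eq0 -(natrD _ 1 1).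
  rewrite -(dvdn_pcharf (pchar_Fp pr)); apply: contraL odd_p => /dvdn_leq.
  by have := prime_gt1 pr; case: p => [|[|[|]]] //= q _ /(_ isT).
move=> /h ha /h hb; rewrite {1}/nonres intrM exprMn ha hb.
by do 2!case: (nonres _ _); rewrite ?mulrN1 ?mulN1r ?mulr1 ?opprK ?eqxx ?m1.
Qed.

Lemma nonresX2 (a : int) : ~~ (p %| a)%Z -> nonres p (a ^+ 2) = false.
Proof. by move=> h; rewrite expr2 nonresM // addbb. Qed.

Lemma nonres_mod (a b : int) : (p %| a - b)%Z -> nonres p a = nonres p b.
Proof. by rewrite -Fp_eq0 rmorphB subr_eq0 /nonres => /eqP ->. Qed.

(** A generator z of the multiplicative group gives a = z^i, the criterion makes i even, and z^(i/2)
    is the root. *)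
Lemma nonresPn (a : int) : ~~ (p %| a)%Z -> ~~ nonres p a ->
  exists x : int, (p %| x ^+ 2 - a)%Z.
Proof.
rewrite -Fp_eq0 negbK => a0 /eqP ha.
have pg : (0 < p.-1)%N by have := prime_gt1 pr; lia.
have hu : all p.-1.-unity_root [seq x <- enum 'F_p | x != 0].
  apply/allP => x; rewrite mem_filter => /andP[x0 _].
  by apply/unity_rootP/Fp_fermat.
have /hasP [z _ hz] : has p.-1.-primitive_root [seq x <- enum 'F_p | x != 0].
  apply: has_prim_root => //; first by rewrite filter_uniq ?enum_uniq.
  have := count_predC (fun x : 'F_p => x != 0) (enum 'F_p).
  have -> : size (enum 'F_p) = p by rewrite -cardT card_Fp.
  rewrite size_filter.
  have -> : count (predC (fun x : 'F_p => x != 0)) (enum 'F_p) = 1%N.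
    rewrite (@eq_count _ _ (pred1 0)) => [|x]; last by rewrite /= negbK.
    by rewrite count_uniq_mem ?enum_uniq // mem_enum.
  by move=> e; move: (congr1 predn e); rewrite addn1 /= => <-.
have [i hi] := prim_rootP hz (Fp_fermat a0).
move: ha; rewrite hi -exprM => /eqP; rewrite -(prim_order_dvd hz) => hd.
have ei : ~~ odd i.
  have p3 : (2 < p)%N by have := prime_gt1 pr; case: p odd_p => [|[|[|]]].
  have h0 : (0 < p.-1./2)%N by move: p3 half_p; lia.
  move: hd => /dvdnP [k hk]; have : (i * p.-1./2 == k.*2 * p.-1./2)%N.
    by rewrite hk {1}half_p -addnn mulnDl mulnDr.
  by rewrite eqn_pmul2r // => /eqP ->; rewrite odd_double.
exists ((z ^+ (i./2))%:Z).
rewrite -Fp_eq0 rmorphB rmorphXn /= -[_%:~R]/(_%:R) natr_Zp -exprM muln2.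
by rewrite even_halfK // hi subrr.
Qed.

End QuadraticCharacter.

Definition vz (p : nat) (a : int) : nat := logn p `|a|%N.
Definition unonres (p : nat) (a : int) : bool :=
  nonres p (a %/ (p%:Z ^+ vz p a))%Z.

(** The tame formula: the quadratic character modulo p of (-1)^(v(a) v(b)) a^v(b) / b^v(a), written
    additively. For odd p, [true] means that (a, b) is ramified at p. *)
Definition hs (p : nat) (a b : int) : bool :=
  (odd (vz p a) && unonres p b) (+) (odd (vz p b) && unonres p a)
  (+) [&& odd (vz p a), odd (vz p b) & unonres p (-1)%R].

Section TameSymbol.
Variable p : nat.
Hypotheses (pr : prime p).

Let p0 : p%:Z != 0. Proof. by rewrite -lt0n prime_gt0. Qed.

Lemma vzP (a : int) : a != 0 ->
  exists2 u, a = p%:Z ^+ vz p a * u & ~~ (p %| u)%Z.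
Proof.
move=> a0; have ag : (0 < `|a|)%N by rewrite absz_gt0.
have /dvdnP [k hk] := pfactor_dvdnn p `|a|%N.
exists (sgz a * k%:Z).
  rewrite mulrCA.
  have -> : p%:Z ^+ vz p a * k%:Z = `|a|%N%:Z by rewrite [in RHS]hk PoszM mulrC -[Posz (p ^ _)]natz natrX natz.
  by rewrite -intEsg.
rewrite dvdzE abszM absz_sg a0 mul1n.
apply/negP => /= /dvdnP [l hl].
have : (p ^ (logn p `|a|).+1 %| `|a|)%N.
  by rewrite {2}hk hl expnS -mulnA dvdn_mull.
by rewrite pfactor_dvdn // ltnn.
Qed.

Lemma vzE (a u : int) (k : nat) : a = p%:Z ^+ k * u -> ~~ (p %| u)%Z ->
  vz p a = k /\ unonres p a = nonres p u.
Proof.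
move=> -> hu; have e : vz p (p%:Z ^+ k * u) = k.
  rewrite /vz abszM abszX mulnC logn_Gauss ?pfactorK //.
  by rewrite prime_coprime // -dvdzE.
by split=> //; rewrite /unonres e mulKz // expf_neq0.
Qed.

Lemma vzM (a b : int) : a != 0 -> b != 0 -> vz p (a * b) = (vz p a + vz p b)%N.
Proof. by move=> a0 b0; rewrite /vz abszM lognM // absz_gt0. Qed.

Lemma vzN (a : int) : vz p (- a) = vz p a.
Proof. by rewrite /vz abszN. Qed.

Lemma vz_ndvd (a : int) : ~~ (p %| a)%Z -> vz p a = 0.
Proof.
by move=> ha; have [] := @vzE a a 0 _ ha => //; rewrite expr0 mul1r.
Qed.

Lemma unonres_ndvd (a : int) : ~~ (p %| a)%Z -> unonres p a = nonres p a.
Proof.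
by move=> ha; have [] := @vzE a a 0 _ ha => //; rewrite expr0 mul1r.
Qed.

Lemma ndvd1 : ~~ (p %| 1)%Z.
Proof. by rewrite dvdz1 /=; case: p pr => [|[]]. Qed.

Lemma ndvdN1 : ~~ (p %| (-1)%R)%Z.
Proof. by rewrite dvdzE abszN -dvdzE ndvd1. Qed.

Hypothesis (odd_p : odd p).

Lemma unonresM (a b : int) : a != 0 -> b != 0 ->
  unonres p (a * b) = unonres p a (+) unonres p b.
Proof.
move=> /vzP [u ha hu] /vzP [v hb hv].
have [_ ->] := vzE ha hu; have [_ ->] := vzE hb hv.
have huv : ~~ (p %| u * v)%Z by rewrite Euclid_dvdzM // negb_or hu.
have [|_ ->] := @vzE (a * b) (u * v) (vz p a + vz p b) _ huv.
  by rewrite {1}ha {1}hb exprD; ring.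
by rewrite nonresM.
Qed.

Lemma unonresX2 (a : int) : a != 0 -> unonres p (a ^+ 2) = false.
Proof. by move=> a0; rewrite expr2 unonresM // addbb. Qed.

Lemma unonresN (a : int) : a != 0 ->
  unonres p (- a) = unonres p (-1)%R (+) unonres p a.
Proof. by move=> a0; rewrite -[X in unonres p X = _]mulN1r unonresM. Qed.

Lemma hsC (a b : int) : hs p a b = hs p b a.
Proof.
by rewrite /hs; do 2!case: (odd _); do 3!case: (unonres _ _).
Qed.

Lemma hsMr (a b c : int) : b != 0 -> c != 0 ->
  hs p a (b * c) = hs p a b (+) hs p a c.
Proof.
move=> b0 c0; rewrite /hs vzM // oddD unonresM //.
by do 3!case: (odd _); do 4!case: (unonres _ _).
Qed.

Lemma hsX2r (a t : int) : t != 0 -> hs p a (t ^+ 2) = false.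
Proof. by move=> t0; rewrite expr2 hsMr // addbb. Qed.

Lemma hs_ndvd (a b : int) : ~~ (p %| a)%Z -> ~~ (p %| b)%Z -> hs p a b = false.
Proof. by move=> ha hb; rewrite /hs !vz_ndvd // andbF. Qed.

Lemma vzD_lt (x y : int) : x != 0 -> y != 0 -> (vz p x < vz p y)%N ->
  vz p (x + y) = vz p x /\ unonres p (x + y) = unonres p x.
Proof.
move=> /vzP [u hx hu] /vzP [v hy hv] lt.
have [_ ->] := vzE hx hu.
pose w := u + p%:Z ^+ (vz p y - vz p x) * v.
have pw : (p %| w - u)%Z.
  have -> : w - u = p%:Z ^+ (vz p y - vz p x).-1.+1 * v.
    by rewrite prednK ?subn_gt0 // /w addrC addKr.
  by rewrite exprS -mulrA dvdz_mulr.
have hw : ~~ (p %| w)%Z.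
  by apply: contra hu => h; rewrite -(subKr w u) rpredB.
have [|-> ->] := @vzE (x + y) w (vz p x) _ hw.
  rewrite {1}hx {1}hy /w mulrDr mulrA -exprD subnKC //; exact: ltnW.
by split=> //; apply: nonres_mod.
Qed.

(** The ultrametric inequality leaves three cases: b has the leading term t^2, or -a s^2, where (a,
    -a) is trivial, or both terms have the same valuation, which is then even. *)
Lemma hs_norm (a b t s : int) : a != 0 -> b != 0 ->
  b = t ^+ 2 - a * s ^+ 2 -> hs p a b = false.
Proof.
move=> a0 b0 eb.
have hN1 : vz p (-1)%R = 0 by rewrite vz_ndvd // ndvdN1.
have hNa x : x != 0 -> hs p x (- x) = false.
  move=> x0; rewrite /hs vzN unonresN //.
  by case: (odd _); do 2!case: (unonres _ _).
have [s0|s0] := eqVneq s 0.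
  rewrite eb s0 expr0n mulr0 subr0 hsX2r //.
  by apply: contraNneq b0 => t0; rewrite eb s0 t0 !expr0n mulr0 subr0.
have [t0|t0] := eqVneq t 0.
  rewrite eb t0 expr0n sub0r -mulNr hsMr ?oppr_eq0 ?expf_neq0 //.
  by rewrite hNa // hsX2r.
have x0 : t ^+ 2 != 0 by rewrite expf_neq0.
have y0 : - (a * s ^+ 2) != 0 by rewrite oppr_eq0 mulf_neq0 ?expf_neq0.
have vx : odd (vz p (t ^+ 2)) = false by rewrite expr2 vzM // oddD addbb.
have vy : odd (vz p (- (a * s ^+ 2))) = odd (vz p a).
  by rewrite vzN vzM ?expf_neq0 // (expr2 s) vzM // !oddD addbb addbF.
have Xx : unonres p (t ^+ 2) = false by rewrite unonresX2.
have Xy : unonres p (- (a * s ^+ 2)) = unonres p (-1)%R (+) unonres p a.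
  by rewrite unonresN ?mulf_neq0 ?expf_neq0 // unonresM ?expf_neq0 // unonresX2 // addbF.
have [lt|gt|e] := ltngtP (vz p (t ^+ 2)) (vz p (- (a * s ^+ 2))).
- have [e1 e2] := vzD_lt x0 y0 lt.
  by rewrite /hs eb e1 e2 vx Xx !andbF.
- have [e1 e2] := vzD_lt y0 x0 gt.
  rewrite /hs eb addrC e1 e2 vy Xy.
  by case: (odd _); do 2!case: (unonres _ _).
(* Only an odd valuation of b could still matter. If v(b) exceeds v(t^2), then a s^2 = t^2 - b has a
   square leading unit; if v(b) equals v(t^2), it is even. *)
have va : odd (vz p a) = false by rewrite -vy -e vx.
have [lt|gt|e'] := ltngtP (vz p (t ^+ 2)) (vz p b).
- have b0' : - b != 0 by rewrite oppr_eq0.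
  have lt' : (vz p (t ^+ 2) < vz p (- b))%N by rewrite vzN.
  have [e1 e2] := vzD_lt x0 b0' lt'.
  have ea : t ^+ 2 + - b = a * s ^+ 2 by rewrite eb; ring.
  move: e2; rewrite ea Xx unonresM ?expf_neq0 // unonresX2 // addbF => Xa.
  by rewrite /hs va Xa !andbF.
- have [e1 _] := vzD_lt b0 x0 gt; exfalso.
  have b0' : - b != 0 by rewrite oppr_eq0.
  have lt' : (vz p (- b) < vz p (t ^+ 2))%N by rewrite vzN.
  have [] := vzD_lt b0' x0 lt'.
  have -> : - b + t ^+ 2 = - - (a * s ^+ 2) by rewrite eb; ring.
  rewrite !vzN in e e1 gt * => h _; lia.
by rewrite /hs va -e' vx.
Qed.

End TameSymbol.

(** * Descent for quaternion symbols over Q unramified at all primes above 3 *)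

Definition sqfree (a : int) : Prop :=
  forall p : nat, prime p -> ~~ (p%:Z ^+ 2 %| a)%Z.

Lemma sqfreePn (a : int) : a != 0 -> sqfree a \/
  exists (p : nat) (b : int), [/\ prime p, a = p%:Z ^+ 2 * b & b != 0].
Proof.
move=> a0.
have [/'exists_andP [p [pp /dvdzP [b hb]]]|hn] :=
  boolP [exists p : 'I_`|a|.+1, prime p && (p%:Z ^+ 2 %| a)%Z].
  right; exists p, b; split=> //; first by rewrite mulrC.
  by apply: contraNneq a0 => b0; rewrite hb b0 mul0r.
left=> p pp; apply: contra hn => hd; apply/existsP.
have lp : (p < `|a|.+1)%N.
  move: hd; rewrite dvdzE abszX => /dvdn_leq; rewrite absz_gt0 => /(_ a0) h.
  rewrite ltnS; apply: leq_trans h; rewrite /= expnS expn1.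
  by rewrite leq_pmulr // prime_gt0.
by exists (Ordinal lp); rewrite pp.
Qed.

Lemma sqfree_nz (a : int) : sqfree a -> a != 0.
Proof. by move=> h; apply: contraNneq (h 2%N isT) => ->; rewrite dvdz0. Qed.

Lemma sqfree_vz (p : nat) (a : int) : prime p -> sqfree a -> (p %| a)%Z ->
  vz p a = 1.
Proof.
move=> pp ha hp; have a0 := sqfree_nz ha.
have ag : (0 < `|a|)%N by rewrite absz_gt0.
have := ha p pp; rewrite dvdzE abszX /= pfactor_dvdn // -ltnNge.
by move: hp; rewrite dvdzE /= -{1}(expn1 p) pfactor_dvdn // /vz; lia.
Qed.

Lemma sqrt_mod_sqfree (a : int) (n : nat) : (0 < n)%N -> sqfree n ->
  (forall p, prime p -> (p %| n)%N -> exists t : int, (p %| t ^+ 2 - a)%Z) ->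
  exists t : int, (n %| t ^+ 2 - a)%Z.
Proof.
elim/ltn_ind: n => n IH n0 sn hn.
have [n1|n1] := leqP n 1; first by exists 0; rewrite (_ : n = 1%N) ?dvd1z //; lia.
have pp := pdiv_prime n1; set p := pdiv n in pp.
have /dvdnP [k hk] := pdiv_dvd n; rewrite -/p in hk.
have k0 : (0 < k)%N by case: k hk n0 => // ->.
have cpk : coprime p k.
  rewrite prime_coprime //; apply: contra (sn p pp) => /dvdnP [l hl].
  by rewrite hk hl !PoszM -mulrA -expr2 dvdz_mull.
have [t1 ht1] := hn p pp (pdiv_dvd n).
have [||q pq qk|t2 ht2] := IH k _ k0.
- by rewrite hk ltn_Pmulr // prime_gt1.
- move=> q pq; apply: contra (sn q pq) => h; apply: dvdz_trans h _.
  by rewrite hk PoszM dvdz_mulr.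
- by apply: hn => //; rewrite hk dvdn_mulr.
have cz : coprimez p k by [].
pose t := zchinese p k t1 t2; exists t.
have hmod m t' : (t = t' %[mod m])%Z -> (m %| t' ^+ 2 - a)%Z -> (m %| t ^+ 2 - a)%Z.
  move=> /eqP; rewrite eqz_mod_dvd => h h'.
  have -> : t ^+ 2 - a = (t - t') * (t + t') + (t' ^+ 2 - a) by ring.
  by rewrite rpredD // dvdz_mulr.
rewrite hk mulnC PoszM Gauss_dvdz //; apply/andP; split.
  by apply: hmod ht1; apply: zchinese_modl.
by apply: hmod ht2; apply: zchinese_modr.
Qed.

Lemma centered_residue (n : nat) (t : int) : (0 < n)%N ->
  exists2 t', (n %| t' - t)%Z & (2 * `|t'| <= n)%N.
Proof.
move=> n0; have nz : n%:Z != 0 by rewrite -lt0n.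
have h0 := modz_ge0 t nz; have := ltz_mod t nz; rewrite ger0_norm // => h1.
have hd : (n %| (t %% n)%Z - t)%Z by rewrite -eqz_mod_dvd modz_mod.
have [le|gt] := leP (2 * (t %% n)%Z) n%:Z.
  by exists (t %% n)%Z => //; lia.
exists ((t %% n)%Z - n%:Z); last by lia.
by rewrite addrAC rpredB.
Qed.

(** The values (x i + y j + z ij)^2 on pure quaternions of (a, b / Q). *)
Definition rep (a b : int) (n : rat) : Prop := exists x y z : rat,
  n = a%:~R * x ^+ 2 + b%:~R * y ^+ 2 - a%:~R * b%:~R * z ^+ 2.

Lemma rep_swap a b n : rep a b n -> rep b a n.
Proof. by case=> x [y [z ->]]; exists y, x, z; ring. Qed.

(** Since b b' is the norm of t + s i, the element j' = (t + s i) j / b anticommutes with i and has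
    square b'. The witness rewrites x i + y j' + z i j' in the basis i, j, ij. *)
Lemma rep_move (a b b' t s : int) n : b != 0 ->
  b * b' = t ^+ 2 - a * s ^+ 2 -> rep a b' n -> rep a b n.
Proof.
move=> b0 e [x [y [z ->]]].
have bQ : b%:~R != 0 :> rat by rewrite intr_eq0.
have eQ : b'%:~R = (t%:~R ^+ 2 - a%:~R * s%:~R ^+ 2) / b%:~R :> rat.
  apply: (mulfI bQ); rewrite -intrM e [RHS]mulrC divfK // intrD intrN intrM !expr2 !intrM //.
exists x, ((y * t%:~R + a%:~R * z * s%:~R) / b%:~R),
  ((y * s%:~R + z * t%:~R) / b%:~R).
by rewrite eQ; field.
Qed.

(* Isomorphism of the quaternion algebras (a, b / Q) and (a', b' / Q), recorded
   through the squares of their pure quaternions and their local invariants. *)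
Record same (a b a' b' : int) : Prop := Same {
  same_nz : [&& a != 0, b != 0, a' != 0 & b' != 0];
  same_rep : forall n, rep a b n <-> rep a' b' n;
  same_hs : forall p, prime p -> odd p -> hs p a b = hs p a' b';
  same_neg : (a < 0) && (b < 0) = (a' < 0) && (b' < 0) }.

Lemma same_refl a b : a != 0 -> b != 0 -> same a b a b.
Proof. by move=> a0 b0; split=> //; rewrite a0 b0. Qed.

Lemma same_trans a b a' b' a'' b'' :
  same a b a' b' -> same a' b' a'' b'' -> same a b a'' b''.
Proof.
move=> [/and4P[a0 b0 _ _] r h s] [/and4P[_ _ a0' b0'] r' h' s'].
split; first by rewrite a0 b0 a0'.
- by move=> n; rewrite r.
- by move=> p pp op; rewrite h // h'.
by rewrite s.
Qed.

Lemma same_sym a b a' b' : same a b a' b' -> same a' b' a b.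
Proof.
case=> /and4P[a0 b0 a0' b0'] r h s; split=> //.
- by rewrite a0' b0' a0.
- by move=> n; rewrite r.
by move=> p pp op; rewrite h.
Qed.

Lemma same_swap a b : a != 0 -> b != 0 -> same a b b a.
Proof.
move=> a0 b0; split; first by rewrite a0 b0.
- by move=> n; split; apply: rep_swap.
- by move=> p pp op; rewrite hsC.
by rewrite andbC.
Qed.

Lemma same_move (a b b' t s : int) : a != 0 -> b != 0 -> b' != 0 ->
  b * b' = t ^+ 2 - a * s ^+ 2 -> same a b a b'.
Proof.
move=> a0 b0 b0' e; split; first by rewrite a0 b0.
- move=> n; split; last exact: rep_move e.
  by apply: rep_move b0' _; rewrite mulrC; apply: e.
- move=> p pp op; have bb0 : b * b' != 0 by rewrite mulf_neq0.
  have := hs_norm pp op a0 bb0 e; rewrite hsMr //.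
  by case: (hs p a b); case: (hs p a b').
have [an|//] := ltP a 0; rewrite /=.
have : 0 < b * b'.
  by rewrite lt0r mulf_neq0 //= e addr_ge0 ?sqr_ge0 // -mulNr mulr_ge0 ?sqr_ge0 //; lia.
by case: (ltgtP b 0) => hb; case: (ltgtP b' 0) => hb' //; nia.
Qed.

Lemma same_sqr (a b k : int) : a != 0 -> b != 0 -> k != 0 ->
  same a (k ^+ 2 * b) a b.
Proof.
move=> a0 b0 k0; apply: (@same_move _ _ _ (k * b) 0) => //; last by ring.
by rewrite mulf_neq0 ?expf_neq0.
Qed.

Definition small_ints : seq int := [:: 1; -1; 2; -2; 3; -3; 6; -6].

Definition small_moves (ab : int * int) : seq (int * int) :=
  (ab.2, ab.1) ::
  [seq (ab.1, b') | b' <- small_ints & has (fun t => has (fun s =>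
     ab.2 * b' == t ^+ 2 - ab.1 * s ^+ 2) [:: 0; 1; 2; 3; 6]) [:: 0; 1; 2; 3; 6]].

(** Ramified respectively nowhere, at {2, infinity}, at {3, infinity} and at {2, 3}: these are all
    quaternion algebras over Q unramified outside 2, 3 and infinity. *)
Definition canonical_symbols : seq (int * int) :=
  [:: (1, 1); (-1, -1); (-1, -3); (-1, 3)].

Lemma small_movesP (ab c : int * int) : ab.1 != 0 -> ab.2 != 0 ->
  c \in small_moves ab -> same ab.1 ab.2 c.1 c.2.
Proof.
case: ab => a b /= a0 b0; rewrite inE => /orP[/eqP->|]; first exact: same_swap.
move=> /mapP [b']; rewrite mem_filter => /andP[/hasP[t _ /hasP[s _ /eqP e]] hb].
move=> ->; apply: same_move e => //.
by apply: contraTneq hb => ->.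
Qed.

Lemma small_same (a b : int) : a \in small_ints -> b \in small_ints ->
  exists2 c, c \in canonical_symbols & same a b c.1 c.2.
Proof.
pose level n := iter n (fun l => undup (l ++ flatten [seq small_moves x | x <- l]))
  canonical_symbols.
have lev n ab : ab \in level n ->
    exists2 c, c \in canonical_symbols & same ab.1 ab.2 c.1 c.2.
  elim: n ab => [|n IH] ab /=.
    move=> h; exists ab => //; move: h.
    by rewrite !inE => /or4P[] /eqP ->; apply: same_refl.
  rewrite mem_undup mem_cat => /orP[|/flattenP [l /mapP[d hd ->] hc]]; first exact: IH.
  have [c cc hdc] := IH d hd; have [/and4P[d1 d2 _ _] _ _ _] := hdc.
  exists c => //; apply: same_trans hdc.
  exact/same_sym/small_movesP.
(* Seven rounds of moves, started at the four canonical symbols, reach all 64 pairs; as [same] is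
   symmetric, the direction of the search is immaterial. *)
have key : let l := level 7 in
    all (fun a => all (fun b => (a, b) \in l) small_ints) small_ints.
  by vm_compute.
by move=> ha hb; apply: lev (allP (allP key a ha) b hb).
Qed.

Lemma absB_le (x y : int) : (`|(x - y)%R| <= `|x| + `|y|)%N.
Proof. lia. Qed.

(** For a centred t the right-hand side is at most b^2/4 + 3b, which is below b^2 exactly when b >
    4. The 3 bounds the coefficient e of the descent; entries up to 4 are left to the finite
    check. *)
Lemma descent_bound (x b t : nat) : (x * b <= t * t + 3 * b)%N ->
  (4 < b)%N -> (2 * t <= b)%N -> (x < b)%N.
Proof.
move=> h b4 tb; rewrite ltnNge; apply/negP => bx.
have h1 : (b * b <= x * b)%N by rewrite leq_mul2r bx orbT.
have h2 : (2 * t * (2 * t) <= b * b)%N by rewrite leq_mul.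
have h3 : (5 * b <= b * b)%N by rewrite leq_mul2r b4 orbT.
by lia.
Qed.

(** Legendre's descent on |a| + |b|. The coefficients e and f carry the possible factor 3, so that a
    and b can be kept prime to 3: an odd prime dividing b is then above 3, where the trivial symbol
    makes e a a square. *)
Lemma same_reduce (n : nat) (a b e f : int) : (`|a| + `|b| <= n)%N ->
  a != 0 -> b != 0 -> e \in [:: 1; 3] -> f \in [:: 1; 3] ->
  (forall p, prime p -> (3 < p)%N -> hs p (e * a) (f * b) = false) ->
  exists2 c, c \in canonical_symbols & same (e * a) (f * b) c.1 c.2.
Proof.
elim: n a b e f => [|n IH] a b e f; first by lia.
move=> hn a0 b0 he hf hp.
have ef0 g : g \in [:: 1; 3 : int] -> g != 0 by rewrite !inE => /orP[] /eqP ->.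
have e0 := ef0 e he; have f0 := ef0 f hf.
have step a' b' e' f' : same (e * a) (f * b) (e' * a') (f' * b') ->
    (`|a'| + `|b'| < `|a| + `|b|)%N -> e' \in [:: 1; 3] -> f' \in [:: 1; 3] ->
    exists2 c, c \in canonical_symbols & same (e * a) (f * b) c.1 c.2.
  move=> hs' lt he' hf'; have [/and4P[_ _ ea0' fb0'] _ hh _] := hs'.
  have [||||||c cc hc] := IH a' b' e' f' => //.
  - by rewrite -ltnS; apply: leq_trans hn.
  - by apply: contraNneq ea0' => ->; rewrite mulr0.
  - by apply: contraNneq fb0' => ->; rewrite mulr0.
  - move=> p pp p3; rewrite -hh ?hp //.
    by apply: contraLR p3 => /(prime_oddPn pp) ->.
  by exists c => //; apply: same_trans hc.
wlog le_ab : a b e f hn a0 b0 he hf hp e0 f0 step / (`|a| <= `|b|)%N.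
  move=> W; have [le|/ltnW le] := leqP `|a| `|b|; first exact: W.
  have [|||c cc hc] := W b a f e _ b0 a0 hf he _ f0 e0 _ le.
  - by rewrite addnC.
  - by move=> p pp p3; rewrite hsC hp.
  - move=> a' b' e' f' h lt he' hf'.
    have [/and4P[h1 h2 h3 h4] _ _ _] := h.
    have [||//|//|c cc hc] := step b' a' f' e'.
    + apply: same_trans (same_swap h3 h4); apply: same_trans h.
      exact: same_swap.
    + by rewrite addnC [X in (_ < X)%N]addnC.
    exists c => //; apply: same_trans hc; apply: same_swap => //.
  exists c => //; apply: same_trans hc; apply: same_swap.
  + by rewrite mulf_neq0.
  + by rewrite mulf_neq0.
have ea0 : e * a != 0 by rewrite mulf_neq0.
have fb0 : f * b != 0 by rewrite mulf_neq0.
have move_b b' f' : b' != 0 -> f' \in [:: 1; 3] -> (`|b'| < `|b|)%N ->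
    same (e * a) (f * b) (e * a) (f' * b') ->
    exists2 c, c \in canonical_symbols & same (e * a) (f * b) c.1 c.2.
  by move=> b0' hf' lt h; apply: step h _ he hf'; rewrite ltn_add2l.
have move_a a' e' : a' != 0 -> e' \in [:: 1; 3] -> (`|a'| < `|a|)%N ->
    same (f * b) (e * a) (f * b) (e' * a') ->
    exists2 c, c \in canonical_symbols & same (e * a) (f * b) c.1 c.2.
  move=> a0' he' lt h; apply: (@step a' b e' f) => //; last by rewrite ltn_add2r.
  have [/and4P[h1 h2 h3 h4] _ _ _] := h.
  apply: same_trans (same_swap h3 h4); apply: same_trans h.
  exact: same_swap.
(* A square factor is dropped, and a factor 3 is moved into the coefficient, where 3 times 3
   disappears as a square; otherwise the entry is already squarefree and prime to 3. *)
have strip x g y : x != 0 -> g \in [:: 1; 3] -> y != 0 ->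
    (exists x' g', [/\ x' != 0, g' \in [:: 1; 3], (`|x'| < `|x|)%N &
       same y (g * x) y (g' * x')]) \/ sqfree x /\ ~~ (3 %| x)%Z.
  move=> x0 hg y0; have g0 := ef0 g hg.
  have [h3|n3] := boolP (3 %| x)%Z.
    left; have /dvdzP [x' hx'] := h3.
    have x0' : x' != 0 by apply: contraNneq x0 => h; rewrite hx' h mul0r.
    move: hg; rewrite !inE => /orP[] /eqP eg.
      exists x', 3; split=> //; first by lia.
      rewrite eg mul1r hx' mulrC; apply: same_refl => //.
      by rewrite mulf_neq0.
    exists x', 1; split=> //; first by lia.
    rewrite eg mul1r hx' (_ : 3 * (x' * 3) = 3%:Z ^+ 2 * x'); last by ring.
    exact: same_sqr.
  have [h|[p [x' [pp hx x0']]]] := sqfreePn x0; first by right.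
  left; exists x', g; split=> //.
    rewrite hx; have := prime_gt1 pp; rewrite abszM abszX /=.
    have : (0 < `|x'|)%N by rewrite absz_gt0.
    by nia.
  rewrite hx mulrCA; apply: same_sqr => //; first by rewrite mulf_neq0.
  by rewrite -lt0n prime_gt0.
have [[b' [f' [? ? ? ?]]]|[sb b3]] := strip b f _ b0 hf ea0; first exact: (@move_b b' f').
have [[a' [e' [? ? ? ?]]]|[sa a3]] := strip a e _ a0 he fb0; first exact: (@move_a a' e').
have small x g : x != 0 -> sqfree x -> ~~ (3 %| x)%Z -> g \in [:: 1; 3] -> (`|x| <= 4)%N ->
    g * x \in small_ints.
  move=> x0 sx x3 hg h; have := sx 2%N isT.
  have : x \in [:: 1; -1; 2; -2; 3; -3; 4; -4] by rewrite !inE; lia.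
  move: x3; rewrite !inE => x3 /or4P[||| /orP[|/or4P[]]] /eqP hx; move: x3; rewrite ?hx => x3 h4;
  by move: hg x3 h4; rewrite !inE => /orP[] /eqP ->.
have [le4|gt4] := leqP `|b| 4.
  by apply: small_same; apply: small => //; apply: leq_trans le_ab le4.
(* Since e a = t^2 modulo b, the entry b is replaced by the smaller (t^2 - e a) / b. *)
have bg : (0 < `|b|)%N by rewrite absz_gt0.
have [||t0 ht0] := @sqrt_mod_sqfree (e * a) `|b|%N bg.
- by move=> p pp; have := sb p pp; rewrite !dvdzE.
- move=> p pp pb; have pbz : (p %| b)%Z by rewrite dvdzE.
  have [pa|pa] := boolP (p %| e * a)%Z.
    by exists 0; rewrite expr0n sub0r rpredN.
  have [p2|op] := even_prime pp.
    exists 1; move: pa; rewrite p2; lia.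
  have p3 : (3 < p)%N.
    have := prime_gt1 pp; move: pbz op b3; case: p {pb pa} pp => [|[|[|[|]]]] //=.
    by move=> _ ->.
  have := hp p pp p3; rewrite /hs (vz_ndvd pp pa) /= (unonres_ndvd pp pa) !addbF.
  have pf : ~~ (p %| f)%Z.
    move: hf; rewrite !inE dvdzE => /orP[] /eqP -> /=; apply/negP => /dvdn_leq.
      by move=> /(_ isT); lia.
    by move=> /(_ isT); lia.
  rewrite (vzM p f0 b0) (sqfree_vz pp sb pbz) (vz_ndvd pp pf) /= => /negbT.
  exact: nonresPn.
have [t ht lt] := centered_residue t0 bg.
have : (`|b|%N %| t ^+ 2 - e * a)%Z.
  have -> : t ^+ 2 - e * a = (t - t0) * (t + t0) + (t0 ^+ 2 - e * a) by ring.
  by rewrite rpredD // dvdz_mulr.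
rewrite dvdzE absz_nat -dvdzE => /dvdzP [b' hb'].
(* Here e a is a square, so the algebra splits: with a replaced by 1, the identity 4c = (c + 1)^2 -
   (c - 1)^2 for c = f b replaces b by 4, and then by 1. *)
have [b'0|b'0] := eqVneq b' 0.
  have et : e * a = t ^+ 2 by apply/eqP; rewrite eq_sym -subr_eq0 hb' b'0 mul0r.
  have t0' : t != 0 by apply: contraNneq ea0 => h; rewrite et h.
  exists (1, 1) => //=; rewrite et -[t ^+ 2]mulr1.
  have h1 : same (t ^+ 2 * 1) (f * b) 1 (f * b).
    have t1 : t ^+ 2 * 1 != 0 by rewrite mulr1 expf_neq0.
    apply: same_trans (same_swap t1 fb0) _.
    by apply: same_trans (same_swap fb0 _) => //; apply: same_sqr.
  apply: same_trans h1 _.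
  apply: same_trans (same_sqr (k := 2) _ _ _) => //.
  apply: (@same_move _ _ _ (f * b + 1) (f * b - 1)) => //; ring.
apply: (@move_b b' f) => //.
  apply: (@descent_bound _ `|b| `|t|) => //.
  have := absB_le (t ^+ 2) (e * a).
  rewrite hb' expr2 !abszM => /leq_trans; apply; rewrite leq_add2l leq_mul //.
  by move: he; rewrite !inE => /orP[] /eqP ->.
apply: (@same_move _ _ _ (f * t) f) => //; first by rewrite mulf_neq0.
have -> : f * b * (f * b') = f ^+ 2 * (b' * b) by ring.
by rewrite -hb'; ring.
Qed.

(** The four canonical symbols are separated by the sign and the symbol at 3, so these two
    invariants select the one reached by the descent. *)
Lemma same_canonical (a b : int) : a != 0 -> b != 0 ->
  (forall p, prime p -> (3 < p)%N -> hs p a b = false) ->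
  same a b (if (a < 0) && (b < 0) then -1 else if hs 3 a b then -1 else 1)
    (if hs 3 a b then if (a < 0) && (b < 0) then -3 else 3
     else if (a < 0) && (b < 0) then -1 else 1).
Proof.
move=> a0 b0 h.
have [||||||c cc hc] := @same_reduce (`|a| + `|b|) a b 1 1 => //.
  by move=> p; rewrite !mul1r; apply: h.
have := hc; rewrite !mul1r; case=> _ _ /(_ 3%N isT isT) -> ->.
have e1 : hs 3 1 1 = false by vm_compute.
have e2 : hs 3 (-1)%R (-1)%R = false by vm_compute.
have e3 : hs 3 (-1)%R (-3)%R = true by vm_compute.
have e4 : hs 3 (-1)%R 3 = true by vm_compute.
move: cc hc; rewrite !mul1r !inE => /or4P[] /eqP ->;
  by rewrite [_.1]/= [_.2]/= ?(e1, e2, e3, e4).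
Qed.

(** * Norms from imaginary quadratic fields with bounded denominator *)

Lemma clear_denominator (x : rat) : exists2 d : int, d != 0 & exists u : int,
  d%:~R * x = u%:~R.
Proof.
by exists (denq x); rewrite ?denq_neq0 //; exists (numq x); rewrite numqE mulrC.
Qed.

(** The hypothesis reads 1 + m x^2 = c (y^2 + m z^2), so c is a quotient of two norms from
    Q(sqrt(-m)), hence a norm. *)
Lemma norm_of_rep1 (m c : int) : 0 < m -> rep (- m) c 1 ->
  exists u v w : int, w != 0 /\ c * w ^+ 2 = u ^+ 2 + m * v ^+ 2.
Proof.
move=> m0 [x [y [z e]]].
pose M : rat := m%:~R; have M0 : 0 < M by rewrite ltr0z.
pose N := y ^+ 2 + M * z ^+ 2; pose C : rat := c%:~R.
have e1 : 1 + M * x ^+ 2 = C * N.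
  by rewrite {1}e rmorphN -/M -/C /N; ring.
have N0 : N != 0.
  apply: contra_eqN e1 => /eqP ->; rewrite mulr0; apply: lt0r_neq0.
  by rewrite ltr_pwDl // mulr_ge0 ?sqr_ge0 // ltW.
have e2 : C * N ^+ 2 = (y - M * x * z) ^+ 2 + M * (z + x * y) ^+ 2.
  have -> : C * N ^+ 2 = (1 + M * x ^+ 2) * N by rewrite e1; ring.
  by rewrite /N; ring.
move: e2 N0; move: (y - _) (z + _) => p q e2 N0.
have [d1 d10 [n1 en1]] := clear_denominator p.
have [d2 d20 [n2 en2]] := clear_denominator q.
have [d3 d30 [n3 en3]] := clear_denominator N.
exists (n1 * d2 * d3), (n2 * d1 * d3), (n3 * d1 * d2); split.
  rewrite !mulf_neq0 // -(intr_eq0 rat) -en3 mulf_neq0 // intr_eq0 //.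
apply: (@intr_inj rat); rewrite !expr2 !(intrD, intrM) -en1 -en2 -en3 -/M -/C.
transitivity (C * N ^+ 2 * (d3%:~R * d1%:~R * d2%:~R) ^+ 2); first by ring.
by rewrite e2; ring.
Qed.

Lemma floor_sqrt (n : nat) : exists q, (q * q <= n < q.+1 * q.+1)%N.
Proof.
elim: n => [|n [q /andP[h1 h2]]]; first by exists 0.
have [lt|ge] := ltnP n.+1 (q.+1 * q.+1)%N; first by exists q; lia.
by exists q.+1; nia.
Qed.

Lemma Thue (n : nat) (a : int) : (0 < n)%N -> exists r s : int,
  [/\ (r != 0) || (s != 0), (n %| r + a * s)%Z, r ^+ 2 <= n%:Z & s ^+ 2 <= n%:Z].
Proof.
move=> n0; have nz : n%:Z != 0 by rewrite -lt0n.
have [q /andP[q1 q2]] := floor_sqrt n.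
have lt (x : int) : (`|(x %% n)%Z| < n)%N.
  have := modz_ge0 x nz; have := ltz_mod x nz; rewrite ger0_norm //; lia.
pose f (x : 'I_q.+1 * 'I_q.+1) : 'I_n := Ordinal (lt (x.1%:Z + a * x.2%:Z)).
have /injectivePn [x [y nxy fxy]] : ~~ injectiveb f.
  apply/negP => /injectiveP /leq_card; rewrite card_prod !card_ord leqNgt.
  by rewrite q2.
exists (x.1%:Z - y.1%:Z), (x.2%:Z - y.2%:Z).
have b1 := ltn_ord x.1; have b2 := ltn_ord x.2.
have b3 := ltn_ord y.1; have b4 := ltn_ord y.2.
split.
- apply: contraNT nxy; rewrite negb_or !negbK !subr_eq0 => /andP[/eqP[h1] /eqP[h2]].
  by case: x y h1 h2 {fxy b1 b2 b3 b4} => x1 x2 [y1 y2] /= /val_inj -> /val_inj ->.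
- have -> : x.1%:Z - y.1%:Z + a * (x.2%:Z - y.2%:Z)
      = (x.1%:Z + a * x.2%:Z) - (y.1%:Z + a * y.2%:Z) by ring.
  move: fxy => /(congr1 val) /= h; rewrite -eqz_mod_dvd; apply/eqP.
  have := modz_ge0 (x.1%:Z + a * x.2%:Z) nz.
  by have := modz_ge0 (y.1%:Z + a * y.2%:Z) nz; lia.
- move: (nat_of_ord x.1) (nat_of_ord y.1) b1 b3 => i j; nia.
move: (nat_of_ord x.2) (nat_of_ord y.2) b2 b4 => i j; nia.
Qed.

Lemma coprime_inv (v n : int) : coprimez v n -> exists i : int, (n %| v * i - 1)%Z.
Proof.
move=> /eqP h; have [a [b e]] := Bezoutz v n; move: e; rewrite h => e.
exists a; apply/dvdzP; exists (- b); rewrite -e; ring.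
Qed.

(* The ideal-theoretic content: a primitive solution X with denominator w
   generates c b^2 with N b = w, and an element y of the conjugate of b with norm k w turns X
   into X y^2 / w^2, whose denominator k is bounded by Thue's lemma. *)
Lemma bounded_denominator (m c u v w : int) : 0 < m -> w != 0 ->
  c * w ^+ 2 = u ^+ 2 + m * v ^+ 2 ->
  exists u' v' k : int, [/\ 0 < k, k <= m + 1 & c * k ^+ 2 = u' ^+ 2 + m * v' ^+ 2].
Proof.
move=> m0; move: {2}`|w|%N (leqnn `|w|) => N.
elim: N u v w => [|N IH] u v w; first by move=> h; rewrite -absz_eq0; lia.
move=> hN w0 e.
(* A common prime of v and w divides u as well, and the solution can be divided by it. *)
have [cvw|/eqP ncvw] := boolP (coprimez v w); last first.
  have g1 : (1 < `|gcdz v w|)%N.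
    have : (0 < gcdn `|v| `|w|)%N by rewrite gcdn_gt0 !absz_gt0 w0 orbT.
    by move: ncvw; rewrite /gcdz /=; lia.
  have pp := pdiv_prime g1; set p := pdiv _ in pp.
  have pg : (p %| gcdz v w)%Z by rewrite dvdzE pdiv_dvd.
  have /dvdzP [v' hv'] : (p %| v)%Z := dvdz_trans pg (dvdz_gcdl _ _).
  have /dvdzP [w' hw'] : (p %| w)%Z := dvdz_trans pg (dvdz_gcdr _ _).
  have : (p %| u ^+ 2)%Z.
    have -> : u ^+ 2 = p%:Z * (c * w' ^+ 2 * p%:Z - m * v' ^+ 2 * p%:Z).
      by rewrite -[LHS](addrK (m * v ^+ 2)) -e hv' hw'; ring.
    exact: dvdz_mulr.
  rewrite Euclid_dvdzX2 // => /dvdzP [u' hu'].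
  have p0 : p%:Z != 0 by rewrite -lt0n prime_gt0.
  have w0' : w' != 0 by apply: contraNneq w0; rewrite hw' => ->; rewrite mul0r.
  apply: (IH u' v' w') => //.
    rewrite -ltnS; apply: leq_trans hN.
    by rewrite hw' abszM ltn_Pmulr ?absz_gt0 // prime_gt1.
  apply: (mulIf (expf_neq0 2 p0)); move: e; rewrite hu' hv' hw' => e.
  by transitivity (c * (w' * p%:Z) ^+ 2); [ring | rewrite e; ring].
pose n := `|w|%N; have n0 : (0 < n)%N by rewrite absz_gt0.
have en : n%:Z ^+ 2 = w ^+ 2.
  have [->|->] : n%:Z = w \/ n%:Z = - w by rewrite /n; lia.
    by [].
  by rewrite sqrrN.
have cn2 : coprimez v (n%:Z ^+ 2) by rewrite en expr2 coprimezMr cvw.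
have [i hi] := coprime_inv cn2.
(* This is u / v modulo w^2, a square root of -m there. *)
pose rho := u * i.
have [f hf] : exists f, u = rho * v + n%:Z ^+ 2 * f.
  have /dvdzP [f hf] := hi; exists (- (u * f)); rewrite /rho.
  have -> : u * i * v = u * (v * i - 1) + u by ring.
  by rewrite hf; ring.
have [g hg] : exists g, m = n%:Z ^+ 2 * g - rho ^+ 2.
  have h : (n%:Z ^+ 2 %| v ^+ 2 * (rho ^+ 2 + m))%Z.
    have -> : v ^+ 2 * (rho ^+ 2 + m) = n%:Z ^+ 2 * (c - 2 * rho * v * f - n%:Z ^+ 2 * f ^+ 2).
      have -> : n%:Z ^+ 2 * (c - 2 * rho * v * f - n%:Z ^+ 2 * f ^+ 2) =
        c * n%:Z ^+ 2 - ((rho * v + n%:Z ^+ 2 * f) ^+ 2 - (rho * v) ^+ 2) by ring.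
      by rewrite -hf en e; ring.
    exact: dvdz_mulr.
  have /dvdzP [g hg] : (n%:Z ^+ 2 %| rho ^+ 2 + m)%Z.
    by rewrite -(Gauss_dvdzr _ (m := n%:Z ^+ 2) (n := v ^+ 2)) // coprimez_sym expr2 coprimezMl cn2.
  by exists g; rewrite mulrC -hg; ring.
(* The congruence r = -rho s makes the norm of r + s sqrt(-m) a multiple n k of n, and the size
   bounds of Thue's lemma give k <= m + 1. *)
have [r [s [nz /dvdzP [z hz] r2 s2]]] := Thue rho n0.
have er : r = z * n%:Z - rho * s by rewrite -hz; ring.
have [k hk] : exists k, r ^+ 2 + m * s ^+ 2 = n%:Z * k.
  by exists (z ^+ 2 * n%:Z - 2 * z * rho * s + n%:Z * g * s ^+ 2); rewrite hg er; ring.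
have pos : 0 < r ^+ 2 + m * s ^+ 2.
  have sq (x : int) : x != 0 -> 0 < x ^+ 2 by move=> x0; rewrite lt0r expf_neq0 ?sqr_ge0.
  have m0' := ltW m0.
  case/orP: nz => /sq h; first by apply: ltr_pwDl => //; rewrite mulr_ge0 ?sqr_ge0.
  by apply: ltr_wpDl; [exact: sqr_ge0 | exact: mulr_gt0].
have nz0 : 0 < n%:Z by [].
clearbody rho.
(* The coordinates of (u + v sqrt(-m)) (r + s sqrt(-m))^2 / w^2, expanded through z, f and g to
   exhibit them as integers. *)
exists (rho * v * z ^+ 2 - g * rho * v * s ^+ 2 - 2 * g * v * r * s
  + f * (r ^+ 2 - m * s ^+ 2)), (v * z ^+ 2 - v * g * s ^+ 2 + 2 * f * r * s), k.
split.
- by move: pos; rewrite hk pmulr_rgt0.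
- have : n%:Z * k <= n%:Z * (m + 1).
    by rewrite -hk mulrDr mulr1 addrC lerD // mulrC ler_pM2r.
  by rewrite ler_pM2l.
apply: (mulfI (expf_neq0 4 (lt0r_neq0 nz0))).
have -> : n%:Z ^+ 4 * (c * k ^+ 2) = c * n%:Z ^+ 2 * (n%:Z * k) ^+ 2 by ring.
rewrite en e -hk.
have -> x y : n%:Z ^+ 4 * (x ^+ 2 + m * y ^+ 2) = (n%:Z ^+ 2 * x) ^+ 2 + m * (n%:Z ^+ 2 * y) ^+ 2.
  by ring.
have -> : n%:Z ^+ 2 * (v * z ^+ 2 - v * g * s ^+ 2 + 2 * f * r * s) =
   v * (r ^+ 2 - m * s ^+ 2) + 2 * u * r * s.
  by rewrite hf hg er; ring.
have -> : n%:Z ^+ 2 * (rho * v * z ^+ 2 - g * rho * v * s ^+ 2 - 2 * g * v * r * s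
  + f * (r ^+ 2 - m * s ^+ 2)) = u * (r ^+ 2 - m * s ^+ 2) - 2 * m * v * r * s.
  by rewrite hf hg er; ring.
by ring.
Qed.

(** * Primes split in Q(sqrt(-m)) and q-adic square roots of -m *)

Definition split_prime (m : int) (q : nat) : bool :=
  prime q && if q == 2 then (8 %| m + 1)%Z else ~~ (q %| m)%Z && ~~ nonres q (- m).

(** Newton's correction. At 2 the derivative 2 rho is not a unit, so the correction is made at
    2^(N-1): this costs one digit of congruence and needs N > 2. *)
Lemma hensel_step (m : int) (q N : nat) (rho : int) : prime q -> ~~ (q %| m)%Z ->
  (0 < N)%N -> (q = 2 -> 2 < N)%N -> (q%:Z ^+ N %| rho ^+ 2 + m)%Z ->
  exists2 rho', (q%:Z ^+ N.+1 %| rho' ^+ 2 + m)%Z & (q%:Z ^+ N.-1 %| rho' - rho)%Z.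
Proof.
move=> pq qm N0 N2 h; have qrho : ~~ (q %| rho)%Z.
  apply: contra qm => hq; rewrite -(addKr (rho ^+ 2) m) rpredD ?rpredN //.
    by rewrite Euclid_dvdzX2.
  by apply: dvdz_trans (dvdz_exp2l q N0) h.
have /dvdzP [e he] := h.
have [q2|oq] := even_prime pq.
  have {}N2 := N2 q2; rewrite q2 in he qrho *.
  have eN : 2%:Z ^+ N = 2 * 2 ^+ N.-1 by rewrite -exprS prednK.
  exists (rho + 2 ^+ N.-1 * e); last by rewrite addrC addKr dvdz_mulr.
  have -> : (rho + 2 ^+ N.-1 * e) ^+ 2 + m = 2 ^+ N * (e * (rho + 1)) + 2 ^+ N.-1 ^+ 2 * e ^+ 2.
    have -> : m = e * 2%:Z ^+ N - rho ^+ 2 by rewrite -he; ring.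
    by rewrite eN; ring.
  rewrite rpredD //.
    rewrite exprSr dvdz_mul // dvdz_mull //; lia.
  by rewrite dvdz_mulr // -exprM dvdz_exp2l //; lia.
have c2 : coprimez (2 * rho) q.
  rewrite coprimez_sym /coprimez /gcdz -[_ == _]/(coprime _ _) prime_coprime //.
  rewrite -dvdzE Euclid_dvdzM // negb_or qrho andbT dvdzE /=.
  by rewrite gtnNdvd // odd_prime_gt2.
have [i /dvdzP [j hj]] := coprime_inv c2.
exists (rho - q%:Z ^+ N * (i * e)); last first.
  by rewrite addrC addKr rpredN dvdz_mulr // dvdz_exp2l // leq_pred.
have -> : (rho - q%:Z ^+ N * (i * e)) ^+ 2 + m =
    q%:Z ^+ N * (- (2 * rho * i - 1) * e) + q%:Z ^+ N ^+ 2 * (i * e) ^+ 2.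
  have -> : m = e * q%:Z ^+ N - rho ^+ 2 by rewrite -he; ring.
  by ring.
rewrite hj rpredD //.
  by rewrite exprSr dvdz_mul // mulNr rpredN mulrAC dvdz_mull.
by rewrite dvdz_mulr // -exprM dvdz_exp2l //; lia.
Qed.

Lemma hensel (m : int) (q N0 N : nat) (rho : int) : prime q -> ~~ (q %| m)%Z ->
  (0 < N0)%N -> (q = 2 -> 2 < N0)%N -> (q%:Z ^+ N0 %| rho ^+ 2 + m)%Z -> (N0 <= N)%N ->
  exists2 rho', (q%:Z ^+ N %| rho' ^+ 2 + m)%Z & (q%:Z ^+ N0.-1 %| rho' - rho)%Z.
Proof.
move=> pq qm h0 h2 h /subnK <-; elim: (N - N0)%N => [|k [r hr hr']].
  by exists rho => //; rewrite subrr dvdz0.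
have [|q2|r' hr1 hr2] := hensel_step pq qm _ _ hr.
- by rewrite addn_gt0 h0 orbT.
- by apply: leq_trans (h2 q2) _; rewrite leq_addl.
exists r' => //; rewrite -(subrK r r') -addrA rpredD //.
have le : (N0.-1 <= (k + N0).-1)%N by rewrite -!subn1 leq_sub2r ?leq_addl.
exact: dvdz_trans (dvdz_exp2l q le) hr2.
Qed.

Lemma split_prime_sqrt (m : int) (q N : nat) : split_prime m q ->
  exists rho : int, (q%:Z ^+ N %| rho ^+ 2 + m)%Z.
Proof.
move=> /andP[pq hq].
have weaken n : (exists rho : int, (q%:Z ^+ (N + n) %| rho ^+ 2 + m)%Z) ->
    exists rho : int, (q%:Z ^+ N %| rho ^+ 2 + m)%Z.
  by case=> r hr; exists r; apply: dvdz_trans hr; rewrite dvdz_exp2l // leq_addr.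
move: hq; case: eqP => [q2 h8|q2 /andP[qm nr]].
  apply: (weaken 3); have [|||||r hr _] := @hensel m q 3 (N + 3) 1 pq.
  - by rewrite q2; lia.
  - by [].
  - by [].
  - by rewrite q2 expr1n addrC.
  - by rewrite leq_addl.
  by exists r.
have oq : odd q by case: (even_prime pq).
have qm' : ~~ (q %| - m)%Z by rewrite rpredN.
have [r0 hr0] := nonresPn pq oq qm' nr.
apply: (weaken 1); have [||||r hr _] := @hensel m q 1 (N + 1) r0 pq qm => //.
- by rewrite expr1; move: hr0; rewrite opprK.
- by rewrite leq_addl.
by exists r.
Qed.

Lemma vz_dvd (q N : nat) (x : int) : prime q -> x != 0 ->
  (q%:Z ^+ N %| x)%Z = (N <= vz q x)%N.
Proof. by move=> pq x0; rewrite dvdzE abszX pfactor_dvdn // absz_gt0. Qed.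

Lemma vz_gt0 (q : nat) (x : int) : prime q -> x != 0 -> (0 < vz q x)%N = (q %| x)%Z.
Proof. by move=> pq x0; rewrite -vz_dvd // expr1. Qed.

Lemma vz_congr (q N : nat) (x y : int) : prime q -> x != 0 -> (vz q x < N)%N ->
  (q%:Z ^+ N %| x - y)%Z -> y != 0 /\ vz q y = vz q x.
Proof.
move=> pq x0 lt h.
have y0 : y != 0.
  by apply: contraTneq lt => y0; rewrite -leqNgt -vz_dvd // -[x]subr0 -y0.
split=> //; apply/eqP; rewrite eqn_leq; apply/andP; split; last first.
  rewrite -vz_dvd // -[y](subKr x) rpredB //; first by rewrite vz_dvd.
  by apply: dvdz_trans h; apply/dvdz_exp2l/ltnW.
rewrite leqNgt; apply/negP => lt'.
have : (q%:Z ^+ (vz q x).+1 %| (x - y) + y)%Z.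
  apply: rpredD; last by rewrite vz_dvd.
  by apply: dvdz_trans h; apply/dvdz_exp2l.
by rewrite subrK vz_dvd // ltnn.
Qed.

(** * Ternary forms over Q *)

(* The pair (u, v) stands for u + v sqrt(-m). *)
Section QuadraticPairs.
Variable m : int.

Definition pmul (X Y : int * int) : int * int :=
  (X.1 * Y.1 - m * X.2 * Y.2, X.1 * Y.2 + X.2 * Y.1).
Definition pnorm (X : int * int) : int := X.1 ^+ 2 + m * X.2 ^+ 2.
Definition pconj (X : int * int) : int * int := (X.1, - X.2).
Definition pprod (L : seq (int * int)) : int * int := foldr pmul (1, 0) L.
(** The image of the pair under sqrt(-m) -> rho. When rho^2 = -m modulo q^N this approximates one of
    the two embeddings into the q-adic numbers, and -rho gives the other. *)
Definition pphi (rho : int) (X : int * int) : int := X.1 + rho * X.2.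

Lemma pnormM X Y : pnorm (pmul X Y) = pnorm X * pnorm Y.
Proof. by rewrite /pnorm /=; ring. Qed.

Lemma pnorm_conj X : pnorm (pconj X) = pnorm X.
Proof. by rewrite /pnorm sqrrN. Qed.

Lemma pnorm_prod L : pnorm (pprod L) = \prod_(X <- L) pnorm X.
Proof.
elim: L => [|X L IH]; first by rewrite big_nil /pnorm /=; ring.
by rewrite big_cons /= pnormM IH.
Qed.

Lemma pphi_conj rho X : pphi rho (pconj X) = pphi (- rho) X.
Proof. by rewrite /pphi /=; ring. Qed.

Variables (q N : nat) (rho : int).
Hypotheses (pq : prime q) (hrho : (q%:Z ^+ N %| rho ^+ 2 + m)%Z).

(** The difference of the orders at the two primes above q, once N exceeds the valuation of the
    norm. *)
Definition pdiff (X : int * int) : int :=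
  (vz q (pphi rho X))%:Z - (vz q (pphi (- rho) X))%:Z.

Lemma pphi_vz X : pnorm X != 0 -> (vz q (pnorm X) < N)%N ->
  [/\ pphi rho X != 0, pphi (- rho) X != 0 &
      (vz q (pphi rho X) + vz q (pphi (- rho) X))%N = vz q (pnorm X)].
Proof.
move=> X0 lt.
have h : (q%:Z ^+ N %| pnorm X - pphi rho X * pphi (- rho) X)%Z.
  have -> : pnorm X - pphi rho X * pphi (- rho) X = (rho ^+ 2 + m) * X.2 ^+ 2.
    by rewrite /pnorm /pphi; ring.
  exact: dvdz_mulr.
have [] := vz_congr pq X0 lt h; rewrite mulf_eq0 negb_or => /andP[h1 h2].
by rewrite vzM.
Qed.

Lemma pphi_prod r L : (q%:Z ^+ N %| r ^+ 2 + m)%Z ->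
  (q%:Z ^+ N %| pphi r (pprod L) - (\prod_(X <- L) pphi r X)%R)%Z.
Proof.
move=> hr; elim: L => [|X L IH]; first by rewrite big_nil /pphi /= mulr0 addr0 subrr dvdz0.
rewrite big_cons /=.
have -> : pphi r (pmul X (pprod L)) - pphi r X * (\prod_(j <- L) pphi r j)%R
   = pphi r X * (pphi r (pprod L) - (\prod_(j <- L) pphi r j)%R)
     - (r ^+ 2 + m) * (X.2 * (pprod L).2) by rewrite /pphi /=; ring.
by apply: rpredB; [apply: dvdz_mull | apply: dvdz_mulr].
Qed.

Lemma vz_prod (I : Type) (s : seq I) (F : I -> int) : (\prod_(i <- s) F i)%R != 0 ->
  vz q (\prod_(i <- s) F i)%R = (\sum_(i <- s) vz q (F i))%N.
Proof.
elim: s => [|i s IH]; first by rewrite !big_nil /vz logn1.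
by rewrite !big_cons mulf_eq0 negb_or => /andP[h1 h2]; rewrite vzM // IH.
Qed.

Lemma pdiff_prod L : pnorm (pprod L) != 0 -> (vz q (pnorm (pprod L)) < N)%N ->
  pdiff (pprod L) = \sum_(X <- L) pdiff X.
Proof.
move=> L0 lt; have [h1 h2 h3] := pphi_vz L0 lt.
have hN : (q%:Z ^+ N %| (- rho) ^+ 2 + m)%Z by rewrite sqrrN.
have [p1 e1] := @vz_congr q N _ _ pq h1 (leq_ltn_trans (leq_trans (leq_addr _ _) (eq_leq h3)) lt) (pphi_prod L hrho).
have [p2 e2] := @vz_congr q N _ _ pq h2 (leq_ltn_trans (leq_trans (leq_addl _ _) (eq_leq h3)) lt) (pphi_prod L hN).
rewrite /pdiff -e1 -e2 !vz_prod // sumrB; congr (_ - _).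
  by rewrite -natz natr_sum; apply: eq_bigr => X _; rewrite natz.
by rewrite -natz natr_sum; apply: eq_bigr => X _; rewrite natz.
Qed.

End QuadraticPairs.

Lemma sqr_mod8 (x : int) : ~~ (2 %| x)%Z -> (8 %| x ^+ 2 - 1)%Z.
Proof.
move=> h; have [y hy] : exists y, x = 2 * y + 1 by exists ((x - 1) %/ 2)%Z; lia.
have [z hz] : exists z, y * (y + 1) = 2 * z.
  have [/dvdzP [t ht]|o] := boolP (2 %| y)%Z.
    by exists (t * (y + 1)); rewrite ht; ring.
  have /dvdzP [t ht] : (2 %| y + 1)%Z by lia.
  by exists (y * t); rewrite ht; ring.
apply/dvdzP; exists z.
have -> : x ^+ 2 - 1 = 4 * (y * (y + 1)) by rewrite hy; ring.
by rewrite hz; ring.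
Qed.

Lemma two_power (M : int) : 0 < M ->
  (forall q, prime q -> (q %| M)%Z -> q = 2%N) -> ~~ (8 %| M)%Z -> M <= 4.
Proof.
case: M => // M M0 h h8; have Mg : (0 < M)%N by [].
have : (2%N).-nat M by apply/pnatP => // q pq qM; apply/eqP/h.
move=> /part_pnat_id; rewrite p_part => e.
move: h8; rewrite -e dvdzE /=; case: (logn 2 M) => [|[|[|k]]] //.
by rewrite (dvdn_exp2l 2 (isT : 3 <= k.+3)%N).
Qed.

(** Otherwise every odd prime dividing the norm divides m. With g = gcd(U, m), U = g U1 and m = g
    m1, the cofactor M = g U1^2 + m1 V^2 is prime to m, hence a power of 2, and 8 does not divide
    it, since that would make 2 a split prime as required. So g + m1 <= M <= 4, which is impossible
    for a squarefree m > 3. *)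
Lemma ramified_norm (m U V : int) : sqfree m -> 3 < m -> U != 0 -> V != 0 ->
  coprimez U V ->
  exists q, [/\ split_prime m q, (q %| U ^+ 2 + m * V ^+ 2)%Z & (q = 2%N -> ~~ (2 %| U)%Z /\ ~~ (2 %| V)%Z)].
Proof.
move=> sm m3 U0 V0 cUV.
have m0 : m != 0 by lia.
have npr q : prime q -> (q %| U)%Z -> ~~ (q %| V)%Z.
  move=> pq hU; apply/negP => hV; have : (q %| gcdz U V)%Z by rewrite dvdz_gcd hU.
  by rewrite (eqP cUV) (negPf (ndvd1 pq)).
have [//|ns] := boolp.EM (exists q, [/\ split_prime m q, (q %| U ^+ 2 + m * V ^+ 2)%Z & (q = 2%N -> ~~ (2 %| U)%Z /\ ~~ (2 %| V)%Z)]).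
exfalso.
have qm q : prime q -> q != 2%N -> (q %| U ^+ 2 + m * V ^+ 2)%Z -> (q %| m)%Z.
  move=> pq q2 hq; apply: contraT => nqm; case: ns; exists q; split=> //; last by move=> e; rewrite e in q2.
  rewrite /split_prime pq (negPf q2) nqm /=.
  have oq : odd q by case: (even_prime pq) q2 => [->|].
  have nV : ~~ (q %| V)%Z.
    apply/negP => hV; have : (q %| U ^+ 2)%Z.
      rewrite -(addrK (m * V ^+ 2) (U ^+ 2)); apply: rpredB => //.
      by apply: dvdz_mull; rewrite Euclid_dvdzX2.
    by rewrite Euclid_dvdzX2 // => /(npr q pq); rewrite hV.
  have nV2 : ~~ (q %| V ^+ 2)%Z by rewrite Euclid_dvdzX2.
  have nm : ~~ (q %| - m)%Z by rewrite rpredN.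
  have nmV : ~~ (q %| - m * V ^+ 2)%Z by rewrite Euclid_dvdzM // negb_or nm.
  have nU : ~~ (q %| U)%Z.
    apply: contra nmV => hU; have -> : - m * V ^+ 2 = U ^+ 2 - (U ^+ 2 + m * V ^+ 2) by ring.
    by apply: rpredB => //; rewrite Euclid_dvdzX2.
  have : nonres q (U ^+ 2) = nonres q (- m * V ^+ 2).
    by apply: nonres_mod => //; rewrite mulNr opprK.
  by rewrite nonresX2 // nonresM // nonresX2 // addbF => <-.
pose g := gcdz U m.
have [U1 eU] : exists U1, U = U1 * g by apply/dvdzP/dvdz_gcdl.
have [m1 em] : exists m1, m = m1 * g by apply/dvdzP/dvdz_gcdr.
have g0 : 0 < g.
  by rewrite lt0r /g gcdz_eq0 negb_and U0 /=.
have m10 : 0 < m1 by move: m3; rewrite em; nia.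
have U10 : U1 != 0 by apply: contraNneq U0 => h; rewrite eU h mul0r.
pose M := g * U1 ^+ 2 + m1 * V ^+ 2.
have eN : U ^+ 2 + m * V ^+ 2 = g * M by rewrite eU {1}em /M; ring.
have sq1 (x : int) : x != 0 -> 1 <= x ^+ 2.
  by move=> x0; rewrite -gtz0_ge1 lt0r expf_neq0 ?sqr_ge0.
have M1 : g + m1 <= M.
  rewrite /M lerD //.
    by rewrite -[leLHS]mulr1 ler_pM2l // sq1.
  by rewrite -[leLHS]mulr1 ler_pM2l // sq1.
have qUm q : prime q -> (q %| M)%Z -> ~~ (q %| m)%Z.
  move=> pq qM; apply/negP => qdm.
  have qN : (q %| U ^+ 2 + m * V ^+ 2)%Z by rewrite eN dvdz_mull.
  have qU : (q %| U)%Z.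
    rewrite -Euclid_dvdzX2 // -(addrK (m * V ^+ 2) (U ^+ 2)).
    by apply: rpredB => //; apply: dvdz_mulr.
  have qg : (q %| g)%Z by rewrite dvdz_gcd qU.
  have : (q %| m1 * V ^+ 2)%Z.
    rewrite -(addKr (g * U1 ^+ 2) (m1 * V ^+ 2)); apply: rpredD => //.
    by rewrite rpredN; apply: dvdz_mulr.
  rewrite Euclid_dvdzM // Euclid_dvdzX2 // (negPf (npr q pq qU)) orbF => qm1.
  by have := sm q pq; rewrite em expr2 dvdz_mul.
have odd2 : (2 %| M)%Z -> [/\ ~~ (2 %| m)%Z, ~~ (2 %| U)%Z & ~~ (2 %| V)%Z].
  move=> h2; have nm := qUm 2%N isT h2.
  have hN : (2 %| U ^+ 2 + m * V ^+ 2)%Z by rewrite eN dvdz_mull.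
  have h : (2 %| U)%Z = (2 %| V)%Z.
    apply/idP/idP => h.
      have : (2 %| m * V ^+ 2)%Z.
        rewrite -(addKr (U ^+ 2) (m * V ^+ 2)); apply: rpredD => //.
        by rewrite rpredN (Euclid_dvdzX2 _ (isT : prime 2)).
      by rewrite (Euclid_dvdzM _ _ (isT : prime 2)) (negPf nm) (Euclid_dvdzX2 _ (isT : prime 2)).
    rewrite -(Euclid_dvdzX2 _ (isT : prime 2)) -(addrK (m * V ^+ 2) (U ^+ 2)).
    by apply: rpredB => //; apply: dvdz_mull; rewrite (Euclid_dvdzX2 _ (isT : prime 2)).
  have nU : ~~ (2 %| U)%Z by apply/negP => hU; have := npr 2%N isT hU; rewrite -h hU.
  by rewrite -h nU nm.
have M4 : M <= 4.
  apply: two_power.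
  - by apply: lt_le_trans M1; rewrite addr_gt0.
  - move=> q pq qM; apply/eqP; apply: contraT => q2; have := qUm q pq qM.
    by rewrite (qm q pq q2) // eN dvdz_mull.
  apply/negP => h8; have [|nm nU nV] := odd2; first by apply: dvdz_trans h8.
  have hN8 : (8 %| U ^+ 2 + m * V ^+ 2)%Z by rewrite eN dvdz_mull.
  have h1 := sqr_mod8 nU; have h2 := sqr_mod8 nV.
  case: ns; exists 2%N; split=> //; last first.
    by apply: dvdz_trans hN8.
  rewrite /split_prime /=.
  have -> : m + 1 = U ^+ 2 + m * V ^+ 2 - (U ^+ 2 - 1) - m * (V ^+ 2 - 1) by ring.
  by apply: rpredB; [apply: rpredB | apply: dvdz_mull].
have gm : (g == 2) && (m1 == 2) || (m <= 3).
  move: (le_trans M1 M4) g0 m10; rewrite em; move: (g) (m1) => a b h1 h2 h3.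
  have : a = 1 \/ a = 2 \/ a = 3 by lia.
  by case=> [e|[e|e]]; rewrite e in h1 *; lia.
move: gm => /orP[/andP[/eqP g2 /eqP m2]|]; last by lia.
by have := sm 2%N isT; rewrite em g2 m2.
Qed.

Lemma halve_to_odd (n : nat) (k : 'I_n -> int) : (exists i, k i != 0) ->
  exists k' : 'I_n -> int, (exists i, odd `|k' i|%N) /\
    exists2 c : int, c != 0 & forall i, k i = c * k' i.
Proof.
case=> i0; move: {2}`|k i0|%N (leqnn `|k i0|%N) => N.
elim: N k => [|N IH] k; first by move=> h; rewrite -absz_eq0; lia.
move=> hN k0; have [/existsP [i oi]|no] := boolP [exists i, odd `|k i|%N].
  exists k; split; first by exists i.
  by exists 1 => // j; rewrite mul1r.
have hk i : k i = 2 * (k i %/ 2)%Z.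
  have : ~~ odd `|k i|%N by apply: contra no => oi; apply/existsP; exists i.
  by lia.
have [||k' [h [c c0 hc]]] := IH (fun i => (k i %/ 2)%Z).
- by have := hk i0; lia.
- by apply: contraNneq k0 => h0; rewrite hk h0 mulr0.
exists k'; split=> //; exists (2 * c) => [|i]; first by rewrite mulf_neq0.
by rewrite hk hc mulrA.
Qed.

(** A rational dependency, cleared of denominators and divided by a power of 2, stays nontrivial
    modulo 2, which is where it is used. *)
Lemma int_relation (n : nat) (W : 'I_n.+1 -> 'I_n -> int) :
  exists k : 'I_n.+1 -> int, (exists i, odd `|k i|%N) /\
    forall j, \sum_i k i * W i j = 0.
Proof.
pose M : 'M[rat]_(n.+1, n) := \matrix_(i, j) (W i j)%:~R.
have : kermx M != 0.
  rewrite kermx_eq0 /row_free eqn_leq negb_and -ltnNge; apply/orP; right.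
  by rewrite -leqNgt rank_leq_col.
move=> /rowV0Pn [v /sub_kermxP vM v0].
pose d := \prod_i denq (v 0 i).
have d0 : d != 0 by apply/prodf_neq0 => i _; apply: denq_neq0.
have [k hk] : exists k : 'I_n.+1 -> int, forall i, (k i)%:~R = d%:~R * v 0 i.
  exists (fun i => numq (v 0 i) * \prod_(j | j != i) denq (v 0 j)) => i.
  rewrite (_ : d = denq (v 0 i) * \prod_(j | j != i) denq (v 0 j)); last exact: bigD1.
  by rewrite !intrM numqE; ring.
have kW j : \sum_i k i * W i j = 0.
  apply: (@intr_inj rat); rewrite raddf_sum /=.
  under eq_bigr => i _ do rewrite intrM hk -mulrA.
  rewrite -mulr_sumr; have /matrixP /(_ 0 j) := vM; rewrite !mxE => h.
  by rewrite (eq_bigr (fun i => v 0 i * M i j)) ?h ?mulr0 // => i _; rewrite mxE.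
have [i ki] : exists i, k i != 0.
  have /rV0Pn [i vi] := v0.
  by exists i; rewrite -(intr_eq0 rat) hk mulf_neq0 // intr_eq0.
have [k' [ho [c c0 hc]]] := halve_to_odd (ex_intro _ i ki).
exists k'; split=> // j; apply: (mulfI c0); rewrite mulr0 mulr_sumr -[RHS](kW j).
by apply: eq_bigr => l _; rewrite hc mulrA.
Qed.

(** Otherwise, after division by the content, some split prime q divides the norm; equal orders at
    both primes above q make q divide both coordinates or, for q = 2, make 4 divide 2 U with U
    odd. *)
Lemma balanced_pair (m : int) (Y : int * int) : sqfree m -> 3 < m ->
  (forall q, split_prime m q -> exists (N : nat) (rho : int),
     [/\ (vz q (pnorm m Y) < N)%N, (q%:Z ^+ N %| rho ^+ 2 + m)%Z & pdiff q rho Y = 0]) ->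
  Y.1 = 0 \/ Y.2 = 0.
Proof.
move=> sm m3 h; have [|U0] := eqVneq Y.1 0; first by left.
have [|V0] := eqVneq Y.2 0; first by right.
exfalso; pose g := gcdz Y.1 Y.2.
have g0 : g != 0 by rewrite gcdz_eq0 negb_and U0.
have [U eU] : exists U, Y.1 = U * g by apply/dvdzP/dvdz_gcdl.
have [V eV] : exists V, Y.2 = V * g by apply/dvdzP/dvdz_gcdr.
have U0' : U != 0 by apply: contraNneq U0 => e; rewrite eU e mul0r.
have V0' : V != 0 by apply: contraNneq V0 => e; rewrite eV e mul0r.
have cUV : coprimez U V.
  have [a [b e]] := Bezoutz Y.1 Y.2; apply/coprimezP; exists (a, b) => /=.
  by apply: (mulIf g0); rewrite mul1r -[RHS]e eU eV; ring.
have pos (x : int * int) : x.1 != 0 -> pnorm m x != 0.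
  move=> x0; apply: lt0r_neq0; apply: ltr_pwDl; first by rewrite lt0r sqr_ge0 expf_neq0.
  by rewrite mulr_ge0 ?sqr_ge0 //; lia.
have [q [sq qd q2]] := ramified_norm sm m3 U0' V0' cUV.
have pq : prime q by case/andP: sq.
have [N [rho [lt hN hd]]] := h q sq.
have eY : pnorm m Y = g ^+ 2 * pnorm m (U, V) by rewrite /pnorm eU eV /=; ring.
have n0 := pos (U, V) U0'.
have lt' : (vz q (pnorm m (U, V)) < N)%N.
  by apply: leq_ltn_trans lt; rewrite eY vzM ?expf_neq0 // leq_addl.
have [p1 p2 e12] := pphi_vz pq hN n0 lt'.
have ephi r : pphi r Y = g * pphi r (U, V) by rewrite /pphi eU eV /=; ring.
have e : vz q (pphi rho (U, V)) = vz q (pphi (- rho) (U, V)).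
  move: hd; rewrite /pdiff !ephi !vzM //; move: (vz q g) (vz q _) (vz q _) => a b c.
  by clear; lia.
have sum : pphi rho (U, V) + pphi (- rho) (U, V) = 2 * U by rewrite /pphi /=; ring.
have vpos : (0 < vz q (pnorm m (U, V)))%N by rewrite vz_gt0.
have [q2'|oq] := even_prime pq.
  have [nU nV] := q2 q2'; subst q.
  have : (3 <= vz 2 (pnorm m (U, V)))%N.
    rewrite -vz_dvd // -[_ ^+ 3]/(8 : int).
    have -> : pnorm m (U, V) = (U ^+ 2 - 1) + m * (V ^+ 2 - 1) + (m + 1).
      by rewrite /pnorm /=; ring.
    have /andP [_ /= h8] := sq.
    apply: rpredD => //; apply: rpredD; first exact: sqr_mod8.
    by apply: dvdz_mull; apply: sqr_mod8.
  rewrite -e12 -e => h3.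
  have : (2%:Z ^+ 2 %| 2 * U)%Z.
    have h4 : (2 <= vz 2 (pphi rho (U, V)))%N.
      by move: h3; move: (vz 2 _) => a; clear; lia.
    by rewrite -sum; apply: rpredD; rewrite vz_dvd // -e.
  by rewrite expr2 dvdz_mul2l // (negPf nU).
have qd1 : (q %| pphi rho (U, V))%Z by rewrite -vz_gt0 //; move: vpos; rewrite -e12 -e addn_gt0 orbb.
have qd2 : (q %| pphi (- rho) (U, V))%Z by rewrite -vz_gt0 // -e vz_gt0.
have nq2 : ~~ (q %| 2)%Z by rewrite dvdzE /= gtnNdvd // odd_prime_gt2.
have qU : (q %| U)%Z.
  by have : (q %| 2 * U)%Z; [rewrite -sum; apply: rpredD | rewrite Euclid_dvdzM // (negPf nq2)].
have qm : ~~ (q %| m)%Z.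
  by case/andP: sq => _; case: eqP => [q2'|_ /andP[]] //; rewrite q2' in oq.
have : (q %| m * V ^+ 2)%Z.
  rewrite -(addKr (U ^+ 2) (m * V ^+ 2)); apply: rpredD => //.
  by rewrite rpredN Euclid_dvdzX2.
rewrite Euclid_dvdzM // (negPf qm) Euclid_dvdzX2 //= => qV.
have : (q %| gcdz U V)%Z by rewrite dvdz_gcd qU.
by rewrite (eqP cUV) (negPf (ndvd1 pq)).
Qed.

(** There is one element more than there are split primes, so the vectors of [pdiff] are dependent.
    With conjugates in place of negative powers, the relation yields a product balanced at every
    split prime, hence an integer or an integer multiple of sqrt(-m). *)
Lemma norm_relation (m : int) (qs : seq nat) (X : 'I_(size qs).+1 -> int * int) :
  sqfree m -> 3 < m -> all (split_prime m) qs ->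
  (forall i, pnorm m (X i) != 0) ->
  (forall i q, split_prime m q -> (q %| pnorm m (X i))%Z -> q \in qs) ->
  exists k : 'I_(size qs).+1 -> nat, (exists i, odd (k i)) /\
    exists U : int, \prod_i pnorm m (X i) ^+ k i = U ^+ 2 \/
                    \prod_i pnorm m (X i) ^+ k i = m * U ^+ 2.
Proof.
move=> sm m3 aqs X0 Xqs.
have m0 : m != 0 by lia.
(* This precision exceeds every valuation involved, with room for the digit lost by Hensel's lemma
   and for its requirement at 2. *)
pose N0 := (4 + \sum_i `|pnorm m (X i)|)%N.
have ltN0 q i : (vz q (pnorm m (X i)) < N0.-1)%N.
  rewrite /N0 /= (bigD1 i) //= addnA addnC ltn_addl // /vz.
  by apply: leq_trans (ltn_logl _ _) (leq_addl _ _); rewrite absz_gt0.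
have N0s q i : (vz q (pnorm m (X i)) < N0)%N by apply: leq_trans (ltN0 q i) (leq_pred _).
pose qj (j : 'I_(size qs)) := nth 0 qs j.
have sqj j : split_prime m (qj j) by apply: (allP aqs); apply: mem_nth.
have [r0 hr0] : exists r0 : 'I_(size qs) -> int, forall j,
    ((qj j)%:Z ^+ N0 %| r0 j ^+ 2 + m)%Z.
  have h j : exists r : int, ((qj j)%:Z ^+ N0 %| r ^+ 2 + m)%Z.
    exact: split_prime_sqrt.
  exact: fin_all_exists h.
have [k [ho hk]] := int_relation (fun i j => pdiff (qj j) (r0 j) (X i)).
pose Z i := if 0 <= k i then X i else pconj (X i).
pose L := flatten [seq nseq `|k i| (Z i) | i <- enum 'I_(size qs).+1].
pose Y := pprod m L.
have sumL F : \sum_(x <- L) F x = \sum_i F (Z i) *+ `|k i| :> int.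
  rewrite big_flatten big_map enumT; apply: eq_bigr => i _.
  by rewrite big_nseq_cond /= iter_addr_0.
have nZ i : pnorm m (Z i) = pnorm m (X i) by rewrite /Z; case: ifP; rewrite ?pnorm_conj.
have nY : pnorm m Y = \prod_i pnorm m (X i) ^+ `|k i|.
  rewrite pnorm_prod big_flatten big_map enumT; apply: eq_bigr => i _.
  by rewrite big_nseq_cond /= iter_mulr_1 nZ.
have Y0 : pnorm m Y != 0 by rewrite nY; apply/prodf_neq0 => i _; rewrite expf_neq0.
exists (fun i => `|k i|%N); split=> //; rewrite -nY.
have [|h|h] := @balanced_pair m Y sm m3; last 2 first.
- by exists Y.2; right; rewrite /pnorm h expr0n add0r.
- by exists Y.1; left; rewrite /pnorm h expr0n mulr0 addr0.
move=> q sq; have pq : prime q by case/andP: sq.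
have sumW N rho : (vz q (pnorm m Y) < N)%N -> (q%:Z ^+ N %| rho ^+ 2 + m)%Z ->
    pdiff q rho Y = \sum_i k i * pdiff q rho (X i).
  move=> lt hN; rewrite (pdiff_prod pq hN Y0 lt) sumL; apply: eq_bigr => i _.
  rewrite /Z; case: ifP => ki; first by rewrite -mulr_natl natz gez0_abs.
  have -> : pdiff q rho (pconj (X i)) = - pdiff q rho (X i).
    by rewrite /pdiff !pphi_conj opprK; ring.
  rewrite mulNrn -mulr_natl natz ltz0_abs ?ltNge ?ki //; ring.
pose N := (N0 + vz q (pnorm m Y)).+1.
have ltN : (vz q (pnorm m Y) < N)%N by rewrite /N ltnS leq_addl.
have [qin|qnin] := boolP (q \in qs); last first.
  have [rho hrho] := @split_prime_sqrt m q N sq.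
  exists N, rho; split=> //; rewrite (sumW N rho) // big1 // => i _.
  have v0 : vz q (pnorm m (X i)) = 0.
    by apply/eqP; rewrite -leqn0 leqNgt vz_gt0 //; apply: contra qnin => h; apply: Xqs h.
  have [|_ _ e] := pphi_vz pq hrho (X0 i); first by rewrite v0.
  rewrite v0 in e; rewrite /pdiff; move: e; case: (vz q _) => //; case: (vz q _) => //.
  by rewrite mulr0.
have ltj : (index q qs < size qs)%N by rewrite index_mem.
pose j := Ordinal ltj.
have eq : qj j = q by rewrite /qj /= nth_index.
have qm : ~~ (q %| m)%Z.
  case/andP: sq => _; case: eqP => [->|_ /andP[] //] h8; lia.
(* The finer root lifts the chosen [r0 j], so both label the primes above q alike and give the
   values of [pdiff] that enter the relation. *)
have [||||rho hrho hr] := @hensel m q N0 N (r0 j) pq qm.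
- by [].
- by [].
- by rewrite -eq.
- by rewrite /N -addnS leq_addr.
exists N, rho; split=> //; rewrite (sumW N rho) // -[RHS](hk j).
apply: eq_bigr => i _; congr (_ * _); rewrite eq.
have hj : (q%:Z ^+ N0 %| r0 j ^+ 2 + m)%Z by rewrite -eq.
have [p1 p2 e] := pphi_vz pq hj (X0 i) (N0s q i).
have cong r r' : (q%:Z ^+ N0.-1 %| r - r')%Z -> pphi r' (X i) != 0 ->
    (vz q (pphi r' (X i)) < N0.-1)%N -> vz q (pphi r (X i)) = vz q (pphi r' (X i)).
  move=> h1 h2 h3.
  have [] // := @vz_congr q N0.-1 (pphi r' (X i)) (pphi r (X i)) pq h2 h3.
  have -> : pphi r' (X i) - pphi r (X i) = - ((r - r') * (X i).2) by rewrite /pphi; ring.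
  by rewrite rpredN; apply: dvdz_mulr.
rewrite /pdiff (cong rho (r0 j)) ?(cong (- rho) (- r0 j)) //.
- by rewrite -opprD rpredN.
- by apply: leq_ltn_trans (ltN0 q i); rewrite -e leq_addl.
by apply: leq_ltn_trans (ltN0 q i); rewrite -e leq_addr.
Qed.

Lemma F2E (a : 'F_2) : a = (a != 0)%:R.
Proof. by case: a => [[|[|]]] // i; apply: val_inj. Qed.

Lemma F2_addb (a b : bool) : (a (+) b)%:R = a%:R + b%:R :> 'F_2.
Proof. by case: a; case: b; apply: val_inj. Qed.

Lemma F2_inj (a b : bool) : a%:R = b%:R :> 'F_2 -> a = b.
Proof. by case: a; case: b. Qed.

Lemma F2_odd (n : nat) : n%:R = (odd n)%:R :> 'F_2.
Proof. by elim: n => //= n IH; rewrite mulrS IH; case: (odd n); apply: val_inj. Qed.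

(** * Genus characters of Q(sqrt(-m)) *)

Section Genera.
Variable m : int.
Hypotheses (sm : sqfree m) (m3 : 3 < m).

Definition genus_primes : seq nat := [seq p <- primes `|m| | odd p].
(** The bound |m| + 1 is that of [bounded_denominator]: the odd split primes of all norms used below
    lie in this list. *)
Definition small_split_primes : seq nat :=
  [seq q <- iota 0 (`|m|.+2) | split_prime m q && odd q].
Definition genus_gens : seq nat := 2 :: genus_primes ++ small_split_primes.
Local Notation T := genus_primes.
Local Notation Pr := genus_gens.

Let m0 : m != 0. Proof. by lia. Qed.

Lemma mem_genus_primes p : (p \in T) = [&& prime p, odd p & (p %| m)%Z].
Proof.
rewrite mem_filter mem_primes dvdzE absz_gt0 m0 /=.
by case: (odd p); rewrite ?andbT ?andbF.
Qed.

Lemma mem_small_split_primes q :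
  (q \in small_split_primes) = [&& split_prime m q, odd q & (q <= `|m|.+1)%N].
Proof. by rewrite mem_filter mem_iota leq0n add0n ltnS -andbA. Qed.

Lemma genus_gens_uniq : uniq Pr.
Proof.
rewrite cons_uniq mem_cat mem_genus_primes mem_small_split_primes /= !andbF.
rewrite cat_uniq !filter_uniq ?primes_uniq ?iota_uniq // andbT.
apply/hasPn => q; rewrite mem_small_split_primes => /and3P[/andP[pq]].
case: eqP => [->//|_ /andP[nq _] _ _].
by rewrite mem_genus_primes (negPf nq) !andbF.
Qed.

Lemma genus_gens_prime q : q \in Pr ->
  prime q /\ [|| q == 2%N, (q %| m)%Z | split_prime m q].
Proof.
rewrite inE mem_cat => /or3P[/eqP->//||].
  by rewrite mem_genus_primes => /and3P[-> _ ->]; rewrite orbT.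
by rewrite mem_small_split_primes => /and3P[/[dup] /andP[-> _] -> _ _]; rewrite !orbT.
Qed.

Local Notation r := (size Pr).
Definition gens_prod (e : 'rV['F_2]_r) : int := \prod_(i | e 0 i != 0) (nth 0%N Pr i)%:Z.

Lemma gens_prod_gt0 e : 0 < gens_prod e.
Proof.
apply: prodr_gt0 => i _; have [pi _] := genus_gens_prime (mem_nth 0%N (ltn_ord i)).
exact: prime_gt0.
Qed.

Lemma dvd_gens_prod e p : prime p -> (p %| gens_prod e)%Z ->
  exists2 i, e 0 i != 0 & p = nth 0%N Pr i.
Proof.
move=> pp; rewrite /gens_prod; elim/big_rec: _ => [|i x ei IH].
  by rewrite (negPf (ndvd1 pp)).
rewrite Euclid_dvdzM // => /orP[|//].
have [pi _] := genus_gens_prime (mem_nth 0%N (ltn_ord i)).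
by rewrite dvdzE /= dvdn_prime2 // => /eqP h; exists i.
Qed.

Lemma vz_gens_prod (e : 'rV_r) (i : 'I_r) : vz (nth 0%N Pr i) (gens_prod e) = (e 0 i != 0).
Proof.
have pP (k : 'I_r) : prime (nth 0%N Pr k) by case: (genus_gens_prime (mem_nth 0%N (ltn_ord k))).
rewrite /gens_prod; have pi : prime (nth 0%N Pr i) by exact: pP.
have ei1 (P : pred 'I_r) : ~~ P i -> vz (nth 0%N Pr i) (\prod_(k | P k) (nth 0%N Pr k)%:Z)%R = 0%N.
  move=> nP; apply: vz_ndvd => //; elim/big_rec: _ => [|k x Pk IH]; first exact: ndvd1.
  rewrite Euclid_dvdzM // negb_or IH andbT dvdzE /= dvdn_prime2 // nth_uniq ?genus_gens_uniq //.
  by apply: contraNneq nP => /val_inj ->.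
have [ei|ei] := boolP (e 0 i != 0); last by rewrite ei1 //.
rewrite (bigD1 i) //= vzM; last 2 first.
- by rewrite -lt0n prime_gt0.
- by apply/prodf_neq0 => k _; rewrite -lt0n prime_gt0.
rewrite ei1 ?eqxx ?andbF // addn0.
by have [] := @vzE _ pi (nth 0%N Pr i)%:Z 1 1; rewrite ?mulr1 ?expr1 //; exact: ndvd1.
Qed.

(** The values of the genus characters c -> (-m, c)_p, for odd p dividing m, at the generators. *)
Definition genus_mx : 'M['F_2]_(r, size T) :=
  \matrix_(i, j) (hs (nth 0%N T j) (- m) (nth 0%N Pr i)%:Z)%:R.

Lemma genus_mxE (e : 'rV_r) (j : 'I_(size T)) :
  (e *m genus_mx) 0 j = (hs (nth 0%N T j) (- m) (gens_prod e))%:R.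
Proof.
have := mem_nth 0%N (ltn_ord j); rewrite mem_genus_primes => /and3P[pp op _].
set p := nth 0%N T j in pp op *.
rewrite mxE /gens_prod (bigID (fun i => e 0 i != 0)) /= [X in _ + X]big1 ?addr0; last first.
  by move=> i; rewrite negbK => /eqP ->; rewrite mul0r.
have gt0 (x : int) : 0 < x -> x != 0 by move/lt0r_neq0.
suff [_ ->] : 0 < (\prod_(i | e 0 i != 0) (nth 0%N Pr i)%:Z)%R /\
    (hs p (- m) (\prod_(i | e 0 i != 0) (nth 0%N Pr i)%:Z)%R)%:R =
    \sum_(i | e 0 i != 0) (hs p (- m) (nth 0%N Pr i)%:Z)%:R :> 'F_2.
  by apply: eq_bigr => i ei; rewrite mxE (F2E (e 0 i)) ei mul1r.
elim/big_rec2: _ => [|i y x ei [x0 IH]].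
  have := hsX2r pp op (- m) (oner_neq0 int); rewrite expr1n => ->.
  by split.
have [pi _] := genus_gens_prime (mem_nth 0%N (ltn_ord i)).
split; first by rewrite mulr_gt0 // ltz_nat prime_gt0.
have q0 : (nth 0%N Pr i)%:Z != 0 by rewrite -lt0n prime_gt0.
by rewrite (hsMr pp op _ q0 (gt0 _ x0)) F2_addb IH.
Qed.

Lemma hs_gens_prod e p : prime p -> odd p -> ~~ (p %| m)%Z ->
  hs p (- m) (gens_prod e) = false.
Proof.
move=> pp op nm; have nm' : ~~ (p %| - m)%Z by rewrite rpredN.
have [pd|nd] := boolP (p %| gens_prod e)%Z; last exact: hs_ndvd.
have [i ei ep] := dvd_gens_prod pp pd.
have [_] := genus_gens_prime (mem_nth 0%N (ltn_ord i)); rewrite -ep (negPf nm).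
have p2 : (p == 2)%N = false by apply: contraTF op => /eqP ->.
rewrite p2 /= /split_prime p2 => /and3P[_ _ nr].
by rewrite /hs (vz_ndvd pp nm') (unonres_ndvd pp nm') (negPf nr) !andbF.
Qed.

(** In the kernel all symbols at odd primes are trivial, and the product c is positive, so
    [same_canonical] splits (-m, c) and c is a norm; [bounded_denominator] then controls k. *)
Lemma gens_prod_norm e : e *m genus_mx = 0 -> exists (u v k : int),
  [/\ 0 < k, k <= m + 1 & gens_prod e * k ^+ 2 = u ^+ 2 + m * v ^+ 2].
Proof.
move=> eH; have c0 := gens_prod_gt0 e.
have h p : prime p -> odd p -> hs p (- m) (gens_prod e) = false.
  move=> pp op; have [pm|] := boolP (p %| m)%Z; last exact: hs_gens_prod.
  have pT : p \in T by rewrite mem_genus_primes pp op pm.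
  have lt : (index p T < size T)%N by rewrite index_mem.
  have := genus_mxE e (Ordinal lt); rewrite eH mxE /= nth_index //.
  by move=> /esym/(@F2_inj _ false).
have nm0 : - m != 0 by rewrite oppr_eq0.
have [|_ hr _ _] := @same_canonical (- m) (gens_prod e) nm0 (lt0r_neq0 c0).
  move=> p pp p3; apply: h => //; case: (even_prime pp) => // p2; by rewrite p2 in p3.
have hneg : (- m < 0) && (gens_prod e < 0) = false by rewrite [gens_prod e < 0]ltNge (ltW c0) andbF.
move: hr; rewrite hneg h // => /(_ 1) [_ hr].
have r1 : rep 1 1 1 by exists 1, 0, 0; rewrite expr0n /= !mulr0 subr0 addr0 expr1n.
have m0' : 0 < m by lia.
have [u [v [w [w0 e']]]] := norm_of_rep1 m0' (hr r1).
exact: bounded_denominator e'.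
Qed.

(** If the rank were smaller, the kernel modulo the class of m would have dimension greater than the
    number of split primes in play. Its products are norms up to bounded squares, and
    [norm_relation] would make a nontrivial F_2-combination of independent vectors equal to 0 or to
    the class of m. *)
Lemma genus_rank : (size T <= \rank genus_mx + split_prime m 2)%N.
Proof.
pose qs := (if split_prime m 2 then [:: 2%N] else [::]) ++ small_split_primes.
have sq : size qs = (split_prime m 2 + size small_split_primes)%N.
  by rewrite size_cat; case: ifP.
have aqs : all (split_prime m) qs.
  rewrite all_cat; apply/andP; split; first by case: ifP => //= ->.
  by apply/allP => q; rewrite mem_small_split_primes => /andP[].
pose K := kermx genus_mx.
have rK : \rank K = (r - \rank genus_mx)%N by rewrite mxrank_ker.
rewrite leqNgt; apply/negP => lt.
have rK2 : ((size qs).+2 <= \rank K)%N.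
  have er : r = (size T + size small_split_primes).+1 by rewrite /= size_cat.
  by have := rank_leq_row genus_mx; move: lt er; rewrite rK sq; lia.
(* The class of the squarefree integer m modulo squares. Passing to a complement of it accounts for
   the second alternative of [norm_relation]. *)
pose mu : 'rV['F_2]_r := \row_i (nth 0%N Pr i %| `|m|)%N%:R.
have mu0 : mu != 0.
  have m1 : (1 < `|m|)%N by lia.
  have pp := pdiv_prime m1.
  have pm : pdiv `|m| \in Pr.
    rewrite inE; have [->//|oq] := even_prime pp.
    by rewrite mem_cat mem_genus_primes pp oq dvdzE pdiv_dvd orbT.
  have lt' : (index (pdiv `|m|) Pr < r)%N by rewrite index_mem.
  apply/rV0Pn; exists (Ordinal lt').
  by rewrite mxE nth_index // pdiv_dvd.
have rD : ((size qs).+1 <= \rank (K :\: mu)%MS)%N.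
  have := mxrank_cap_compl K mu; have := mxrankS (capmxSr K mu).
  have := rank_leq_row mu; lia.
pose D := row_base (K :\: mu)%MS.
pose v (i : 'I_(size qs).+1) : 'rV_r := row (widen_ord rD i) D.
have vD i : (v i <= K :\: mu)%MS by rewrite -(eq_row_base (K :\: mu)%MS) row_sub.
have vH i : v i *m genus_mx = 0.
  by apply/sub_kermxP; apply: submx_trans (vD i) (diffmxSl _ _).
have [X hX] : exists X : 'I_(size qs).+1 -> int * int, forall i, exists k : int,
    [/\ 0 < k, k <= m + 1 & pnorm m (X i) = gens_prod (v i) * k ^+ 2].
  have h i : exists X : int * int, exists k : int,
      [/\ 0 < k, k <= m + 1 & pnorm m X = gens_prod (v i) * k ^+ 2].
    by have [x [y [k [k0 k1 e]]]] := gens_prod_norm (vH i); exists (x, y), k.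
  exact: fin_all_exists h.
have c0 i := lt0r_neq0 (gens_prod_gt0 (v i)).
have X0 i : pnorm m (X i) != 0.
  by have [k [k0 _ ->]] := hX i; rewrite mulf_neq0 // expf_neq0 // lt0r_neq0.
have [|k [[i0 oi0] [U hU]]] := norm_relation sm m3 aqs X0.
  move=> i q spq; have pq : prime q by case/andP: spq.
  have [k [k0 k1 ->]] := hX i; rewrite Euclid_dvdzM // Euclid_dvdzX2 // mem_cat.
  have [q2|oq] := even_prime pq; first by rewrite -q2 spq q2 inE.
  have q2 : (q == 2)%N = false by apply: contraTF oq => /eqP ->.
  have nqm : ~~ (q %| m)%Z by case/andP: spq => _; rewrite q2 => /andP[].
  rewrite orbC => /orP[qk|qc].
    rewrite mem_small_split_primes spq oq /=.
    have : (q <= `|k|)%N by rewrite dvdn_leq ?absz_gt0 ?lt0r_neq0 // -dvdzE.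
    by move: k0 k1 m3; clear; lia.
  have [i1 _ eq] := dvd_gens_prod pq qc.
  have := mem_nth 0%N (ltn_ord i1); rewrite -eq inE q2 mem_cat mem_genus_primes.
  by rewrite (negPf nqm) !andbF /= => ->; rewrite orbT.
have parity j : \sum_i (k i)%:R * v i 0 j =
    (odd (vz (nth 0%N Pr j) (\prod_i pnorm m (X i) ^+ k i)%R))%:R :> 'F_2.
  have pj : prime (nth 0%N Pr j) by case: (genus_gens_prime (mem_nth 0%N (ltn_ord j))).
  rewrite vz_prod; last by apply/prodf_neq0 => i _; rewrite expf_neq0.
  rewrite -F2_odd natr_sum; apply: eq_bigr => i _.
  have -> : vz (nth 0%N Pr j) (pnorm m (X i) ^+ k i) = (k i * vz (nth 0%N Pr j) (pnorm m (X i)))%N.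
    by rewrite /vz abszX lognX.
  rewrite natrM; congr (_ * _); have [l [l0 _ ->]] := hX i.
  have l0' := lt0r_neq0 l0; rewrite vzM ?expf_neq0 // vz_gens_prod expr2 vzM // addnn.
  by rewrite natrD [X in _ + X]F2_odd odd_double addr0 -F2E.
have : (\sum_i (k i)%:R *: v i == 0) || (\sum_i (k i)%:R *: v i == mu).
  case: hU => hU; apply/orP; [left | right]; apply/eqP/rowP => j;
    have pj : prime (nth 0%N Pr j) by [case: (genus_gens_prime (mem_nth 0%N (ltn_ord j)))];
    rewrite summxE; under eq_bigr => i _ do rewrite mxE; rewrite parity hU.
    rewrite mxE; have [->|U0] := eqVneq U 0; first by rewrite expr0n /vz logn0.
    by rewrite expr2 vzM // addnn odd_double.
  have U0 : U != 0.
    have : (\prod_i pnorm m (X i) ^+ k i)%R != 0 by apply/prodf_neq0 => i _; rewrite expf_neq0.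
    by apply: contraNneq => U0; rewrite hU U0 expr0n mulr0.
  rewrite mxE vzM ?expf_neq0 // (expr2 U) vzM // addnn oddD odd_double addbF.
  have [pm|npm] := boolP (nth 0%N Pr j %| m)%Z.
    by rewrite sqfree_vz //; rewrite dvdzE in pm; rewrite pm.
  by rewrite vz_ndvd //; rewrite dvdzE in npm; rewrite (negPf npm).
have sumD : ((\sum_i (k i)%:R *: v i)%R <= K :\: mu)%MS.
  by apply: summx_sub => i _; apply/scalemx_sub/vD.
case/orP => /eqP h; last first.
  have : (mu <= (K :\: mu) :&: mu)%MS by rewrite sub_capmx -{1}h sumD submx_refl.
  by rewrite capmx_diff submx0 (negPf mu0).
have h0 : \sum_i (k i)%:R *: delta_mx 0 (widen_ord rD i) = 0 :> 'rV['F_2]_(\rank (K :\: mu)%MS).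
  apply: (row_free_inj (row_base_free (K :\: mu)%MS)).
  rewrite mul0mx mulmx_suml -[RHS]h; apply: eq_bigr => i _.
  by rewrite -scalemxAl -rowE.
move/rowP/(_ (widen_ord rD i0)): h0; rewrite summxE mxE (bigD1 i0) //= big1 => [|i ni].
  by rewrite !mxE !eqxx mulr1 addr0 F2_odd oi0.
by rewrite !mxE eqxx /= -val_eqE /= eq_sym val_eqE (negPf ni) mulr0.
Qed.

Definition genus_attained (tau : nat -> bool) : Prop := exists c : int,
  [/\ 0 < c, forall p, prime p -> (p %| c)%Z -> [|| p == 2%N, (p %| m)%Z | split_prime m p],
      forall p, p \in T -> hs p (- m) c = tau p &
      forall p, prime p -> odd p -> ~~ (p %| m)%Z -> hs p (- m) c = false].

Lemma genus_attained_row (tau : nat -> bool) (e : 'rV['F_2]_r) :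
  e *m genus_mx = \row_j (tau (nth 0%N T j))%:R -> genus_attained tau.
Proof.
move=> he; exists (gens_prod e); split.
- exact: gens_prod_gt0.
- move=> p pp pd; have [i _ ->] := dvd_gens_prod pp pd.
  by case: (genus_gens_prime (mem_nth 0%N (ltn_ord i))).
- move=> p pT; have lt : (index p T < size T)%N by rewrite index_mem.
  have := genus_mxE e (Ordinal lt); rewrite he mxE /= nth_index // => /esym.
  exact: F2_inj.
by move=> p pp op nm; apply: hs_gens_prod.
Qed.

Lemma genus_exists (tau : nat -> bool) : ~~ split_prime m 2 -> genus_attained tau.
Proof.
move=> ns; have := genus_rank; rewrite (negPf ns) addn0 => rk.
have full : row_full genus_mx by rewrite /row_full eqn_leq rank_leq_col.
have /submxP [e he] := submx_full (\row_j (tau (nth 0%N T j))%:R : 'rV_(size T)) full.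
exact: genus_attained_row (esym he).
Qed.

(** The attained patterns contain a subspace of codimension at most one, and the sum of two patterns
    outside it lies in it. *)
Lemma genus_exists_split (tau0 tau : nat -> bool) :
  [\/ genus_attained tau0, genus_attained tau |
      genus_attained (fun p => tau p (+) tau0 p)].
Proof.
pose rw (t : nat -> bool) : 'rV['F_2]_(size T) := \row_j (t (nth 0%N T j))%:R.
have [/submxP [e he]|n0] := boolP (rw tau0 <= genus_mx)%MS.
  by apply: Or31; apply: genus_attained_row (esym he).
have lt : (\rank genus_mx < \rank (genus_mx + rw tau0)%MS)%N.
  apply: rank_ltmx; rewrite ltmxE addsmxSl /=; apply: contra n0 => h.
  exact: submx_trans (addsmxSr _ _) h.
have full : row_full (genus_mx + rw tau0)%MS.
  rewrite /row_full eqn_leq rank_leq_col /=; have := genus_rank => h.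
  apply: leq_trans h _; apply: leq_trans _ lt.
  by rewrite -[(\rank _).+1]addn1 leq_add2l leq_b1.
have /sub_addsmxP [[u w] /= e] := submx_full (rw tau) full.
have ew : w *m rw tau0 = (w 0 0 != 0)%:R *: rw tau0.
  by rewrite {1}[w]mx11_scalar mul_scalar_mx -F2E.
rewrite ew in e; move: e; case: (w 0 0 != 0) => /= e.
  apply/Or33/(@genus_attained_row _ u); have -> : u *m genus_mx = rw tau + rw tau0.
    rewrite e scale1r -addrA (_ : rw tau0 + rw tau0 = 0) ?addr0 //.
    by apply/rowP => j; rewrite !mxE -F2_addb addbb.
  by apply/rowP => j; rewrite !mxE F2_addb.
apply/Or32/(@genus_attained_row _ u); move: e; by rewrite scale0r addr0 => <-.
Qed.

End Genera.

(** * Representation by x^2 + y^2 + z^2 and x^2 + 3 y^2 + 3 z^2 *)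

Lemma rep_int (a b n : int) : rep a b n%:~R -> exists x y z w : int,
  w != 0 /\ n * w ^+ 2 = a * x ^+ 2 + b * y ^+ 2 - a * b * z ^+ 2.
Proof.
case=> x [y [z e]].
have [d1 d10 [n1 e1]] := clear_denominator x.
have [d2 d20 [n2 e2]] := clear_denominator y.
have [d3 d30 [n3 e3]] := clear_denominator z.
exists (n1 * d2 * d3), (n2 * d1 * d3), (n3 * d1 * d2), (d1 * d2 * d3).
split; first by rewrite !mulf_neq0.
apply: (@intr_inj rat); rewrite !expr2 intrD intrN !intrD !intrM e -e1 -e2 -e3.
ring.
Qed.

Lemma rep_self (a b : int) : rep a b a%:~R.
Proof. by exists 1, 0, 0; rewrite expr1n expr0n /= !mulr0 mulr1 addr0 subr0. Qed.

Lemma even_quadruple (a x y z w : int) : a = 1 \/ a = -3 ->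
  (8 %| x ^+ 2 + w ^+ 2 + a * (y ^+ 2 + z ^+ 2))%Z ->
  [/\ (2 %| x)%Z, (2 %| y)%Z, (2 %| z)%Z & (2 %| w)%Z].
Proof.
have sq (t : int) : exists u, if (2 %| t)%Z then t ^+ 2 = 4 * u else t ^+ 2 = 8 * u + 1.
  have [/dvdzP [s ->]|/sqr_mod8 /dvdzP [s hs]] := boolP (2 %| t)%Z.
    by exists (s ^+ 2); ring.
  by exists s; rewrite mulrC -hs subrK.
have [u1 h1] := sq x; have [u2 h2] := sq y; have [u3 h3] := sq z; have [u4 h4] := sq w.
move=> ha; have {ha} [b ->] : exists b, a = 1 + 4 * b by case: ha => ->; [exists 0 | exists (-1)].
move: h1 h2 h3 h4; case: ifP => _; case: ifP => _; case: ifP => _; case: ifP => _ -> -> -> -> //;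
  by move=> /dvdzP [k hk]; exfalso; move: hk; lia.
Qed.

(** As m = -1 modulo 8, the form x^2 + w^2 + b (y^2 + z^2) is divisible by 8, which makes all four
    variables even; descent on w. *)
Lemma anisotropic_mod8 (m b x y z w : int) : b = 1 \/ b = -3 -> (8 %| m + 1)%Z ->
  x ^+ 2 + b * (y ^+ 2 + z ^+ 2) = m * w ^+ 2 -> w = 0.
Proof.
move=> ha hm; move: {2}`|w|%N (leqnn `|w|) => N.
elim: N x y z w => [|N IH] x y z w; first by lia.
move=> hw e.
have h8 : (8 %| x ^+ 2 + w ^+ 2 + b * (y ^+ 2 + z ^+ 2))%Z.
  have -> : x ^+ 2 + w ^+ 2 + b * (y ^+ 2 + z ^+ 2) = (m + 1) * w ^+ 2.
    by rewrite addrAC e; ring.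
  exact: dvdz_mulr.
have [/dvdzP [x' hx] /dvdzP [y' hy] /dvdzP [z' hz] /dvdzP [w' hw']] := even_quadruple ha h8.
have [->|w0] := eqVneq w 0; first by [].
have : w' = 0.
  apply: (IH x' y' z'); first by move: hw w0; rewrite hw'; clear; lia.
  apply: (@mulfI _ 4) => //; have -> : 4 * (m * w' ^+ 2) = m * w ^+ 2 by rewrite hw'; ring.
  by rewrite -e hx hy hz; ring.
by rewrite hw' => ->; rewrite mul0r.
Qed.

(** If c has the symbols of -1, then (-m, -c) is definite and unramified at odd primes, hence is
    (-1, -1); there -m, the square of a pure quaternion, is minus a sum of three squares. *)
Lemma three_squares_of_attained (m : int) : 3 < m ->
  genus_attained m (fun p => hs p (- m) (-1)%R) ->
  exists x y z w : int, w != 0 /\ m * w ^+ 2 = x ^+ 2 + y ^+ 2 + z ^+ 2.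
Proof.
move=> m3 [c [c0 _ h1 h2]]; have m0 : 0 < m by lia.
have mz : m != 0 by apply: lt0r_neq0.
have h p : prime p -> odd p -> hs p (- m) (- c) = false.
  move=> pp op; rewrite -[- c]mulN1r hsMr //; last exact: lt0r_neq0.
  have [pm|pm] := boolP (p %| m)%Z.
    by rewrite (h1 p) ?addbb // (mem_genus_primes m3) pp op pm.
  by rewrite h2 // hs_ndvd ?rpredN ?ndvdN1 //.
have [|||_ hr _ _] := @same_canonical (- m) (- c).
- by rewrite oppr_eq0.
- by rewrite oppr_eq0 lt0r_neq0.
- move=> p pp p3; apply: h => //; case: (even_prime pp) => // p2; by rewrite p2 in p3.
move: hr; rewrite !oppr_lt0 m0 c0 h // => /(_ (- m)%:~R) [/(_ (rep_self _ _))] /rep_int.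
case=> x [y [z [w [w0 e]]]] _; exists x, y, z, w; split=> //.
by apply: oppr_inj; rewrite -mulNr e; ring.
Qed.

Lemma three_squares (m : int) : sqfree m -> 0 < m -> ~~ (8 %| m + 1)%Z ->
  exists x y z w : int, w != 0 /\ m * w ^+ 2 = x ^+ 2 + y ^+ 2 + z ^+ 2.
Proof.
move=> sm m0 m8; have [m3|m3] := leP m 3.
  have [->|[->|->]] : m = 1 \/ m = 2 \/ m = 3 by lia.
  - by exists 1, 0, 0, 1.
  - by exists 1, 1, 0, 1.
  by exists 1, 1, 1, 1.
apply: three_squares_of_attained => //; apply: genus_exists => //.
Qed.

(** The same with (-1, -3), which is ramified at 3. If 2 splits, one of three patterns is attained;
    the two unwanted ones would write m w^2 as x^2 + y^2 + z^2 or as x^2 - 3 y^2 - 3 z^2 although m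
    = -1 modulo 8. *)
Lemma one_three_three (m : int) : sqfree m -> 0 < m -> ~~ (3 %| m + 1)%Z ->
  exists x y z w : int, w != 0 /\ m * w ^+ 2 = x ^+ 2 + 3 * y ^+ 2 + 3 * z ^+ 2.
Proof.
move=> sm m0 m3'; have [m3|m3] := leP m 3.
  have [->|[e|->]] : m = 1 \/ m = 2 \/ m = 3 by lia.
  - by exists 1, 0, 0, 1.
  - by rewrite e in m3'.
  by exists 0, 1, 0, 1.
have mz : m != 0 by apply: lt0r_neq0.
have mz' : - m != 0 by rewrite oppr_eq0.
(* If 3 divides m, the pattern tau can prescribe ramification at 3. Otherwise m = 1 modulo 3, so -m
   is a nonresidue and the factor 3 makes (-m, 3) ramified there. *)
pose e : int := if (3 %| m)%Z then 1 else 3.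
have e0 : 0 < e by rewrite /e; case: ifP.
pose tau p := hs p (- m) (- e) (+) (p == 3%N).
have he p : prime p -> odd p -> ~~ (p %| m)%Z -> p != 3%N -> ~~ (p %| e)%Z.
  move=> pp op pm p3; rewrite /e; case: ifP => _; first exact: ndvd1.
  by rewrite dvdzE /= dvdn_prime2.
have key c f : c != 0 -> f = e \/ f = - e ->
    (forall p, p \in genus_primes m -> hs p (- m) c = hs p (- m) f (+) (p == 3%N)) ->
    (forall p, prime p -> odd p -> ~~ (p %| m)%Z -> hs p (- m) c = false) ->
    ~~ (3 %| c)%Z || (3 %| m)%Z ->
    hs 3 (- m) (f * c) /\
    forall p, prime p -> (3 < p)%N -> hs p (- m) (f * c) = false.
  move=> c0 hf h1 h2 h3.
  have f0 : f != 0 by case: hf => ->; rewrite ?oppr_eq0 lt0r_neq0.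
  have fd p : (p %| f)%Z = (p %| e)%Z by case: hf => ->; rewrite ?rpredN.
  split.
    rewrite hsMr //; have [d3|d3] := boolP (3 %| m)%Z.
      by rewrite (h1 3%N) ?addKb // (mem_genus_primes m3) d3.
    rewrite h2 // addbF /hs vz_ndvd ?rpredN //= addbF unonres_ndvd ?rpredN //.
    have -> : vz 3 f = 1%N.
      by case: hf => ->; rewrite ?vzN /e (negPf d3).
    rewrite (@nonres_mod 3 _ (- m) 2) //; lia.
  move=> p pp p3; have op : odd p by case: (even_prime pp) p3 => // ->.
  have np3 : p != 3%N by apply: contraTneq p3 => ->.
  rewrite hsMr //; have [pm|pm] := boolP (p %| m)%Z.
    by rewrite (h1 p) ?(negPf np3) ?addbF ?addbb // (mem_genus_primes m3) pp op pm.
  by rewrite h2 // hs_ndvd ?rpredN // fd he.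
have fin : genus_attained m tau -> exists x y z w : int,
    w != 0 /\ m * w ^+ 2 = x ^+ 2 + 3 * y ^+ 2 + 3 * z ^+ 2.
  case=> c [c0 h0 h1 h2]; have cz := lt0r_neq0 c0.
  have [||||h3 h4] := key c (- e) cz; [by right | exact: h1 | exact: h2 | |].
    apply/orP; have [|d3] := boolP (3 %| m)%Z; [by right | left].
    apply/negP => /(h0 3%N isT); rewrite (negPf d3) /= => /andP[_ /andP[_]].
    by rewrite (@nonres_mod 3 _ (- m) 2) //; lia.
  have ec0 : - e * c < 0 by rewrite mulNr oppr_lt0 mulr_gt0.
  have [||//|_ hr _ _] := @same_canonical (- m) (- e * c); [by [] | exact: ltr0_neq0 |].
  move: hr; rewrite h3 ec0 oppr_lt0 m0 /= => /(_ (- m)%:~R) [/(_ (rep_self _ _))] /rep_int.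
  case=> x [y [z [w [w0 ew]]]] _; exists x, y, z, w; split=> //.
  by apply: oppr_inj; rewrite -mulNr ew; ring.
have [sp|ns] := boolP (split_prime m 2); last exact/fin/genus_exists.
have m8 : (8 %| m + 1)%Z by case/andP: sp.
have [/three_squares_of_attained|//|] := genus_exists_split sm m3 (fun p => hs p (- m) (-1)%R) tau.
  move=> /(_ m3) [x [y [z [w [w0 ew]]]]]; case/eqP: w0.
  by apply: (@anisotropic_mod8 m 1 x y z) => //; [left | rewrite ew; ring].
case=> c [c0 h0 h1 h2]; have cz := lt0r_neq0 c0.
have [||||h3 h4] := key c e cz; [by left | | exact: h2 | |].
- move=> p pT; rewrite h1 // /tau; move: pT; rewrite (mem_genus_primes m3) => /and3P[pp op _].
  rewrite -[- e]mulN1r hsMr // ?lt0r_neq0 //.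
  by case: (hs p _ _); case: (hs p _ _); case: (p == 3%N).
- apply/orP; have [|d3] := boolP (3 %| m)%Z; [by right | left].
  apply/negP => /(h0 3%N isT); rewrite (negPf d3) /= => /andP[_ /andP[_]].
  by rewrite (@nonres_mod 3 _ (- m) 2) //; lia.
have ec0 : (e * c < 0) = false by rewrite ltNge ltW // mulr_gt0.
have [||//|_ hr _ _] := @same_canonical (- m) (e * c); [by [] | by rewrite mulf_neq0 // lt0r_neq0 |].
move: hr; rewrite h3 ec0 andbF /= => /(_ (- m)%:~R) [/(_ (rep_self _ _))] /rep_int.
case=> x [y [z [w [w0 ew]]]] _; case/eqP: w0.
apply: (@anisotropic_mod8 m (-3) x y z) => //; first by right.
apply: oppr_inj; rewrite -mulNr ew; ring.
Qed.

(** * Orders in number fields *)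

Section NumberField.
Variable K : fieldExtType rat.

Lemma in_alg_int (z : int) : in_alg K z%:~R = z%:~R.
Proof. exact: rmorph_int. Qed.

Lemma nf_int_eq0 (z : int) : (z%:~R == 0 :> K) = (z == 0).
Proof. by rewrite -in_alg_int fmorph_eq0 intr_eq0. Qed.

Lemma nf_nat_eq0 (z : nat) : (z%:R == 0 :> K) = (z == 0)%N.
Proof. by rewrite pmulrn nf_int_eq0. Qed.

Lemma nf_char0 : has_pchar0 K.
Proof.
move=> p; rewrite !inE; apply/negP => /andP[pp].
by rewrite nf_nat_eq0 => /eqP p0; rewrite p0 in pp.
Qed.

Lemma map_intr_in_alg (f : {poly int}) :
  map_poly (in_alg K) (map_poly intr f) = map_poly intr f.
Proof. by rewrite -map_poly_comp; apply: eq_map_poly => z /=; exact: in_alg_int. Qed.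

Definition integral_generator (theta : K) (f : {poly int}) : Prop :=
  [/\ f \is monic, size f = (\dim {:K}).+1, root (map_poly intr f) theta &
      forall x, exists p : {poly rat}, x = (map_poly (in_alg K) p).[theta]].

(** Multiplying a primitive element by the common denominator d of its minimal polynomial q turns
    the coefficients into d^(n-i) q_i, which are integers. *)
Lemma integral_generator_exists : exists theta f, integral_generator theta f.
Proof.
pose t0 := separable_generator 1%AS {:K}%AS.
have e0 : {:K}%VS = <<1; t0>>%VS.
  apply: eq_adjoin_separable_generator; last exact: sub1v.
  by apply/separableP => y _; apply/pcharf0_separable/nf_char0.
have [q eq] := polyOver1P (minPolyOver 1%AS t0).
have mq : q \is monic by rewrite -(map_monic (in_alg K)) -eq monic_minPoly.
pose n := \dim {:K}.
have sq : size q = n.+1.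
  rewrite -(size_map_poly (in_alg K)) -eq size_minPoly; congr _.+1.
  by rewrite /n e0 dim_Fadjoin dimv1 muln1.
pose d := \prod_(i < n.+1) denq q`_i.
have d0 : d != 0 by apply/prodf_neq0 => i _; rewrite denq_neq0.
have dq (i : 'I_n.+1) : exists z : int, z%:~R = d%:~R * q`_i :> rat.
  exists (numq q`_i * \prod_(j < n.+1 | j != i) denq q`_j).
  rewrite (_ : d = denq q`_i * \prod_(j < n.+1 | j != i) denq q`_j); last exact: bigD1.
  by rewrite !intrM numqE; ring.
have coef i : exists z : int, z%:~R = d%:~R ^+ (n - i) * q`_i :> rat.
  have [lt|gt|->] := ltngtP i n; last first.
  - exists 1; rewrite subnn expr0 mul1r; move/monicP: mq; rewrite /lead_coef sq /= => ->.
    by [].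
  - by exists 0; rewrite nth_default ?mulr0 // sq.
  have [z hz] := dq (Ordinal (ltnW lt : (i < n.+1)%N)); rewrite /= in hz.
  exists (d ^+ (n - i).-1 * z); rewrite intrM hz rmorphXn /= mulrA -exprSr.
  by rewrite prednK // subn_gt0.
have [F hF] := boolp.choice coef.
pose f := \poly_(i < n.+1) F i.
have Fn : F n = 1.
  apply: (@intr_inj rat); rewrite hF subnn expr0 mul1r.
  by move/monicP: mq; rewrite /lead_coef sq /= => ->.
have sf : size f = n.+1 by apply: size_poly_eq; rewrite Fn.
pose dK : K := in_alg K d%:~R.
have dK0 : dK != 0 by rewrite fmorph_eq0 intr_eq0.
exists (dK * t0), f; split=> //.
- by rewrite monicE /lead_coef sf coef_poly ltnSn Fn.
- rewrite /root -map_intr_in_alg.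
  rewrite (@horner_coef_wide _ n.+1); last first.
    by rewrite size_map_poly size_map_inj_poly ?sf //; exact: intr_inj.
  have -> : \sum_(i < n.+1) (map_poly (in_alg K) (map_poly intr f))`_i * (dK * t0) ^+ i
     = dK ^+ n * (map_poly (in_alg K) q).[t0].
    rewrite (@horner_coef_wide _ n.+1) ?size_map_poly ?sq // mulr_sumr.
    apply: eq_bigr => i _; rewrite !coef_map /= coef_poly ltn_ord hF.
    rewrite -[(_ * _)%:A]/(in_alg K _) rmorphM rmorphXn exprMn -/dK.
    have -> : dK ^+ n = dK ^+ (n - i) * dK ^+ i by rewrite -exprD subnK // -ltnS.
    by rewrite mulrACA.
  by rewrite -eq (rootP (root_minPoly _ _)) mulr0.
move=> x; have : x \in <<1; t0>>%VS by rewrite -e0 memvf.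
move=> /Fadjoin_polyP [p /polyOver1P [P ->] ->].
exists (P \Po (d%:~R^-1 *: 'X)).
rewrite map_comp_poly horner_comp; congr (_.[_]).
by rewrite map_polyZ hornerZ map_polyX hornerX fmorphV mulKf.
Qed.

Section Generator.
Variables (theta : K) (f : {poly int}).
Hypothesis gen : integral_generator theta f.
Local Notation n := (\dim {:K}).

Lemma generator_minPoly : minPoly 1%AS theta = map_poly intr f.
Proof.
have [mf sf rf sur] := gen.
have full : <<1; theta>>%VS = {:K}%VS.
  apply/eqP; rewrite eqEsubv subvf /=; apply/subvP => x _.
  have [p ->] := sur x; apply/Fadjoin_polyP; exists (map_poly (in_alg K) p) => //.
  by apply/polyOver1P; exists p.
have dv : minPoly 1%AS theta %| map_poly intr f.
  apply: minPoly_dvdp => //; rewrite -map_intr_in_alg.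
  by apply/polyOver1P; eexists.
have mf' : (map_poly intr f : {poly K}) \is monic by exact: monic_map.
apply/eqP; rewrite -eqp_monic ?monic_minPoly //.
rewrite -dvdp_size_eqp // size_minPoly -map_intr_in_alg size_map_poly size_map_poly_id0; last first.
  by rewrite (monicP mf).
by rewrite sf -full dim_Fadjoin dimv1 muln1.
Qed.

Lemma generator_dvd (p : {poly rat}) : (map_poly (in_alg K) p).[theta] = 0 ->
  map_poly intr f %| p.
Proof.
move=> h; rewrite -(dvdp_map (in_alg K)) map_intr_in_alg -generator_minPoly.
apply: minPoly_dvdp; last exact/rootP.
by apply/polyOver1P; exists p.
Qed.

Lemma generator_separable (C : numFieldType) : separable_poly (map_poly intr f : {poly C}).
Proof.
have : separable_element 1%AS theta by apply/pcharf0_separable/nf_char0.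
rewrite /separable_element generator_minPoly -map_intr_in_alg separable_map.
rewrite -(separable_map (@ratr C)) -map_poly_comp.
by rewrite (eq_map_poly (g := intr)) // => z /=; rewrite ratr_int.
Qed.

Section OneEmbedding.
Variables (C : numFieldType) (t : C).
Hypothesis root_t : root (map_poly intr f) t.

Let sur (x : K) : exists p : {poly rat}, x = (map_poly (in_alg K) p).[theta].
Proof. by case: gen. Qed.

(** A polynomial expression of x in theta is chosen; two choices differ by a multiple of f, which
    vanishes at t. *)
Definition generator_emb (x : K) : C :=
  (map_poly ratr (sval (boolp.cid (sur x)))).[t].

Lemma generator_embE (p : {poly rat}) :
  generator_emb (map_poly (in_alg K) p).[theta] = (map_poly ratr p).[t].
Proof.
rewrite /generator_emb; case: boolp.cid => q /= hq.
apply/eqP; rewrite -subr_eq0 -hornerN -hornerD -rmorphB; apply/eqP/rootP.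
have /dvdpP [g ->] : map_poly intr f %| q - p.
  by apply: generator_dvd; rewrite rmorphB hornerD hornerN -hq subrr.
rewrite rmorphM rootM; apply/orP; right; rewrite /= -map_poly_comp.
by rewrite (eq_map_poly (g := intr)) // => z /=; rewrite ratr_int.
Qed.

Fact generator_emb_additive : zmod_morphism generator_emb.
Proof.
move=> x y; have [p ->] := sur x; have [q ->] := sur y.
by rewrite -hornerN -hornerD -rmorphB !generator_embE rmorphB hornerD hornerN.
Qed.

Fact generator_emb_multiplicative : monoid_morphism generator_emb.
Proof.
split.
  rewrite -[X in generator_emb X](hornerC 1 theta) -(rmorph1 (in_alg K)) -map_polyC.
  by rewrite generator_embE map_polyC /= rmorph1 hornerC.
move=> x y; have [p ->] := sur x; have [q ->] := sur y.
by rewrite -hornerM -rmorphM !generator_embE rmorphM hornerM.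
Qed.

HB.instance Definition _ :=
  GRing.isZmodMorphism.Build K C generator_emb generator_emb_additive.
HB.instance Definition _ :=
  GRing.isMonoidMorphism.Build K C generator_emb generator_emb_multiplicative.

Lemma generator_emb_theta : generator_emb theta = t.
Proof.
by rewrite -[X in generator_emb X]hornerX -(map_polyX (in_alg K)) generator_embE map_polyX hornerX.
Qed.

Lemma generator_emb_exists : exists tau : {rmorphism K -> C}, tau theta = t.
Proof. by exists generator_emb; apply: generator_emb_theta. Qed.

End OneEmbedding.

Lemma rmorph_generator (C : numFieldType) (s : {rmorphism K -> C}) (p : {poly rat}) :
  s (map_poly (in_alg K) p).[theta] = (map_poly ratr p).[s theta].
Proof.
rewrite -horner_map -map_poly_comp; congr (_.[_]); apply: eq_map_poly => x.
exact: (fmorph_eq_rat (s \o in_alg K)).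
Qed.

Lemma rmorph_generator_int (C : numFieldType) (s : {rmorphism K -> C}) (p : {poly int}) :
  s (map_poly intr p).[theta] = (map_poly intr p).[s theta].
Proof.
rewrite -horner_map -map_poly_comp; congr (_.[_]); apply: eq_map_poly => x /=.
by rewrite rmorph_int.
Qed.

Lemma generator_embeddings (C : numClosedFieldType) :
  exists tau : 'I_n -> {rmorphism K -> C},
    injective (fun j => tau j theta) /\
    forall s : {rmorphism K -> C}, exists j, s =1 tau j.
Proof.
have [mf sf rf sur] := gen.
have mfC : (map_poly intr f : {poly C}) \is monic by exact: monic_map.
have [rs ers] := closed_field_poly_normal (map_poly intr f : {poly C}).
rewrite (monicP mfC) scale1r in ers.
have urs : uniq rs by rewrite -separable_prod_XsubC -ers generator_separable.
have srs : size rs = n.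
  have : size (map_poly intr f : {poly C}) = n.+1.
    by rewrite size_map_inj_poly //; exact: intr_inj.
  by rewrite ers size_prod_XsubC => -[].
have rt (j : 'I_n) : root (map_poly intr f) (nth 0 rs j).
  by rewrite ers root_prod_XsubC mem_nth // srs.
have [tau ht] := fin_all_exists (fun j => generator_emb_exists (rt j)).
exists tau; split.
  by move=> i j; rewrite !ht => /eqP; rewrite nth_uniq ?srs // => /eqP /val_inj.
move=> s; have : root (map_poly intr f) (s theta).
  by rewrite /root -rmorph_generator_int (rootP rf) rmorph0.
rewrite ers root_prod_XsubC => sin.
have lt : (index (s theta) rs < n)%N by rewrite -srs index_mem.
exists (Ordinal lt) => x; have [p ->] := sur x.
by rewrite !rmorph_generator ht /= nth_index.
Qed.

(** The order Z[theta] stands in for the ring of integers: its elements have integral norms, and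
    every element of K has a nonzero integer multiple in it. *)
Definition in_order (x : K) : Prop := exists p : {poly int}, x = (map_poly intr p).[theta].

Lemma in_orderB x y : in_order x -> in_order y -> in_order (x - y).
Proof. by case=> p -> [q ->]; exists (p - q); rewrite rmorphB hornerD hornerN. Qed.

Lemma in_orderM x y : in_order x -> in_order y -> in_order (x * y).
Proof. by case=> p -> [q ->]; exists (p * q); rewrite rmorphM hornerM. Qed.

Lemma in_order_int (z : int) : in_order z%:~R.
Proof. by exists z%:P; rewrite map_polyC hornerC. Qed.

Lemma in_orderN x : in_order x -> in_order (- x).
Proof. by move=> h; rewrite -sub0r; apply: in_orderB => //; exact: (in_order_int 0). Qed.

Lemma in_orderD x y : in_order x -> in_order y -> in_order (x + y).
Proof. by move=> hx hy; rewrite -[y]opprK; apply: in_orderB => //; exact: in_orderN. Qed.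

Lemma in_order_scale x : exists2 N : int, N != 0 & in_order (N%:~R * x).
Proof.
have [_ _ _ sur] := gen; have [p ->] := sur x.
pose d := \prod_(i < size p) denq p`_i.
have d0 : d != 0 by apply/prodf_neq0 => i _; rewrite denq_neq0.
exists d => //.
exists (\poly_(i < size p) (numq p`_i * \prod_(j < size p | j != i :> nat) denq p`_j)).
rewrite -in_alg_int -hornerZ; congr (_.[_]); apply/polyP => i.
rewrite coefZ !coef_map /= coef_poly; case: ltnP => [lt|ge]; last first.
  by rewrite nth_default // scale0r mulr0.
rewrite -[_ * _]/(in_alg K d%:~R * in_alg K p`_i) -rmorphM -in_alg_int.
congr (in_alg K _).
rewrite (_ : d = denq p`_i * \prod_(j < size p | j != i :> nat) denq p`_j).
  by rewrite !intrM numqE; ring.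
by rewrite /d (bigD1 (Ordinal lt)).
Qed.

Lemma in_order_coords x : in_order x ->
  exists c : 'I_n -> int, x = \sum_(i < n) (c i)%:~R * theta ^+ i.
Proof.
case=> p ->; have [mf sf rf _] := gen.
pose r := Pdiv.Ring.rmodp p f; exists (fun i => r`_i).
have -> : (map_poly intr p).[theta] = (map_poly intr r).[theta].
  rewrite {1}(Pdiv.RingMonic.rdivp_eq mf p) rmorphD rmorphM hornerD hornerM.
  by rewrite (rootP rf) mulr0 add0r.
have sr : (size r <= n)%N.
  by rewrite -ltnS -sf Pdiv.Ring.ltn_rmodpN0 // monic_neq0.
rewrite (@horner_coef_wide _ n); first by apply: eq_bigr => i _; rewrite coef_map.
by rewrite size_map_inj_poly //; move=> a b /eqP; rewrite -subr_eq0 -rmorphB nf_int_eq0 subr_eq0 => /eqP.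
Qed.

Lemma in_order_of_coords (c : 'I_n -> int) : in_order (\sum_(i < n) (c i)%:~R * theta ^+ i).
Proof.
exists (\sum_(i < n) (c i)%:P * 'X^i).
rewrite rmorph_sum horner_sum; apply: eq_bigr => i _.
by rewrite rmorphM /= map_polyC map_polyXn hornerM hornerC hornerXn.
Qed.

(* Multiplication by x on the basis of powers of theta is an integral matrix, which the
   Vandermonde matrix of the conjugates of theta diagonalizes. *)
Lemma in_order_norm (C : numClosedFieldType) (tau : 'I_n -> {rmorphism K -> C}) x :
  injective (fun j => tau j theta) -> in_order x ->
  exists N : int, N%:~R = \prod_j tau j x /\
    forall y, in_order y -> exists2 z, in_order z & x * z = N%:~R * y.
Proof.
move=> inj_tau ox.
have [M hM] : exists M : 'M[int]_n, forall i : 'I_n,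
    theta ^+ i * x = \sum_k (M i k)%:~R * theta ^+ k.
  have h (i : 'I_n) : exists c : 'I_n -> int, theta ^+ i * x = \sum_(k < n) (c k)%:~R * theta ^+ k.
    apply: in_order_coords; apply: in_orderM ox.
    by exists 'X^i; rewrite map_polyXn hornerXn.
  have [c hc] := fin_all_exists h.
  by exists (\matrix_(i, k) c i k) => i; rewrite hc; apply: eq_bigr => k _; rewrite mxE.
pose V : 'M[C]_n := \matrix_(i, j) tau j theta ^+ i.
have detV : \det V != 0.
  have -> : V = Vandermonde n (\row_j tau j theta) by apply/matrixP => i j; rewrite !mxE.
  rewrite det_Vandermonde; apply/prodf_neq0 => i _; apply/prodf_neq0 => j ij.
  rewrite !mxE subr_eq0; apply: contraTneq ij => /inj_tau ->.
  by rewrite ltnn.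
have MV : map_mx intr M *m V = V *m diag_mx (\row_j tau j x).
  apply/matrixP => i j; rewrite mul_mx_diag !mxE -rmorphXn -rmorphM hM rmorph_sum.
  by apply: eq_bigr => k _; rewrite !mxE rmorphM rmorph_int rmorphXn.
exists (\det M); split.
  apply: (mulIf detV); rewrite -det_map_mx -det_mulmx MV det_mulmx mulrC det_diag.
  by congr (_ * _); apply: eq_bigr => j _; rewrite mxE.
move=> y /in_order_coords [c ->].
pose u : 'rV[int]_n := \row_i c i.
exists (\sum_(k < n) ((u *m \adj M) 0 k)%:~R * theta ^+ k); first exact: in_order_of_coords.
have ev (v : 'rV[int]_n) : (\sum_(k < n) (v 0 k)%:~R * theta ^+ k) * x =
    \sum_(k < n) ((v *m M) 0 k)%:~R * theta ^+ k.
  rewrite mulr_suml; under eq_bigr => i _ do rewrite -mulrA hM mulr_sumr.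
  rewrite exchange_big; apply: eq_bigr => k _.
  rewrite mxE rmorph_sum mulr_suml; apply: eq_bigr => i _.
  by rewrite rmorphM mulrA.
rewrite mulrC ev -mulmxA mul_adj_mx mul_mx_scalar mulr_sumr.
by apply: eq_bigr => k _; rewrite !mxE rmorphM mulrA.
Qed.

End Generator.
End NumberField.

(** * Quaternion algebras *)

Section QuatAlgebra.
Variables (K : fieldType) (a b : K).
Local Notation Q := (quat a b).

Definition quat_row (x : Q) : 'rV[K]_4 :=
  \row_(i < 4) nth 0 [:: qcoef0 x; qcoef1 x; qcoef2 x; qcoef3 x] i.

Fact quat_row_linear : linear quat_row.
Proof.
move=> k [x0 x1 x2 x3] [y0 y1 y2 y3]; apply/rowP => i; rewrite !mxE /=.
by case: i => [[|[|[|[|i]]]]].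
Qed.

Fact quat_row_bij : bijective quat_row.
Proof.
exists (fun r : 'rV[K]_4 => @Quat K a b (r 0 0) (r 0 1) (r 0 2%:R) (r 0 3%:R)).
  by case=> x0 x1 x2 x3; rewrite !mxE.
move=> r; apply/rowP => i; rewrite !mxE; case: i => [[|[|[|[|i]]]]] //= lt;
  by congr (r 0 _); apply: val_inj.
Qed.

Fact quat_vector : Vector.axiom 4 Q.
Proof. by exists quat_row; [exact: quat_row_linear | exact: quat_row_bij]. Qed.

HB.instance Definition _ := Lmodule_hasFinDim.Build K Q quat_vector.
HB.instance Definition _ := Algebra_isFalgebra.Build K Q.

Lemma dim_quat : \dim {: Q} = 4.
Proof. by rewrite dimvf. Qed.

Definition qconj (x : Q) : Q :=
  Quat a b (qcoef0 x) (- qcoef1 x) (- qcoef2 x) (- qcoef3 x).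
Definition qnorm (x : Q) : K := qcoef0 x ^+ 2 - a * qcoef1 x ^+ 2
  - b * qcoef2 x ^+ 2 + a * b * qcoef3 x ^+ 2.

Lemma quatP (x y : Q) : qcoef0 x = qcoef0 y -> qcoef1 x = qcoef1 y ->
  qcoef2 x = qcoef2 y -> qcoef3 x = qcoef3 y -> x = y.
Proof. by case: x => ? ? ? ?; case: y => ? ? ? ? /= -> -> -> ->. Qed.

Lemma qmul_conj (x : Q) : x * qconj x = (qnorm x)%:A.
Proof. by case: x => x0 x1 x2 x3; congr Quat; rewrite /qnorm /=; ring. Qed.

Lemma qconj_mul (x : Q) : qconj x * x = (qnorm x)%:A.
Proof. by case: x => x0 x1 x2 x3; congr Quat; rewrite /qnorm /=; ring. Qed.

Lemma qnormM (x y : Q) : qnorm (x * y) = qnorm x * qnorm y.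
Proof. by case: x => x0 x1 x2 x3; case: y => y0 y1 y2 y3; rewrite /qnorm /=; ring. Qed.

Lemma qconjM (x y : Q) : qconj (x * y) = qconj y * qconj x.
Proof. by case: x => x0 x1 x2 x3; case: y => y0 y1 y2 y3; congr Quat; rewrite /=; ring. Qed.

Lemma qsqr (x : Q) : x * x = (qcoef0 x *+ 2) *: x - (qnorm x)%:A.
Proof. by case: x => x0 x1 x2 x3; congr Quat; rewrite /qnorm /=; ring. Qed.

Lemma qconjE (x : Q) : qconj x = (qcoef0 x *+ 2)%:A - x.
Proof. by case: x => x0 x1 x2 x3; congr Quat; rewrite /=; ring. Qed.

Lemma qnorm_alg (k : K) : qnorm (k%:A : Q) = k ^+ 2.
Proof. by rewrite /qnorm /=; ring. Qed.

Lemma qnorm1 : qnorm 1 = 1.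
Proof. by rewrite /qnorm /=; ring. Qed.

Lemma qconjK : involutive qconj.
Proof. by case=> x0 x1 x2 x3; rewrite /qconj /= !opprK. Qed.

Lemma quat_unit (x : Q) : qnorm x != 0 -> x \is a GRing.unit /\ x^-1 = (qnorm x)^-1 *: qconj x.
Proof.
move=> n0; have h1 : x * ((qnorm x)^-1 *: qconj x) = 1.
  by rewrite -scalerAr qmul_conj scalerA mulVf // scale1r.
have h2 : ((qnorm x)^-1 *: qconj x) * x = 1.
  by rewrite -scalerAl qconj_mul scalerA mulVf // scale1r.
have ux : x \is a GRing.unit by apply/unitrP; exists ((qnorm x)^-1 *: qconj x).
by split=> //; rewrite -[LHS]mulr1 -h1 mulKr.
Qed.

Section Hom.
Variables (B : algType K) (I J : B).
Hypotheses (hI : I * I = a%:A) (hJ : J * J = b%:A) (hJI : J * I = - (I * J)).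

Definition quat_hom (x : Q) : B :=
  \sum_(i < 4) quat_row x 0 i *: nth 0 [:: 1; I; J; I * J] i.

Lemma quat_homE (x : Q) : quat_hom x =
  (qcoef0 x)%:A + qcoef1 x *: I + qcoef2 x *: J + qcoef3 x *: (I * J).
Proof.
by rewrite /quat_hom !big_ord_recl big_ord0 !mxE /= addr0 !addrA.
Qed.

Fact quat_hom_linear : linear quat_hom.
Proof.
move=> k x y; rewrite /quat_hom scaler_sumr -big_split; apply: eq_bigr => i _.
by rewrite quat_row_linear !mxE scalerDl scalerA.
Qed.

HB.instance Definition _ := GRing.isLinear.Build K Q B _ quat_hom quat_hom_linear.

Lemma quat_hom_qi : quat_hom (qi a b) = I.
Proof. by rewrite quat_homE /= !scale0r scale1r add0r !addr0. Qed.

Lemma quat_hom_qj : quat_hom (qj a b) = J.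
Proof. by rewrite quat_homE /= !scale0r scale1r !add0r addr0. Qed.

Lemma quat_hom_alg (k : K) : quat_hom k%:A = k%:A.
Proof. by rewrite quat_homE /= !mulr0 !scale0r !addr0 mulr1. Qed.

Fact quat_hom_qiM (y : Q) : quat_hom (qi a b * y) = I * quat_hom y.
Proof.
have -> : qi a b * y = Quat a b (a * qcoef1 y) (qcoef0 y) (a * qcoef3 y) (qcoef2 y).
  by case: y => y0 y1 y2 y3; congr Quat; rewrite /=; ring.
rewrite !quat_homE /= !mulrDr -!scalerAr mulr1 mulrA hI -scalerAl mul1r !scalerA.
rewrite [in RHS](mulrC _ a) [in RHS](mulrC _ a) [in LHS](addrC (_ *: 1)).
by rewrite -!addrA; congr (_ + (_ + _)); rewrite addrC.
Qed.

Fact quat_hom_qjM (y : Q) : quat_hom (qj a b * y) = J * quat_hom y.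
Proof.
have -> : qj a b * y = Quat a b (b * qcoef2 y) (- (b * qcoef3 y)) (qcoef0 y) (- qcoef1 y).
  by case: y => y0 y1 y2 y3; congr Quat; rewrite /=; ring.
rewrite !quat_homE /= !mulrDr -!scalerAr mulr1 hJI mulrA hJI mulNr -mulrA hJ.
rewrite -scalerAr mulr1 !scalerN !scaleNr !scalerA !(mulrC _ b).
by rewrite -addrA addrC addrA.
Qed.

Fact quat_hom_monoid : monoid_morphism quat_hom.
Proof.
split; first by rewrite quat_homE /= !scale0r !addr0 scale1r.
move=> x y; case: x => x0 x1 x2 x3; rewrite quat_coords.
rewrite !mulrDl !linearD /= !mulrDl -!scalerAl !linearZ /= mul1r -(mulrA (qi a b)).
rewrite !(quat_hom_qiM, quat_hom_qjM) quat_hom_qi quat_hom_qj.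
have -> : quat_hom 1 = 1 by rewrite quat_homE /= !scale0r !addr0 scale1r.
by rewrite -!scalerAl mul1r mulrA.
Qed.

HB.instance Definition _ := GRing.isMonoidMorphism.Build Q B quat_hom quat_hom_monoid.

(** The kernel is an ideal, and y -> u = a y + i y i followed by u -> b u + j u j sends y to 4 a b
    times its scalar part. Applied to x, x i, x j and x ij, this kills every coordinate of x. *)
Lemma quat_hom_inj : 2%:R != 0 :> K -> a != 0 -> b != 0 -> injective quat_hom.
Proof.
move=> n2 a0 b0; apply: raddf_inj => x.
have ker0 (y : Q) : quat_hom y = 0 -> qcoef0 y = 0.
  move=> hy; pose u := a *: y + qi a b * y * qi a b.
  have hu : quat_hom u = 0 by rewrite /u linearD linearZ !rmorphM /= hy scaler0 mulr0 mul0r addr0.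
  have : quat_hom (b *: u + qj a b * u * qj a b) = 0.
    by rewrite linearD linearZ !rmorphM /= hu scaler0 mulr0 mul0r addr0.
  have -> : b *: u + qj a b * u * qj a b = (2%:R * 2%:R * a * b * qcoef0 y)%:A.
    by rewrite /u; case: y {hy u hu} => y0 y1 y2 y3; congr Quat; rewrite /=; ring.
  rewrite quat_hom_alg => /eqP; rewrite scaler_eq0 oner_eq0 orbF.
  by rewrite !mulf_eq0 (negPf n2) (negPf a0) (negPf b0) /= => /eqP.
move=> hx.
have kerM (y : Q) : qcoef0 (x * y) = 0 by apply: ker0; rewrite rmorphM /= hx mul0r.
apply: quatP; first exact: ker0.
- have := kerM (qi a b); case: x {hx kerM} => x0 x1 x2 x3 /=.
  rewrite !mulr0 !mulr1 subr0 addr0 add0r => /eqP.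
  by rewrite mulf_eq0 (negPf a0) => /eqP.
- have := kerM (qj a b); case: x {hx kerM} => x0 x1 x2 x3 /=.
  rewrite !mulr0 !mulr1 subr0 addr0 add0r => /eqP.
  by rewrite mulf_eq0 (negPf b0) => /eqP.
have := kerM (qi a b * qj a b).
have -> : qcoef0 (x * (qi a b * qj a b)) = - (a * b * qcoef3 x).
  by case: x {hx kerM} => x0 x1 x2 x3 /=; ring.
by move/eqP; rewrite oppr_eq0 !mulf_eq0 (negPf a0) (negPf b0) => /eqP.
Qed.

Lemma quat_hom_exists : exists g : {lrmorphism Q -> B}, g =1 quat_hom.
Proof. by exists quat_hom. Qed.

End Hom.
End QuatAlgebra.

Section Isomorphisms.
Variable K : fieldType.

Lemma inverse_lrmorphism (A B : algType K) (g : {lrmorphism A -> B}) (h : B -> A) :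
  cancel g h -> cancel h g -> exists h' : {lrmorphism B -> A}, h' =1 h.
Proof.
move=> gK hK.
have lin : linear h by move=> k x y; apply: (can_inj gK); rewrite linearP /= !hK.
have mon : monoid_morphism h.
  by split=> [|x y]; apply: (can_inj gK); rewrite ?rmorph1 ?rmorphM /= !hK.
pose hL := GRing.isLinear.Build K B A _ h lin.
pose hM := GRing.isMonoidMorphism.Build B A h mon.
pose H : {lrmorphism B -> A} := HB.pack h hL hM.
by exists H.
Qed.

Lemma alg_isom_sym (A B : algType K) : alg_isom A B -> alg_isom B A.
Proof.
case=> g [h gK hK]; have [h' e] := inverse_lrmorphism gK hK.
by exists h'; exists g => x; rewrite e ?gK ?hK.
Qed.

Lemma alg_isom_trans (A B C : algType K) : alg_isom A B -> alg_isom B C -> alg_isom A C.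
Proof. by case=> g bg [h bh]; exists (h \o g); apply: bij_comp. Qed.

Lemma lrmorphism_bij (A B : falgType K) (g : {lrmorphism A -> B}) :
  injective g -> \dim {:A} = \dim {:B} -> bijective g.
Proof.
move=> inj_g eqd.
have ker0 : lker (linfun g) == 0%VS by apply/lker0P => x y; rewrite !lfunE; apply: inj_g.
have full : limg (linfun g) = fullv.
  by apply/eqP; rewrite eqEdim subvf /= limg_dim_eq ?eqd // (eqP ker0) capv0.
have sur y : exists x, g x = y.
  have : y \in limg (linfun g) by rewrite full memvf.
  by case/memv_imgP => x _ ->; exists x; rewrite lfunE.
have [h hK] := boolp.choice sur.
by exists h => [x|//]; apply: inj_g; rewrite hK.
Qed.

Lemma alg_isom_dim (A B : falgType K) : alg_isom A B -> \dim {:A} = \dim {:B}.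
Proof.
case=> g bg.
have ker0 : lker (linfun g) == 0%VS.
  by apply/lker0P => x y; rewrite !lfunE; apply: bij_inj.
have full : limg (linfun g) = fullv.
  apply/eqP; rewrite eqEsubv subvf /=; apply/subvP => y _; case: bg => h gK hK.
  by rewrite -[y]hK -lfunE memv_img ?memvf.
by rewrite -full limg_dim_eq // (eqP ker0) capv0.
Qed.

Lemma alg_isom_quat (A : falgType K) (a b : K) (I J : A) :
  2%:R != 0 :> K -> a != 0 -> b != 0 -> \dim {:A} = 4 ->
  I * I = a%:A -> J * J = b%:A -> J * I = - (I * J) -> alg_isom A (quat a b).
Proof.
move=> n2 a0 b0 dA hI hJ hJI; apply: alg_isom_sym.
have [g eg] := quat_hom_exists hI hJ hJI.
exists g; apply: lrmorphism_bij; last by rewrite dim_quat dA.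
by move=> x y; rewrite !eg; apply: quat_hom_inj.
Qed.

Hypothesis n2 : 2%:R != 0 :> K.

Lemma quat_swap (a b : K) : a != 0 -> b != 0 -> alg_isom (quat a b) (quat b a).
Proof.
move=> a0 b0; apply: (alg_isom_quat (I := qj a b) (J := qi a b)) => //.
- exact: dim_quat.
- exact: qj_sqr.
- exact: qi_sqr.
by rewrite qji opprK.
Qed.

Lemma quat_scale_norm (a b r s : K) : a != 0 -> b != 0 -> r ^+ 2 - a * s ^+ 2 != 0 ->
  alg_isom (quat a b) (quat a (b * (r ^+ 2 - a * s ^+ 2))).
Proof.
move=> a0 b0 n0.
apply: (alg_isom_quat (I := qi a b) (J := Quat a b 0 0 r s)) => //.
- by rewrite mulf_neq0.
- exact: dim_quat.
- exact: qi_sqr.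
- by congr Quat; rewrite /=; ring.
by congr Quat; rewrite /=; ring.
Qed.

Lemma quat_sqr_matrix (s b : K) : s != 0 -> b != 0 -> alg_isom (quat (s ^+ 2) b) 'M[K]_2.
Proof.
move=> s0 b0; apply: alg_isom_sym.
pose mx (p q r t : K) : 'M[K]_2 := \matrix_(i, j)
  if i == 0 then if j == 0 then p else q else if j == 0 then r else t.
have mxM p q r t p' q' r' t' : mx p q r t * mx p' q' r' t' =
    mx (p * p' + q * r') (p * q' + q * t') (r * p' + t * r') (r * q' + t * t').
  apply/matrixP => i j; rewrite !mxE !big_ord_recl big_ord0 addr0 !mxE /=.
  by case: ifP; case: ifP.
apply: (alg_isom_quat (I := mx s 0 0 (- s)) (J := mx 0 b 1 0)) => //.
- by rewrite expf_neq0.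
- by rewrite dimvf.
- rewrite mxM; apply/matrixP => i j; rewrite !mxE.
  by case: i => [[|[|i]]] // ?; case: j => [[|[|j]]] // ?; rewrite /=; ring.
- rewrite mxM; apply/matrixP => i j; rewrite !mxE.
  by case: i => [[|[|i]]] // ?; case: j => [[|[|j]]] // ?; rewrite /=; ring.
rewrite !mxM; apply/matrixP => i j; rewrite !mxE.
by case: i => [[|[|i]]] // ?; case: j => [[|[|j]]] // ?; rewrite /=; ring.
Qed.

(** Unless a is already a square, an isotropic vector writes b as a quotient of two norms from
    K(sqrt a), so j can be rescaled to have square 1. *)
Lemma quat_isotropic_matrix (a b : K) (x : quat a b) : a != 0 -> b != 0 ->
  x != 0 -> qnorm x = 0 -> alg_isom (quat a b) 'M[K]_2.
Proof.
move=> a0 b0 x0 nx.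
have [[s es]|ns] := boolp.EM (exists s, a = s ^+ 2).
  have s0 : s != 0 by apply: contraNneq a0 => s0; rewrite es s0 expr0n.
  rewrite es; exact: quat_sqr_matrix.
have aniso (r s : K) : r ^+ 2 - a * s ^+ 2 = 0 -> r = 0 /\ s = 0.
  move=> e; have [s0|s0] := eqVneq s 0.
    by move: e; rewrite s0 expr0n mulr0 subr0 => /eqP; rewrite expf_eq0 => /eqP.
  case: ns; exists (r / s); move/eqP: e; rewrite subr_eq0 => /eqP e.
  by rewrite expr_div_n e mulfK // expf_neq0.
have [x23|n23] := eqVneq (qcoef2 x ^+ 2 - a * qcoef3 x ^+ 2) 0.
  case/eqP: x0; have [e2 e3] := aniso _ _ x23.
  have [|e0 e1] := aniso (qcoef0 x) (qcoef1 x).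
    by rewrite -nx /qnorm e2 e3; ring.
  exact: quatP.
have n01 : qcoef0 x ^+ 2 - a * qcoef1 x ^+ 2 = b * (qcoef2 x ^+ 2 - a * qcoef3 x ^+ 2).
  by apply/eqP; rewrite -subr_eq0 -nx /qnorm; apply/eqP; ring.
pose N := qcoef2 x ^+ 2 - a * qcoef3 x ^+ 2.
pose r := (qcoef0 x * qcoef2 x - a * qcoef1 x * qcoef3 x) / (b * N).
pose s := (qcoef1 x * qcoef2 x - qcoef0 x * qcoef3 x) / (b * N).
have ers : b * (r ^+ 2 - a * s ^+ 2) = 1.
  have -> : b * (r ^+ 2 - a * s ^+ 2) =
      (qcoef0 x ^+ 2 - a * qcoef1 x ^+ 2) * N / (b * N ^+ 2).
    by rewrite /r /s /N; field; rewrite b0 n23.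
  by rewrite n01 -/N; field; rewrite b0 n23.
have rs0 : r ^+ 2 - a * s ^+ 2 != 0.
  by apply: contra_eq_neq ers => ->; rewrite mulr0 eq_sym oner_neq0.
apply: alg_isom_trans (quat_scale_norm a0 b0 rs0) _; rewrite ers.
apply: alg_isom_trans (quat_swap a0 (oner_neq0 _)) _.
by rewrite -(expr1n K 2); apply: quat_sqr_matrix => //; exact: oner_neq0.
Qed.

End Isomorphisms.

Lemma ord2P (i : 'I_2) : i = 0 \/ i = 1.
Proof. by case: i => [[|[|i]]] // h; [left | right]; apply: val_inj. Qed.

Lemma det_mx2 (L : comNzRingType) (M : 'M[L]_2) :
  \det M = M 0 0 * M 1 1 - M 0 1 * M 1 0.
Proof.
rewrite (expand_det_row _ 0) !big_ord_recl big_ord0 /cofactor !det_mx11 !mxE /=.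
have -> : lift ord0 ord0 = 1 :> 'I_2 by apply: val_inj.
have -> : lift 1 0 = 0 :> 'I_2 by apply: val_inj.
have -> : ord0 = 0 :> 'I_2 by apply: val_inj.
by rewrite /bump /= expr0 expr1; ring.
Qed.

Lemma mx2_cayley_hamilton (L : comNzRingType) (M : 'M[L]_2) :
  M *m M = \tr M *: M - (\det M)%:M.
Proof.
apply/matrixP => i j; rewrite !mxE det_mx2 /mxtrace !big_ord_recl !big_ord0 /= !addr0.
have -> : lift ord0 ord0 = 1 :> 'I_2 by apply: val_inj.
have -> : ord0 = 0 :> 'I_2 by apply: val_inj.
by case: (ord2P i) => ->; case: (ord2P j) => ->; rewrite ?eqxx /=; ring.
Qed.

Section QuatMatrix.
Variables (K L : fieldType) (a b : K) (A : falgType K).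
Variables (f : {lrmorphism A -> quat a b}) (iota : {rmorphism K -> L}).
Variable (phi : {rmorphism A -> 'M[L]_2}).
Hypotheses (bf : bijective f) (n2 : 2%:R != 0 :> L) (a0 : a != 0) (b0 : b != 0).
Hypothesis (ext : extends_embedding iota phi).

Lemma phi_scale (k : K) (x : A) : phi (k *: x) = iota k *: phi x.
Proof. by rewrite -[k *: x]mulr_algl rmorphM /= ext -[_ * _]/(_ *m _) mul_scalar_mx. Qed.

(** The images of i, j and ij have trace equal to its own opposite, because i and j anticommute and
    have invertible squares. *)
Lemma phi_trace (x : A) : \tr (phi x) = iota (qcoef0 (f x) *+ 2).
Proof.
have [g fK gK] := bf; pose I := phi (g (qi a b)); pose J := phi (g (qj a b)).
have gE k x0 : g (k *: x0) = k *: g x0 by apply: (can_inj fK); rewrite linearZ /= !gK.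
have gM x0 y0 : g (x0 * y0) = g x0 * g y0 by apply: (can_inj fK); rewrite rmorphM /= !gK.
have gN x0 : g (- x0) = - g x0 by apply: (can_inj fK); rewrite rmorphN /= !gK.
have gD x0 y0 : g (x0 + y0) = g x0 + g y0 by apply: (can_inj fK); rewrite rmorphD /= !gK.
have g1 : g 1 = 1 by apply: (can_inj fK); rewrite rmorph1 gK.
have hI : I *m I = (iota a)%:M by rewrite -[_ *m _]/(_ * _) -rmorphM -gM qi_sqr gE g1 ext.
have hJ : J *m J = (iota b)%:M by rewrite -[_ *m _]/(_ * _) -rmorphM -gM qj_sqr gE g1 ext.
have hJI : J *m I = - (I *m J).
  by rewrite -![_ *m _]/(_ * _) -!rmorphM -!gM qji gN rmorphN.
have ib0 : iota b != 0 by rewrite fmorph_eq0.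
have tr0 (M : 'M[L]_2) : \tr M = - \tr M -> \tr M = 0.
  move=> e; have : 2%:R * \tr M == 0 by rewrite mulr_natl mulr2n {1}e addNr.
  by rewrite mulf_eq0 (negPf n2) => /eqP.
have trN (M : 'M[L]_2) : \tr (- M) = - \tr M by exact: raddfN.
have trI : \tr I = 0.
  apply: tr0; apply: (mulfI ib0).
  have -> : iota b * \tr I = \tr (I *m J *m J) by rewrite -mulmxA hJ mul_mx_scalar mxtraceZ.
  by rewrite mxtrace_mulC mulmxA hJI mulNmx -mulmxA hJ mul_mx_scalar trN mxtraceZ mulrN.
have trJ : \tr J = 0.
  have ia0 : iota a != 0 by rewrite fmorph_eq0.
  apply: tr0; apply: (mulfI ia0).
  have -> : iota a * \tr J = \tr (J *m I *m I) by rewrite -mulmxA hI mul_mx_scalar mxtraceZ.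
  rewrite mxtrace_mulC mulmxA.
  have -> : I *m J = - (J *m I) by rewrite hJI opprK.
  by rewrite mulNmx -mulmxA hI mul_mx_scalar trN mxtraceZ mulrN.
have trIJ : \tr (I *m J) = 0 by apply: tr0; rewrite {1}mxtrace_mulC hJI trN.
have ex : x = (qcoef0 (f x))%:A + qcoef1 (f x) *: g (qi a b) + qcoef2 (f x) *: g (qj a b)
    + qcoef3 (f x) *: (g (qi a b) * g (qj a b)).
  rewrite -{1}[x]fK; case: (f x) => x0 x1 x2 x3.
  by rewrite /= quat_coords !gD !gE gM g1.
rewrite {1}ex !rmorphD /= !phi_scale rmorphM /= !mxtraceD !mxtraceZ trI trJ -[phi (g _) * phi (g _)]/(I *m J) trIJ.
by rewrite !mulr0 !addr0 rmorph1 mxtrace1 mulr_natr mulr2n.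
Qed.

(** The quaternion and its image satisfy quadratic equations with the same trace, so Cayley-Hamilton
    identifies the constant terms, whatever the splitting. *)
Lemma phi_det (x : A) : \det (phi x) = iota (qnorm (f x)).
Proof.
have := mx2_cayley_hamilton (phi x); rewrite phi_trace -[_ *m _]/(_ * _) -rmorphM.
have -> : x * x = (qcoef0 (f x) *+ 2) *: x - (qnorm (f x))%:A.
  apply: (bij_inj bf); rewrite rmorphM rmorphB /= !linearZ /= rmorph1.
  by rewrite scalerN; exact: qsqr.
rewrite rmorphB /= phi_scale ext => /addrI /oppr_inj /matrixP /(_ 0 0).
by rewrite !mxE eqxx !mulr1n.
Qed.

End QuatMatrix.

Section Norm1.
Variables (R : realType) (K : fieldExtType rat) (A : falgType K) (a b : K).
Variables (f : {lrmorphism A -> quat a b}) (sigma : {rmorphism K -> R[i]}).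
Variable (phi : {rmorphism A -> 'M[R[i]]_2}).
Hypotheses (bf : bijective f) (a0 : a != 0) (b0 : b != 0).
Hypothesis (ext : extends_embedding sigma phi).
Variable O : set A.
Hypothesis hO : Z_order O.

Lemma K2_neq0 : 2%:R != 0 :> K. Proof. by rewrite nf_nat_eq0. Qed.

Lemma reduced_norm_one (x : A) : is_reduced_norm 2 x 1 <-> qnorm (f x) = 1.
Proof.
split=> [[_ [L [iota [psi [hpsi]]]]]|h].
  have n2 : 2%:R != 0 :> L by rewrite -(rmorph_nat iota) fmorph_eq0 K2_neq0.
  rewrite (phi_det bf n2 a0 b0 hpsi) => /(fmorph_inj iota) <-.
  by [].
split.
  by rewrite (alg_isom_dim (B := quat a b)) ?dim_quat //; exists f.
exists R[i], sigma, phi; split=> //.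
by rewrite (phi_det bf _ a0 b0 ext) ?h // pnatr_eq0.
Qed.

Lemma norm1_unitsP (x : A) : norm1_units 2 O x <->
  [/\ O x, qnorm (f x) = 1 & O x^-1].
Proof.
split=> [[h1 _ h2 /reduced_norm_one h3]|[h1 h2 h3]]; first by [].
split=> //; last exact/reduced_norm_one.
have [g fK gK] := bf; have n0 : qnorm (f x) != 0 by rewrite h2 oner_neq0.
have [u _] := quat_unit n0; have [y [hy1 hy2]] := unitrP u.
by apply/unitrP; exists (g y); split; apply: (can_inj fK); rewrite rmorphM rmorph1 /= gK.
Qed.

Lemma norm1_units1 : norm1_units 2 O 1.
Proof. by case: hO => O1 _ _ _; apply/norm1_unitsP; rewrite invr1 rmorph1 qnorm1. Qed.

Lemma norm1_unitsV (x : A) : norm1_units 2 O x -> norm1_units 2 O x^-1.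
Proof.
move=> [h1 h2 h3 h4]; have /norm1_unitsP [_ n1 _] : norm1_units 2 O x by [].
apply/norm1_unitsP; split=> //; last by rewrite invrK.
have := qnormM (f x) (f x^-1); rewrite -rmorphM divrr //= rmorph1 qnorm1 n1 mul1r.
by move=> <-.
Qed.

Lemma norm1_unitsM (x y : A) : norm1_units 2 O x -> norm1_units 2 O y ->
  norm1_units 2 O (x * y).
Proof.
move=> hx hy; have [h1 h2 h3 h4] := hx; have [h1' h2' h3' h4'] := hy.
have /norm1_unitsP [_ n1 _] := hx; have /norm1_unitsP [_ n2 _] := hy.
have [_ OM _ _] := hO; apply/norm1_unitsP; split.
- by case: (OM x y h1 h1').
- by rewrite rmorphM /= qnormM n1 n2 mulr1.
by rewrite invrM //; case: (OM y^-1 x^-1 h3' h3).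
Qed.

Lemma nbhs_mxP (M : 'M[R[i]]_2) (V : set 'M[R[i]]_2) : nbhs M V <->
  exists2 e : R[i], 0 < e & forall N : 'M[R[i]]_2, (forall i j, `|M i j - N i j| < e) -> V N.
Proof.
split=> [/nbhs_ballP [e /= e0 he]|[e e0 he]].
  by exists e => // N hN; apply: he; split.
by apply/nbhs_ballP; exists e => //= N [_ hN]; apply: he.
Qed.

Definition near_one (e : R[i]) (M : 'M[R[i]]_2) : Prop :=
  forall i j, `|M i j - (1 : 'M[R[i]]_2) i j| < e.

Lemma discrete_near_one : discrete_set (phi @` norm1_units 2 O)%classic ->
  exists2 e : R[i], 0 < e & forall x, norm1_units 2 O x -> near_one e (phi x) -> phi x = 1.
Proof.
move=> /(_ 1) []; first by exists 1; [exact: norm1_units1 | exact: rmorph1].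
move=> _ [V /nbhs_mxP [e e0 he] eV].
exists e => // x hx hn.
have : (V `&` (phi @` norm1_units 2 O))%classic (phi x).
  by split; [apply: he => i j; rewrite distrC; apply: hn | exists x].
by rewrite eV.
Qed.

(** Isolation of 1 is transported to x by multiplication with x^-1, whose matrix entries are bounded
    by B. *)
Lemma near_one_discrete (e : R[i]) : 0 < e ->
  (forall x, norm1_units 2 O x -> near_one e (phi x) -> x = 1) ->
  discrete_set (phi @` norm1_units 2 O)%classic.
Proof.
move=> e0 he _ [x hx <-]; split; first by apply/mem_set; exists x.
have ux : x \is a GRing.unit by case: hx.
pose B := 1 + \sum_i \sum_j `|phi x^-1 i j|.
have B0 : 0 < B by rewrite ltr_pwDl // sumr_ge0 // => i _; rewrite sumr_ge0.
have leB i j : `|phi x^-1 i j| <= B.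
  apply: (@le_trans _ _ (\sum_k `|phi x^-1 i k|)).
    by rewrite (bigD1 j) //= lerDl sumr_ge0.
  rewrite /B; apply: ler_wpDl => //; rewrite [leRHS](bigD1 i) //= lerDl.
  by rewrite sumr_ge0 // => k _; rewrite sumr_ge0.
pose V : set 'M[R[i]]_2 := [set N | forall i j, `|phi x i j - N i j| < e / (B *+ 2)]%classic.
have d0 : 0 < e / (B *+ 2) by rewrite divr_gt0 // pmulrn_lgt0.
exists V; first by apply/nbhs_mxP; exists (e / (B *+ 2)).
apply/seteqP; split=> [N [hN [y hy eN]]|N ->]; last first.
  by split; [move=> i j; rewrite subrr normr0 | exists x].
have : x^-1 * y = 1.
  apply: he; first by apply: norm1_unitsM => //; exact: norm1_unitsV.
  have e1 : (1 : 'M[R[i]]_2) = phi x^-1 * phi x by rewrite -rmorphM mulVr // rmorph1.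
  move=> i j; rewrite e1 rmorphM /= eN.
  have -> : (phi x^-1 * N) i j - (phi x^-1 * phi x) i j =
      \sum_k phi x^-1 i k * (N k j - phi x k j).
    by rewrite !mxE -sumrB; apply: eq_bigr => k _; rewrite mulrBr.
  apply: le_lt_trans (ler_norm_sum _ _ _) _.
  have -> : e = \sum_(k < 2) B * (e / (B *+ 2)).
    by rewrite sumr_const card_ord -mulrnAl mulrC divfK // mulrn_eq0 negb_or lt0r_neq0.
  apply: ltr_sum => [|k _]; first by apply/hasP; exists 0 => //; rewrite mem_index_enum.
  rewrite normrM distrC; apply: le_lt_trans (_ : B * `|phi x k j - N k j| < _).
    by rewrite ler_wpM2r.
  by rewrite ltr_pM2l.
by move=> /(congr1 (fun z => x * z)); rewrite mulVKr // mulr1 => exy; rewrite -eN exy.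
Qed.

End Norm1.

(** * Discreteness of the norm one units *)

Section Discreteness.
Variables (R : realType) (K : fieldExtType rat).
Local Notation C := R[i].
Local Notation n := (\dim {:K}).

Section SmallZero.
Variables (theta : K) (F : {poly int}).
Hypothesis gen : integral_generator theta F.

(* A nonzero element of the order has a norm of absolute value at least 1. *)
Lemma in_order_small_eq0 (sigma : {rmorphism K -> C}) (B d : C) y :
  in_order theta y -> 1 <= B -> d * B ^+ n < 1 ->
  `|sigma y| <= d -> (forall tau : {rmorphism K -> C}, `|tau y| <= B) -> y = 0.
Proof.
move=> oy B1 dB sy ty; have [tau [inj_tau all_tau]] := generator_embeddings gen C.
have B0 : 0 <= B := le_trans ler01 B1.
have [j0 ej0] := all_tau sigma.
have [N [hN _]] := in_order_norm gen inj_tau oy.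
have : `|N%:~R : C| < 1.
  rewrite hN normr_prod (bigD1 j0) //=; apply: le_lt_trans dB.
  apply: ler_pM => //; rewrite ?prodr_ge0 -?ej0 //.
  apply: (@le_trans _ _ (\prod_(i < n | i != j0) B)).
    by apply: ler_prod => i _; rewrite normr_ge0 ty.
  rewrite prodr_const; apply: ler_weXn2l => //.
  by rewrite -[leqRHS]card_ord max_card.
rewrite -intr_norm -[1]/(1%:~R) ltr_int => hN1; have N0 : N = 0 by move: hN1; clear; lia.
move/eqP: hN; rewrite N0 eq_sym => /prodf_eq0 [j _]; rewrite fmorph_eq0 => /eqP.
by [].
Qed.
End SmallZero.

Lemma real_sqr_bound (t c : C) : t \is Num.real -> 0 < c -> c * t ^+ 2 <= 1 ->
  `|t| <= 1 + c^-1.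
Proof.
move=> tr c0 h; have ht : t ^+ 2 <= c^-1 by rewrite -[_^-1]mul1r ler_pdivlMr // mulrC.
have c1 : 0 <= c^-1 by rewrite invr_ge0 ltW.
have [le1|gt1] := real_leP (normr_real t) (real1 _).
  by apply: le_trans le1 _; rewrite lerDl.
apply: (@le_trans _ _ (`|t| ^+ 2)); first by rewrite expr2 ler_peMr // ltW.
by rewrite real_normK //; apply: le_trans ht _; rewrite lerDr.
Qed.

Lemma sum_ge_term (I : finType) (F : I -> C) i : (forall j, 0 <= F j) -> F i <= \sum_j F j.
Proof. by move=> h; rewrite (bigD1 i) //= lerDl sumr_ge0. Qed.

Definition mx2 (L : fieldType) (p q r t : L) : 'M[L]_2 := \matrix_(i, j)
    if i == 0 then if j == 0 then p else q else if j == 0 then r else t.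

Lemma mx2M (L : fieldType) (p q r t p' q' r' t' : L) : mx2 p q r t * mx2 p' q' r' t' =
  mx2 (p * p' + q * r') (p * q' + q * t') (r * p' + t * r') (r * q' + t * t').
Proof.
apply/matrixP => i j; rewrite !mxE !big_ord_recl big_ord0 !mxE /= addr0.
by case: (ord2P i) => ->; case: (ord2P j) => ->.
Qed.

Lemma mx2_eq (L : fieldType) (M N : 'M[L]_2) : M 0 0 = N 0 0 -> M 0 1 = N 0 1 ->
  M 1 0 = N 1 0 -> M 1 1 = N 1 1 -> M = N.
Proof.
by move=> *; apply/matrixP => i j; case: (ord2P i) => ->; case: (ord2P j) => ->.
Qed.

Section FinSpan.
Variables (V : zmodType) (T : finType) (B : T -> V) (k0 : T).

Lemma int_span_seq (x : V) :
  (exists c : 'I_(size [seq B k | k <- enum T]) -> int,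
     x = \sum_(i < size [seq B k | k <- enum T]) [seq B k | k <- enum T]`_i *~ c i) <->
  exists c : T -> int, x = \sum_k B k *~ c k.
Proof.
have es (F : T -> V) : \sum_k F k = \sum_(i < size [seq B k | k <- enum T]) F (nth k0 (enum T) i).
  by rewrite -big_enum (big_nth k0) big_mkord size_map.
split=> -[c ->]; last first.
  exists (fun i => c (nth k0 (enum T) i)); rewrite es; apply: eq_bigr => i _.
  have hi : (i < size (enum T))%N by rewrite -(size_map B).
  by rewrite (nth_map k0 0 B).
exists (fun k => oapp c 0 (insub (index k (enum T)))).
rewrite es; apply: eq_bigr => i _.
have hi : (i < size (enum T))%N by rewrite -(size_map B).
rewrite (nth_map k0) // index_uniq ?enum_uniq //; congr (_ *~ _).
by rewrite (valK i).
Qed.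
End FinSpan.

Section QuatOrder.
Variables (theta : K) (F : {poly int}).
Hypothesis gen : integral_generator theta F.
Variables (A : falgType K) (a b : K) (f : {lrmorphism A -> quat a b}).
Hypotheses (bf : bijective f) (a0 : a != 0) (b0 : b != 0).
Hypotheses (oa : in_order theta a) (ob : in_order theta b).

Definition quat_order : set A := [set x | [/\ in_order theta (qcoef0 (f x)),
  in_order theta (qcoef1 (f x)), in_order theta (qcoef2 (f x)) &
  in_order theta (qcoef3 (f x))]]%classic.

Lemma quat_order_Z_order : Z_order quat_order.
Proof.
have [g fK gK] := bf.
have oB := in_orderB; have oM := in_orderM; have oD := in_orderD.
split.
- rewrite /quat_order /= rmorph1 /=.
  by have [h0 h1] := (in_order_int theta 0, in_order_int theta 1).
- move=> x y; rewrite /quat_order /= rmorphB rmorphM /=.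
  case: (f x) => x0 x1 x2 x3; case: (f y) => y0 y1 y2 y3 /= [h0 h1 h2 h3] [k0 k1 k2 k3].
  by do ![split | apply: in_orderB | apply: in_orderD | apply: in_orderM |
     rewrite -?[_ + - _]/(_ - _)] => //; apply: in_orderN.
- have nn : (0 < n)%N := adim_gt0 (aspacef K).
  pose B (k : 'I_4 * 'I_n) :=
    g (theta ^+ k.2 *: nth 0 [:: 1; qi a b; qj a b; qi a b * qj a b] k.1).
  have fB (c : 'I_4 * 'I_n -> int) l : quat_row (f (\sum_k B k *~ c k)) 0 l =
      \sum_(i < n) (c (l, i))%:~R * theta ^+ i.
    have qrD : {morph (fun q : quat a b => quat_row q 0 l) : x y / x + y}.
      move=> [x0 x1 x2 x3] [y0 y1 y2 y3]; rewrite !mxE /=.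
      by case: l => -[|[|[|[|l]]]].
    have qr0 : quat_row (0 : quat a b) 0 l = 0.
      by rewrite mxE /=; case: l {qrD} => -[|[|[|[|l]]]].
    rewrite raddf_sum (big_morph _ qrD qr0).
    transitivity (\sum_(k < 4) \sum_(i < n) (k == l)%:R * ((c (k, i))%:~R * theta ^+ i)).
      rewrite pair_bigA; apply: eq_bigr => -[k i] _ /=.
      have -> : f (B (k, i) *~ c (k, i)) = (c (k, i))%:~R *:
          (theta ^+ i *: [:: 1; qi a b; qj a b; qi a b * qj a b]`_k).
        by rewrite raddfMz scaler_int; congr (_ *~ _); exact: gK.
      rewrite scalerA mxE -val_eqE /=.
      by case: l {qrD qr0} => -[|[|[|[|l]]]] // hl; case: k => -[|[|[|[|k]]]] // hk;
        rewrite /=; ring.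
    rewrite (bigD1 l) //= [X in _ + X]big1 ?addr0 => [|k /negPf kl].
      by apply: eq_bigr => i _; rewrite eqxx mul1r.
    by apply: big1 => i _; rewrite kl mul0r.
  exists [seq B k | k <- enum {: 'I_4 * 'I_n}] => x.
  rewrite (int_span_seq B (ord0, Ordinal nn)); split.
    case=> /(in_order_coords gen) [c0 e0] /(in_order_coords gen) [c1 e1].
    move=> /(in_order_coords gen) [c2 e2] /(in_order_coords gen) [c3 e3].
    pose c (k : 'I_4 * 'I_n) := nth c0 [:: c0; c1; c2; c3] k.1 k.2.
    exists c; apply: (can_inj fK); apply: quatP.
    - by have := fB c (@Ordinal 4 0 isT); rewrite mxE e0.
    - by have := fB c (@Ordinal 4 1 isT); rewrite mxE e1.
    - by have := fB c (@Ordinal 4 2 isT); rewrite mxE e2.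
    by have := fB c (@Ordinal 4 3 isT); rewrite mxE e3.
  case=> c ->; split.
  - have := fB c (@Ordinal 4 0 isT); rewrite mxE /= => ->; exact: in_order_of_coords.
  - have := fB c (@Ordinal 4 1 isT); rewrite mxE /= => ->; exact: in_order_of_coords.
  - have := fB c (@Ordinal 4 2 isT); rewrite mxE /= => ->; exact: in_order_of_coords.
  have := fB c (@Ordinal 4 3 isT); rewrite mxE /= => ->; exact: in_order_of_coords.
move=> x.
have [N0 n0 h0] := in_order_scale gen (qcoef0 (f x)).
have [N1 n1 h1] := in_order_scale gen (qcoef1 (f x)).
have [N2 n2 h2] := in_order_scale gen (qcoef2 (f x)).
have [N3 n3 h3] := in_order_scale gen (qcoef3 (f x)).
pose N := N0 * N1 * N2 * N3.
exists (absz (N * N)); split.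
  by rewrite absz_gt0 !mulf_neq0.

have eN : (absz (N * N))%:Z = N * N by rewrite gez0_abs // -expr2 sqr_ge0.
have efx : f (x *+ (absz (N * N))) = ((N * N)%:~R : K) *: f x.
  by rewrite raddfMn -scaler_nat pmulrn eN.
rewrite /quat_order /= efx /N.
case: (f x) h0 h1 h2 h3 => x0 x1 x2 x3 /= h0 h1 h2 h3.
have os (M : int) y : in_order theta y -> in_order theta (M%:~R * y).
  by move=> oy; apply: in_orderM => //; exact: in_order_int.
split.
- by rewrite (_ : _ * _ = (N1 * N2 * N3 * N)%:~R * (N0%:~R * x0)); [exact: os | rewrite /N !intrM; ring].
- by rewrite (_ : _ * _ = (N0 * N2 * N3 * N)%:~R * (N1%:~R * x1)); [exact: os | rewrite /N !intrM; ring].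
- by rewrite (_ : _ * _ = (N0 * N1 * N3 * N)%:~R * (N2%:~R * x2)); [exact: os | rewrite /N !intrM; ring].
by rewrite (_ : _ * _ = (N0 * N1 * N2 * N)%:~R * (N3%:~R * x3)); [exact: os | rewrite /N !intrM; ring].
Qed.

(** The standard splitting: i goes to diag(s, -s), and j to the antidiagonal matrix with entries
    sigma(b) and 1. *)
Definition quat_mx (sigma : {rmorphism K -> C}) (s : C) (x : A) : 'M[C]_2 :=
  mx2 (sigma (qcoef0 (f x)) + s * sigma (qcoef1 (f x)))
      (sigma b * (sigma (qcoef2 (f x)) + s * sigma (qcoef3 (f x))))
      (sigma (qcoef2 (f x)) - s * sigma (qcoef3 (f x)))
      (sigma (qcoef0 (f x)) - s * sigma (qcoef1 (f x))).

Lemma quat_mx_exists (sigma : {rmorphism K -> C}) s : s ^+ 2 = sigma a ->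
  exists2 phi : {rmorphism A -> 'M[C]_2}, phi =1 quat_mx sigma s & extends_embedding sigma phi.
Proof.
move=> hs.
have zm : zmod_morphism (quat_mx sigma s).
  move=> x y; rewrite /quat_mx rmorphB /=.
  case: (f x) => x0 x1 x2 x3; case: (f y) => y0 y1 y2 y3 /=.
  by rewrite !rmorphD !rmorphN; apply: mx2_eq; rewrite !mxE /=; ring.
have mm : monoid_morphism (quat_mx sigma s).
  split.
    by rewrite /quat_mx rmorph1 /= !rmorph0 rmorph1; apply: mx2_eq; rewrite !mxE /=; ring.
  move=> x y; rewrite /quat_mx mx2M rmorphM /=.
  case: (f x) => x0 x1 x2 x3; case: (f y) => y0 y1 y2 y3 /=.
  rewrite !(rmorphD, rmorphN, rmorphM) -hs.
  by apply: mx2_eq; rewrite !mxE /=; ring.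
pose hZ := GRing.isZmodMorphism.Build _ _ _ zm.
pose hM := GRing.isMonoidMorphism.Build _ _ _ mm.
pose phi : {rmorphism A -> 'M[C]_2} := HB.pack (quat_mx sigma s) hZ hM.
exists phi => // k; rewrite /= /quat_mx linearZ /= rmorph1 /= mulr1 !mulr0 !rmorph0.
by apply: mx2_eq; rewrite !mxE /= ?mulr1n ?mulr0n; ring.
Qed.

(** Let x be a norm one unit close to 1 at sigma. At the definite places the norm form bounds its
    coordinates by B - 1; at sigma and its conjugate the coordinates of x - 1 are at most d. Each of
    these lies in Z[theta] and has a norm of absolute value less than 1, hence is 0. *)
Lemma kleinian_quat_integral (sigma : {rmorphism K -> C}) :
  (forall tau : {rmorphism K -> C}, [\/ tau =1 sigma, forall x, tau x = (sigma x)^*%C |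
     (forall x, tau x \is Num.real) /\ tau a < 0 /\ tau b < 0]) ->
  kleinian_type R A.
Proof.
move=> hemb; right; split.
  by exists a, b; split=> //; exists f.
pose s := sqrtC (sigma a); have hs : s ^+ 2 = sigma a by rewrite sqrtCK.
have s0 : s != 0 by rewrite sqrtC_eq0 fmorph_eq0.
have sb0 : sigma b != 0 by rewrite fmorph_eq0.
have [phi ephi ext] := quat_mx_exists hs.
exists quat_order, sigma, phi; split=> //; first exact: quat_order_Z_order.
have [tau [inj_tau all_tau]] := generator_embeddings gen C.
pose bd (k : K) : C := \sum_j `|(tau j k)^-1|.
have bd0 k : 0 <= bd k by apply: sumr_ge0.
(* B bounds the coordinates at definite places with 1 to spare for x0 - 1, M converts closeness of
   matrix entries into closeness of coordinates, and d is chosen so that d B^n < 1. *)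
pose B : C := 3 + (bd a + bd b + bd (a * b)).
have B2 : 3 <= B by rewrite lerDl !addr_ge0.
have B1 : 1 <= B by apply: le_trans B2; rewrite ler1n.
pose M : C := (1 + `|s|^-1) * (1 + `|sigma b|^-1).
have M1 : 1 <= M.
  by rewrite -[1]mulr1 ler_pM // ?ler01 // lerDl invr_ge0.
have B0 : 0 < B := lt_le_trans ltr01 B1.
have M0 : 0 < M := lt_le_trans ltr01 M1.
pose d := (2 * B ^+ n)^-1; pose e := d / M.
have Bn0 : 0 < 2 * B ^+ n by rewrite mulr_gt0 ?exprn_gt0 ?ltr0n.
have d0 : 0 < d by rewrite invr_gt0.
have e0 : 0 < e by rewrite divr_gt0.
have dB : d * B ^+ n < 1.
  have hB : B ^+ n != 0 by rewrite expf_neq0 ?lt0r_neq0.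
  by rewrite /d invfM mulfVK // invf_lt1 ?ltr1n ?ltr0n.
have d1 : d <= B.
  apply: (le_trans _ B1); rewrite invf_le1 //; apply: (@le_trans _ _ (1 * 1)); first by rewrite mulr1.
  by apply: ler_pM; [exact: ler01 | exact: ler01 | rewrite ler1n | exact: exprn_ege1].
apply: (near_one_discrete bf a0 b0 ext quat_order_Z_order e0) => x hx hn.
have /(norm1_unitsP bf a0 b0 ext) [[o0 o1 o2 o3] nx _] := hx.
have [g fK gK] := bf; apply: (can_inj fK); rewrite rmorph1.
have := (hn 0 0, hn 0 1, hn 1 0, hn 1 1).
rewrite !ephi /quat_mx !mxE /= ?mulr1n ?mulr0n !subr0.
case: (f x) o0 o1 o2 o3 nx => x0 x1 x2 x3 /= o0 o1 o2 o3 nx [[[h1 h2] h3] h4].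
have bnd (tau' : {rmorphism K -> C}) : (forall x, tau' x \is Num.real) /\ tau' a < 0 /\ tau' b < 0 ->
   [/\ `|tau' x0| <= B - 1, `|tau' x1| <= B - 1, `|tau' x2| <= B - 1 & `|tau' x3| <= B - 1].
  move=> [tr [ta tb]]; have [j ej] := all_tau tau'.
  have bdj k c : 0 < c -> `|c| = `|tau' k| -> c^-1 <= bd k.
    move=> hk hc; apply: le_trans (sum_ge_term j _) => //.
    by rewrite -ej normfV -hc gtr0_norm.
  have hN : tau' x0 ^+ 2 + (- tau' a) * tau' x1 ^+ 2 + (- tau' b) * tau' x2 ^+ 2
     + (tau' a * tau' b) * tau' x3 ^+ 2 = 1.
    by rewrite -(rmorph1 tau') -nx /qnorm /= !(rmorphD, rmorphN, rmorphM, rmorphXn) /=; ring.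
  have p k c : 0 < c -> 0 <= c * tau' k ^+ 2.
    by move=> c0; apply: mulr_ge0; [exact: ltW | apply: real_exprn_even_ge0].
  have na : 0 < - tau' a by rewrite oppr_gt0.
  have nb : 0 < - tau' b by rewrite oppr_gt0.
  have nab : 0 < tau' a * tau' b by rewrite nmulr_rgt0.
  have p0 := p x0 1 ltr01; rewrite mul1r in p0.
  have p1 := p x1 _ na; have p2 := p x2 _ nb; have p3 := p x3 _ nab.
  have ba : (- tau' a)^-1 <= bd a by apply: bdj => //; rewrite normrN.
  have bb : (- tau' b)^-1 <= bd b by apply: bdj => //; rewrite normrN.
  have bab : (tau' a * tau' b)^-1 <= bd (a * b) by apply: bdj => //; rewrite rmorphM.
  have BE : B - 1 = 2 + (bd a + bd b + bd (a * b)) by rewrite /B; ring.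
  have s2 : 1 + 1 <= 2 :> C by rewrite -[leRHS]/(1 + 1).
  rewrite BE; split.
  - have := real_sqr_bound (tr x0) ltr01; rewrite mul1r invr1 => h.
    apply: (@le_trans _ _ 2); last by rewrite lerDl !addr_ge0.
    by apply: le_trans (h _) _ => //; rewrite -hN -!addrA lerDl !addr_ge0.
  - apply: le_trans (real_sqr_bound (tr x1) na _) _.
      by rewrite -hN [leRHS](_ : _ = - tau' a * tau' x1 ^+ 2 + (tau' x0 ^+ 2 +
        - tau' b * tau' x2 ^+ 2 + tau' a * tau' b * tau' x3 ^+ 2)) ?lerDl ?addr_ge0 //; ring.
    by apply: lerD; rewrite ?ler1n //; apply: le_trans ba _; rewrite -addrA lerDl addr_ge0.
  - apply: le_trans (real_sqr_bound (tr x2) nb _) _.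
      by rewrite -hN [leRHS](_ : _ = - tau' b * tau' x2 ^+ 2 + (tau' x0 ^+ 2 +
        - tau' a * tau' x1 ^+ 2 + tau' a * tau' b * tau' x3 ^+ 2)) ?lerDl ?addr_ge0 //; ring.
    apply: lerD; rewrite ?ler1n //; apply: le_trans bb _.
    by rewrite [bd a + _]addrC -addrA lerDl addr_ge0.
  apply: le_trans (real_sqr_bound (tr x3) nab _) _.
    by rewrite -hN lerDr !addr_ge0.
  by apply: lerD; rewrite ?ler1n //; apply: le_trans bab _; rewrite lerDr addr_ge0.
have sp (p q r : C) : `|p| <= r -> `|q| <= r -> `|(p + q) / 2| <= r.
  move=> hp hq; rewrite normf_div normr_nat ler_pdivrMr ?ltr0n // mulr_natr mulr2n.
  by apply: le_trans (ler_normD _ _) (lerD hp hq).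
have sm (p q r : C) : `|p| <= r -> `|q| <= r -> `|(p - q) / 2| <= r.
  by move=> hp hq; apply: sp; rewrite ?normrN.
have n2 : 2 != 0 :> C by rewrite pnatr_eq0.
have dE : e * M = d by rewrite /e divfK // lt0r_neq0.
pose e' := e * (1 + `|sigma b|^-1).
have i1 : 0 <= `|s|^-1 by rewrite invr_ge0.
have i2 : 0 <= `|sigma b|^-1 by rewrite invr_ge0.
have ee' : e <= e' by rewrite /e' mulrDr mulr1 lerDl mulr_ge0 // ltW.
have e'0 : 0 < e' by apply: lt_le_trans ee'.
have dE' : d = e' + e' * `|s|^-1 by rewrite -dE /e' /M; ring.
have e'd : e' <= d by rewrite dE' lerDl mulr_ge0 // ltW.
have sd (y : K) : `|s * sigma y| <= e' -> `|sigma y| <= d.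
  rewrite normrM dE' => h; rewrite -[leLHS](mulKf (_ : `|s| != 0)) ?normr_eq0 //.
  by rewrite mulrC; apply: (@le_trans _ _ (e' * `|s|^-1)); rewrite ?ler_wpM2r // lerDr ltW.
have [[[g1 g2] g3] g4] := (ltW h1, ltW h2, ltW h3, ltW h4).
have b0' : `|sigma (x0 - 1)| <= d.
  apply: le_trans (le_trans ee' e'd).
  rewrite rmorphB rmorph1.
  by rewrite (_ : _ - 1 = (sigma x0 + s * sigma x1 - 1 + (sigma x0 - s * sigma x1 - 1)) / 2)
     ?sp //; field.
have b1' : `|sigma x1| <= d.
  apply: sd; apply: le_trans ee'.
  by rewrite (_ : s * _ = (sigma x0 + s * sigma x1 - 1 - (sigma x0 - s * sigma x1 - 1)) / 2)
     ?sm //; field.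
have h2' : `|sigma x2 + s * sigma x3| <= e'.
  move: g2; rewrite normrM => g2.
  rewrite -[leLHS](mulKf (_ : `|sigma b| != 0)) ?normr_eq0 //.
  apply: (@le_trans _ _ (`|sigma b|^-1 * e)); first by rewrite ler_wpM2l.
  by rewrite /e' mulrDr mulr1 mulrC lerDr ltW.
have b2' : `|sigma x2| <= d.
  apply: le_trans e'd.
  rewrite (_ : sigma x2 = (sigma x2 + s * sigma x3 + (sigma x2 - s * sigma x3)) / 2); last by field.
  by apply: sp => //; apply: le_trans ee'.
have b3' : `|sigma x3| <= d.
  apply: sd.
  rewrite (_ : s * _ = (sigma x2 + s * sigma x3 - (sigma x2 - s * sigma x3)) / 2); last by field.
  by apply: sm => //; apply: le_trans ee'.
have small y : in_order theta y -> `|sigma y| <= d ->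
   (forall tau' : {rmorphism K -> C},
     (forall x, tau' x \is Num.real) /\ tau' a < 0 /\ tau' b < 0 -> `|tau' y| <= B) -> y = 0.
  move=> oy sy ry; apply: (in_order_small_eq0 gen oy B1 dB sy) => tau'.
  case: (hemb tau') => [->|->|/ry //]; first exact: le_trans d1.
  by rewrite normcJ; exact: le_trans d1.
have lB y : y <= B - 1 -> y <= B by move=> h; apply: le_trans h _; rewrite gerBl.
apply: quatP => /=.
- apply/eqP; rewrite -subr_eq0; apply/eqP; apply: small => //.
    by apply: in_orderB => //; exact: (in_order_int theta 1).
  move=> tau' /bnd [h _ _ _]; rewrite rmorphB rmorph1.
  apply: le_trans (ler_normB _ _) _; rewrite normr1.
  by rewrite -lerBrDr.
- by apply: small => // tau' /bnd [_ h _ _]; apply: lB.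
- by apply: small => // tau' /bnd [_ _ h _]; apply: lB.
by apply: small => // tau' /bnd [_ _ _ h]; apply: lB.
Qed.
End QuatOrder.

Lemma kleinian_quat (A : falgType K) (a b : K) (sigma : {rmorphism K -> C}) :
  a != 0 -> b != 0 -> alg_isom A (quat a b) ->
  (forall tau : {rmorphism K -> C}, [\/ tau =1 sigma, forall x, tau x = (sigma x)^*%C |
     (forall x, tau x \is Num.real) /\ tau a < 0 /\ tau b < 0]) ->
  kleinian_type R A.
Proof.
move=> a0 b0 iso hemb; have [theta [F gen]] := integral_generator_exists K.
have [M m0 oa] := in_order_scale gen a; have [N n0 ob] := in_order_scale gen b.
have M0 : M%:~R != 0 :> K by rewrite nf_int_eq0.
have N0 : N%:~R != 0 :> K by rewrite nf_int_eq0.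
pose a' : K := M%:~R * (M%:~R * a); pose b' : K := N%:~R * (N%:~R * b).
have a'0 : a' != 0 by rewrite !mulf_neq0.
have b'0 : b' != 0 by rewrite !mulf_neq0.
have [f bf] : alg_isom A (quat a' b').
  apply: alg_isom_trans iso _.
  apply: (alg_isom_quat (I := M%:~R *: qi a b) (J := N%:~R *: qj a b)) => //.
  - by rewrite nf_nat_eq0.
  - exact: dim_quat.
  - by rewrite -scalerAl -scalerAr qi_sqr !scalerA -!mulrA.
  - by rewrite -scalerAl -scalerAr qj_sqr !scalerA -!mulrA.
  by rewrite -!scalerAl -!scalerAr qji !scalerA !scalerN mulrC.
have oi := in_order_int theta; have oM := in_orderM.
apply: (kleinian_quat_integral gen bf a'0 b'0 _ _ (sigma := sigma)).
- exact: oM (oi M) oa.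
- exact: oM (oi N) ob.
move=> tau; case: (hemb tau) => [h|h|[h [ha hb]]]; [by constructor 1|by constructor 2|].
constructor 3; split=> //; rewrite /a' /b' !rmorphM /= !rmorph_int !mulrA -!expr2.
have p (z : int) : z != 0 -> 0 < (z%:~R : C) ^+ 2.
  by move=> z0; rewrite -rmorphXn ltr0z exprn_even_gt0.
by rewrite !pmulr_rlt0 ?p.
Qed.
End Discreteness.

(** * Finite groups generating the listed algebras *)

Section DihedralGroups.
Variables (K : fieldType) (B : falgType K) (z j : B) (N m : nat).
Hypotheses (zN : z ^+ N.+1 = 1) (zjz : z * j * z = j) (jj : j * j = (-1) ^+ m).

Definition dihedral_word (x : B) : Prop :=
  exists s k e : nat, x = (-1) ^+ s * z ^+ k * j ^+ e.

(** The relation z j z = j says that j z = z^-1 j, and z^-1 is the power z^N. *)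
Lemma dihedral_swap e l : exists k, j ^+ e * z ^+ l = z ^+ k * j ^+ e.
Proof.
have jz : j * z = z ^+ N * j.
  by rewrite -{2}zjz !mulrA -exprSr zN mul1r.
have jzl p : j * z ^+ p = z ^+ (N * p) * j.
  elim: p => [|p IH]; first by rewrite muln0 !expr0 mul1r mulr1.
  by rewrite exprSr mulrA IH -mulrA jz mulrA -exprD mulnS addnC.
elim: e => [|e [k IH]]; first by exists l; rewrite expr0 mul1r mulr1.
by exists (N * k)%N; rewrite exprS -mulrA IH !mulrA jzl -!mulrA.
Qed.

Lemma sgn_comm s (x : B) : x * (-1) ^+ s = (-1) ^+ s * x.
Proof. exact: commr_sign. Qed.

Lemma dihedral_wordM x y : dihedral_word x -> dihedral_word y -> dihedral_word (x * y).
Proof.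
move=> [s [k [e ->]]] [s' [l [e' ->]]]; have [k' hk'] := dihedral_swap e l.
exists (s + s')%N, (k + k')%N, (e + e')%N.
rewrite !exprD -!mulrA; congr (_ * _); rewrite [j ^+ e * _]mulrA sgn_comm !mulrA sgn_comm.
by rewrite -!mulrA; congr (_ * (_ * _)); rewrite !mulrA hk'.
Qed.

Lemma dihedral_word1 : dihedral_word 1.
Proof. by exists 0, 0, 0; rewrite !expr0 !mulr1. Qed.

Lemma dihedral_wordz : dihedral_word z.
Proof. by exists 0, 1, 0; rewrite !expr0 mulr1 mul1r. Qed.

Lemma dihedral_wordj : dihedral_word j.
Proof. by exists 0, 0, 1; rewrite !expr0 !mul1r. Qed.

Lemma dihedral_wordX x e : dihedral_word x -> dihedral_word (x ^+ e).
Proof.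
move=> hx; elim: e => [|e IH]; first exact: dihedral_word1.
by rewrite exprS; exact: dihedral_wordM.
Qed.

Definition dihedral_seq : seq B :=
  [seq ((-1) ^+ t.1 * z ^+ t.2.1 * j ^+ t.2.2 : B)
     | t : 'I_2 * ('I_N.+1 * 'I_4) <- enum {: 'I_2 * ('I_N.+1 * 'I_4)}].

Lemma j4 : j ^+ 4 = 1.
Proof. by rewrite (exprM j 2 2) [j ^+ 2]jj -exprM mulnC exprM sqrrN !expr1n. Qed.

Lemma dihedral_seqP x : x \in dihedral_seq <-> dihedral_word x.
Proof.
split=> [/mapP [[s [k e]] _ ->]|[s [k [e ->]]]]; first by exists s, k, e.
have md (y : B) M p : y ^+ M.+1 = 1 -> y ^+ (p %% M.+1) = y ^+ p.
  by move=> h; rewrite [in RHS](divn_eq p M.+1) exprD mulnC exprM h expr1n mul1r.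
apply/mapP; exists (inord (s %% 2), (inord (k %% N.+1), inord (e %% 4))); first exact: mem_enum.
by rewrite /= !inordK ?ltn_mod // !md ?j4 // sqrrN expr1n.
Qed.

Lemma dihedral_seq_group : finite_unit_subgroup dihedral_seq.
Proof.
split.
- exact/dihedral_seqP/dihedral_word1.
- by move=> x y /dihedral_seqP hx /dihedral_seqP hy; apply/dihedral_seqP/dihedral_wordM.
move=> x /dihedral_seqP hx.
have [y wy [xy yx]] : exists2 y, dihedral_word y & x * y = 1 /\ y * x = 1.
  case: hx => s [k [e ->]].
  have z1 p : z ^+ p * z ^+ (N * p) = 1 by rewrite -exprD -mulSn exprM zN expr1n.
  have z2 p : z ^+ (N * p) * z ^+ p = 1 by rewrite -exprD addnC -mulSn exprM zN expr1n.
  have j1 p : j ^+ p * j ^+ (3 * p) = 1 by rewrite -exprD -mulSn exprM j4 expr1n.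
  have j2 p : j ^+ (3 * p) * j ^+ p = 1 by rewrite -exprD addnC -mulSn exprM j4 expr1n.
  have s1 p : (-1) ^+ p * (-1) ^+ p = 1 :> B by rewrite -expr2 sqrr_sign.
  exists (j ^+ (3 * e) * (z ^+ (N * k) * (-1) ^+ s)).
    do !apply: dihedral_wordM; first exact: dihedral_wordX dihedral_wordj.
      exact: dihedral_wordX dihedral_wordz.
    by exists s, 0, 0; rewrite !expr0 !mulr1.
  split.
    by rewrite !mulrA -[_ * j ^+ e * _]mulrA j1 mulr1 -[_ * z ^+ k * _]mulrA z1 mulr1 s1.
  rewrite -!mulrA [(-1) ^+ s * ((-1) ^+ s * _)]mulrA s1 mul1r [z ^+ (N * k) * _]mulrA z2 mul1r.
  exact: j2.
have ux : x \is a GRing.unit by apply/unitrP; exists y.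
split=> //; apply/dihedral_seqP; rewrite (_ : x^-1 = y) //.
by apply: (mulrI ux); rewrite divrr.
Qed.
End DihedralGroups.

(** The hypothesis quantified over P expresses that [qi] and [qj] lie in the K-algebra generated by
    z and j. *)
Lemma schur_quat (K : fieldExtType rat) (A : falgType K) (a b : K) (z j : quat a b) (N m : nat) :
  central_simple A -> alg_isom A (quat a b) -> z ^+ N.+1 = 1 -> z * j * z = j -> j * j = (-1) ^+ m ->
  (forall P : quat a b -> Prop, (forall x y, P x -> P y -> P (x + y)) ->
    (forall x y, P x -> P y -> P (x * y)) -> (forall k x, P x -> P (k *: x)) ->
    P 1 -> P z -> P j -> P (qi a b) /\ P (qj a b)) ->
  schur_algebra A.
Proof.
move=> hA /alg_isom_sym [g [f gK fK]] zN zjz jj gen.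
split=> //; pose G := dihedral_seq (g z) (g j) N.
have gzN : g z ^+ N.+1 = 1 by rewrite -rmorphXn zN rmorph1.
have gzjz : g z * g j * g z = g j by rewrite -!rmorphM zjz.
have gjj : g j * g j = (-1) ^+ m by rewrite -rmorphM jj rmorphXn rmorphN1.
exists G; split; first exact: dihedral_seq_group gzN gzjz gjj.
apply/eqP; rewrite eqEsubv subvf /=; apply/subvP => x _.
set E := <<1 & G>>%AS.
have sE : {subset G <= E}.
  move=> y yG; apply: (subvP (sub_agenv _)); apply: (subvP (addvSr _ _)).
  exact: memv_span.
have /(_ (fun q => g q \in E)) [] := gen.
- by move=> u v hu hv; rewrite rmorphD rpredD.
- by move=> u v hu hv; rewrite rmorphM memvM.
- by move=> k u hu; rewrite linearZ memvZ.
- by rewrite rmorph1; apply/sE/(dihedral_seqP gzN gjj)/dihedral_word1.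
- by apply/sE/(dihedral_seqP gzN gjj)/dihedral_wordz.
- by apply/sE/(dihedral_seqP gzN gjj)/dihedral_wordj.
move=> hi hj; rewrite -[x]fK; case: (f x) => x0 x1 x2 x3.
have gD u v : g (u + v) = g u + g v by exact: rmorphD.
have gZ k u : g (k *: u) = k *: g u by exact: linearZ.
have gM u v : g (u * v) = g u * g v by exact: rmorphM.
rewrite quat_coords !gD !gZ gM rmorph1.
have h1 : 1 \in E by apply/sE/(dihedral_seqP gzN gjj)/dihedral_word1.
by rewrite -/E !rpredD ?memvZ ?memvM.
Qed.

Lemma schur_quat11 (K : fieldExtType rat) (A : falgType K) :
  central_simple A -> alg_isom A (quat (1 : K) 1) -> schur_algebra A.
Proof.
move=> hA iso; apply: (@schur_quat _ _ _ _ (qi 1 1 * qj 1 1) (qj 1 1) 3 0 hA iso).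
- have e : (qi (1 : K) 1 * qj 1 1) ^+ 2 = - 1 by rewrite expr2; congr Quat; rewrite /=; ring.
  by rewrite (exprM _ 2 2) e sqrrN expr1n.
- by congr Quat; rewrite /=; ring.
- by congr Quat; rewrite /=; ring.
move=> P PD PM PZ P1 Pz Pj; split=> //.
rewrite (_ : qi 1 1 = qi 1 1 * qj 1 1 * qj 1 1); last by congr Quat; rewrite /=; ring.
exact: PM.
Qed.

(** The element z = (eta + i)/2 has trace eta and norm (eta^2 - (eta^2 - 4))/4 = 1; it plays the
    part of zeta_n, and conjugation by j inverts it. *)
Lemma schur_quat_dihedral (K : fieldExtType rat) (A : falgType K) (eta : K) (n : nat) :
  (0 < n)%N -> central_simple A -> alg_isom A (quat (eta ^+ 2 - 4) (-1)) ->
  ((2^-1) *: (eta%:A + qi (eta ^+ 2 - 4) (-1))) ^+ n = 1 -> schur_algebra A.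
Proof.
case: n => // N _ hA iso zN.
have n2 : 2 != 0 :> K by rewrite nf_nat_eq0.
apply: (schur_quat (j := qj (eta ^+ 2 - 4) (-1)) (m := 1) hA iso zN).
- by congr Quat; rewrite /=; field.
- by congr Quat; rewrite /=; ring.
move=> P PD PM PZ P1 Pz Pj; split=> //.
rewrite (_ : qi _ _ = 2 *: ((2^-1) *: (eta%:A + qi (eta ^+ 2 - 4) (-1))) + (- eta)%:A); last by congr Quat; rewrite /=; field.
by apply: PD; apply: PZ.
Qed.

(* With U_k the Chebyshev polynomials normalized by z + 1/z |-> (z^k - z^-k)/(z - z^-1),
   cheb eta k is the pair of values U_k(eta), U_(k-1)(eta). *)
Fixpoint cheb (L : pzRingType) (eta : L) (k : nat) : L * L :=
  if k is k'.+1 then (eta * (cheb eta k').1 - (cheb eta k').2, (cheb eta k').1)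
  else (0, -1).

Lemma cheb_morph (L M : pzRingType) (f : {rmorphism L -> M}) eta k :
  cheb (f eta) k = (f (cheb eta k).1, f (cheb eta k).2).
Proof.
elim: k => [|k IH] /=; first by rewrite rmorph0 rmorphN1.
by rewrite IH /= rmorphB rmorphM.
Qed.

Lemma cheb_pow (L : comNzRingType) (B : algType L) (eta : L) (z : B) k : z * z = eta *: z - 1 ->
  z ^+ k = (cheb eta k).1 *: z - (cheb eta k).2%:A.
Proof.
move=> hz; elim: k => [|k IH] /=; first by rewrite expr0 scale0r sub0r scaleN1r opprK.
rewrite exprSr IH mulrBl -scalerAl hz mulr_algl scalerBr scalerA scalerBl [_ * eta]mulrC.
by rewrite -addrA -opprD [_%:A + _]addrC opprD addrA.
Qed.

(** From z^k = U_k z - U_(k-1), and the same for w, the equation z^k = 1 becomes a condition on eta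
    alone. Together with [quat_unity] it carries roots of unity between C and the quaternions. *)
Lemma cheb_unity (L : fieldType) (eta z w : L) k : z * w = 1 -> z + w = eta -> z != w ->
  (z ^+ k == 1) = (cheb eta k == (0, -1)).
Proof.
move=> zw zpw znw.
have hz : (z : L^o) * z = eta *: (z : L^o) - 1.
  by rewrite -zpw -zw -[_ *: _]/(_ * _); ring.
have hw : (w : L^o) * w = eta *: (w : L^o) - 1.
  by rewrite -zpw -zw -[_ *: _]/(_ * _); ring.
have pw (x : L) : (x : L^o) * x = eta *: (x : L^o) - 1 ->
    x ^+ k = (cheb eta k).1 * x - (cheb eta k).2.
  by move=> hx; have := cheb_pow k hx; rewrite -[_ *: _]/(_ * _) -[_%:A]/(_ * _) mulr1.
have [ez ew] := (pw z hz, pw w hw).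
apply/eqP/eqP => [z1|e]; last by rewrite [LHS]ez e /= mul0r sub0r opprK.
have w1 : w ^+ k = 1 by rewrite -[LHS]mul1r -z1 -exprMn zw expr1n.
have u0 : (cheb eta k).1 = 0.
  have : (cheb eta k).1 * (z - w) = 0.
    rewrite mulrBr -[_ * z](subrK (cheb eta k).2) -ez z1 -[_ * w](subrK (cheb eta k).2) -ew w1.
    exact: subrr.
  by move/eqP; rewrite mulf_eq0 subr_eq0 (negPf znw) orbF => /eqP.
rewrite [cheb _ _]surjective_pairing u0; congr pair.
by apply: oppr_inj; rewrite opprK -[RHS]z1 [RHS]ez u0 mul0r sub0r.
Qed.

Lemma quat_unity (K : fieldType) (B : algType K) (eta : K) (z : B) k : z * z = eta *: z - 1 ->
  (forall c : K, z <> c%:A) -> (z ^+ k == 1) = (cheb eta k == (0, -1)).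
Proof.
move=> hz nz; rewrite (cheb_pow k hz).
apply/eqP/eqP => [z1|->]; last by rewrite scale0r sub0r scaleN1r opprK.
set u := (cheb eta k).1 in z1; set v := (cheb eta k).2 in z1.
have e : u *: z = (1 + v)%:A by rewrite -[LHS](subrK v%:A) z1 scalerDl scale1r.
have u0 : u = 0.
  apply/eqP; apply/negP => /negP u0; apply: (nz (u^-1 * (1 + v))).
  by rewrite -scalerA -e scalerA mulVf // scale1r.
rewrite [cheb _ _]surjective_pairing -/u -/v u0; congr pair.
apply/eqP; rewrite -subr_eq0 opprK addrC; apply/eqP.
by move/eqP: e; rewrite u0 scale0r eq_sym scaler_eq0 oner_eq0 orbF => /eqP.
Qed.

(** * The listed algebras are Schur algebras of Kleinian type *)

Section Sufficiency.
Variables (R : realType) (K : fieldExtType rat).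
Local Notation C := R[i].

Lemma emb_exists : inhabited {rmorphism K -> C}.
Proof.
have [theta [F gen]] := integral_generator_exists K.
have [tau _] := generator_embeddings gen C.
by split; exact: tau (Ordinal (adim_gt0 (aspacef K))).
Qed.

Lemma emb_rat (L : numFieldType) (s : {rmorphism K -> L}) (p : rat) : s p%:A = ratr p.
Proof. exact: (fmorph_eq_rat (s \o in_alg K)). Qed.

Lemma rational_emb (s t : {rmorphism K -> C}) : is_rational_field K -> t =1 s.
Proof.
move=> hK x; have : x \in {:K}%VS by exact: memvf.
by rewrite hK => /vlineP [p ->]; rewrite !emb_rat.
Qed.

Lemma quadratic_coords d : is_quadratic_field K d ->
  exists2 s : K, s ^+ 2 = d%:~R & forall x, exists p q : rat, x = p%:A + q *: s.
Proof.
case=> s [hs full]; exists s => // x.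
have : x \in <<1; s>>%VS by rewrite full memvf.
case/Fadjoin_polyP => p /polyOver1P [q ->] ->.
elim/poly_ind: q => [|q c [u [v IH]]]; first by exists 0, 0; rewrite rmorph0 horner0 !scale0r addr0.
exists (v * d%:~R + c), u.
rewrite rmorphD rmorphM /= map_polyX map_polyC hornerD hornerM hornerX hornerC IH mulrDl.
rewrite -!scalerAl mul1r -expr2 hs -in_alg_int /= scalerA scalerDl.
by rewrite -addrA addrC.
Qed.

Lemma conjC_sqr_neg (z : C) : z ^+ 2 < 0 -> z^*%C = - z.
Proof.
move=> h.
have : (z^*%C) ^+ 2 = z ^+ 2 by rewrite -rmorphXn /=; apply/CrealP; rewrite realE (ltW h) orbT.
move/eqP; rewrite eqf_sqr => /orP [/eqP /CrealP zr|/eqP //].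
by move: h; rewrite le_gtF // real_exprn_even_ge0.
Qed.

Lemma conjcD (x y : C) : (x + y)^*%C = x^*%C + y^*%C. Proof. exact: rmorphD. Qed.
Lemma conjcM (x y : C) : (x * y)^*%C = x^*%C * y^*%C. Proof. exact: rmorphM. Qed.
Lemma conjcN (x : C) : (- x)^*%C = - x^*%C. Proof. exact: rmorphN. Qed.

Lemma imaginary_emb d (s t : {rmorphism K -> C}) : d < 0 -> is_quadratic_field K d ->
  t =1 s \/ forall x, t x = (s x)^*%C.
Proof.
move=> d0 /quadratic_coords [r hr crd].
have sr (u : {rmorphism K -> C}) : u r ^+ 2 = d%:~R by rewrite -rmorphXn hr rmorph_int.
have uE (u : {rmorphism K -> C}) p q : u (p%:A + q *: r) = ratr p + ratr q * u r.
  by rewrite rmorphD -[q *: r]mulr_algl rmorphM !emb_rat.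
have hc : (s r)^*%C = - s r by apply: conjC_sqr_neg; rewrite sr ltrz0.
have /eqP : t r ^+ 2 = s r ^+ 2 by rewrite !sr.
rewrite eqf_sqr => /orP [/eqP e|/eqP e]; [left|right] => x; have [p [q ->]] := crd x.
  by rewrite !uE e.
rewrite !uE conjcD [(ratr q * _)^*%C]conjcM hc -e.
have rr (y : rat) : (ratr y : C)^*%C = ratr y by exact: fmorph_rat.
by rewrite !rr.
Qed.

Lemma kleinian_rational (A : falgType K) (a b : K) : is_rational_field K ->
  a != 0 -> b != 0 -> alg_isom A (quat a b) -> kleinian_type R A.
Proof.
move=> hK a0 b0 iso; have [s] := emb_exists.
apply: (kleinian_quat (sigma := s) a0 b0 iso) => t.
by constructor 1; exact: rational_emb.
Qed.

Lemma kleinian_imaginary (A : falgType K) (a b : K) (d : int) : d < 0 -> is_quadratic_field K d ->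
  a != 0 -> b != 0 -> alg_isom A (quat a b) -> kleinian_type R A.
Proof.
move=> d0 hK a0 b0 iso; have [s] := emb_exists.
apply: (kleinian_quat (sigma := s) a0 b0 iso) => t.
by have [h|h] := imaginary_emb s t d0 hK; [constructor 1 | constructor 2].
Qed.

Lemma quadratic_roots (L : closedFieldType) (t : L) : exists z w : L, z * w = 1 /\ z + w = t.
Proof.
have [z hz] : exists z : L, z ^+ 2 = \sum_(i < 2) nth 0 [:: -1; t] i * z ^+ i.
  by apply: solve_monicpoly.
exists z, (t - z); split; last by rewrite addrCA subrr addr0.
move: hz; rewrite !big_ord_recl big_ord0 /= => hz.
by rewrite mulrBr -expr2 hz /bump /= expr0 expr1; ring.
Qed.

(** At every embedding eta becomes z + 1/z with z a root of unity, and z - 1/z is then a nonzero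
    purely imaginary number. *)
Lemma cheb_negative (eta : K) n (tau : {rmorphism K -> C}) : (0 < n)%N ->
  cheb eta n = (0, -1) -> eta ^+ 2 - 4 != 0 -> tau (eta ^+ 2 - 4) < 0.
Proof.
move=> n0 hch l0; have [z [w [zw zpw]]] := quadratic_roots (tau eta).
have el : tau (eta ^+ 2 - 4) = (z - w) ^+ 2.
  rewrite rmorphB rmorphXn rmorph_nat /= -zpw (_ : 4 = 4 * (z * w)); first ring.
  by rewrite zw mulr1.
have znw : z != w.
  by rewrite -subr_eq0; apply: contraNneq l0 => e; rewrite -(fmorph_eq0 tau) el e expr0n.
have zn : z ^+ n = 1.
  by apply/eqP; rewrite (cheb_unity _ zw zpw znw) cheb_morph hch rmorph0 rmorphN1.
have nz : `|z| = 1 by apply/eqP; rewrite -(pexpr_eq1 n0) // -normrX zn normr1.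
have z0 : z != 0 by rewrite -normr_eq0 nz oner_neq0.
have wE : w = z^*%C by apply: (mulfI z0); rewrite zw -[RHS]normCK nz expr1n.
have cw : (z - w)^*%C = - (z - w) by rewrite wE conjcD conjcN [_^*%C^*%C]conjCK opprB addrC.
rewrite el expr2 -[X in _ * X]opprK -cw mulrN oppr_lt0 -[_ * _]normCK.
by rewrite exprn_gt0 // normr_gt0 subr_eq0.
Qed.

Lemma lambda_sqr_cheb n (l : K) : (3 <= n)%N -> lambda_sqr_in R n l ->
  exists eta, [/\ l = eta ^+ 2 - 4, l != 0 & cheb eta n = (0, -1)].
Proof.
move=> n3 [iota [zeta [eta [pz heta hl]]]]; exists eta.
have z0 : zeta != 0.
  apply/eqP => z0; have /eqP := prim_expr_order pz.
  by rewrite z0 expr0n; case: (n) n3 => //= p _; rewrite eq_sym oner_eq0.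
have znw : zeta != zeta^-1.
  apply/eqP => e; have : zeta ^+ 2 = 1 by rewrite expr2 {2}e divff.
  move/eqP; rewrite -(prim_order_dvd pz) => /dvdn_leq h.
  by have := leq_trans n3 (h isT).
have zw : zeta * zeta^-1 = 1 by rewrite divff.
split.
- apply: (fmorph_inj iota); rewrite hl rmorphB rmorphXn rmorph_nat /= heta.
  by field.
- by rewrite -(fmorph_eq0 iota) hl expf_neq0 // subr_eq0.
have : cheb (iota eta) n == (0, -1).
  by rewrite -(cheb_unity _ zw (esym heta) znw) (prim_expr_order pz).
rewrite cheb_morph xpair_eqE fmorph_eq0 -(rmorphN1 iota) (inj_eq (fmorph_inj iota)).
by case: (cheb eta n) => u v /= /andP[/eqP -> /eqP ->].
Qed.

Lemma dihedral_unity (eta : K) n : eta ^+ 2 - 4 != 0 -> cheb eta n = (0, -1) ->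
  ((2^-1) *: (eta%:A + qi (eta ^+ 2 - 4) (-1))) ^+ n = 1.
Proof.
move=> l0 hch; have n2 : 2 != 0 :> K by rewrite nf_nat_eq0.
apply/eqP; rewrite (quat_unity (eta := eta)) ?hch //.
  by congr Quat; rewrite /=; field.
move=> c [] _ /eqP; rewrite !mulr0 add0r mulr1 invr_eq0.
by rewrite (negPf n2).
Qed.

Lemma sufficiency_lambda (A : falgType K) n (l : K) : central_simple A -> (3 <= n)%N ->
  lambda_sqr_in R n l -> at_most_one_complex_pair R K -> alg_isom A (quat l (-1)) ->
  schur_algebra A /\ kleinian_type R A.
Proof.
move=> hA n3 /(lambda_sqr_cheb n3) [eta [-> l0 hch]] amo iso.
have n0 : (0 < n)%N by exact: leq_trans n3.
split; first exact: schur_quat_dihedral n0 hA iso (dihedral_unity l0 hch).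
have m0 : -1 != 0 :> K by rewrite oppr_eq0 oner_neq0.
have rl (tau : {rmorphism K -> C}) : ~ nonreal_embedding tau ->
    (forall x, tau x \is Num.real) /\ tau (eta ^+ 2 - 4) < 0 /\ tau (-1) < 0.
  move=> nr; split; last by rewrite (cheb_negative _ n0 hch l0) rmorphN1 oppr_lt0 ltr01.
  by move=> x; apply/negP => /negP h; apply: nr; exists x.
have [[s hs]|no] := boolp.EM (exists s : {rmorphism K -> C}, nonreal_embedding s).
  apply: (kleinian_quat (sigma := s) l0 m0 iso) => t.
  have [ht|ht] := boolp.EM (nonreal_embedding t); last by constructor 3; exact: rl.
  by have [h|h] := amo t s ht hs; [constructor 1 | constructor 2].
have [s] := emb_exists.
apply: (kleinian_quat (sigma := s) l0 m0 iso) => t; constructor 3; apply: rl => ht.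
by apply: no; exists t.
Qed.

Lemma neg_neq0 (k : nat) : - k.+1%:R != 0 :> K.
Proof. by rewrite oppr_eq0 nf_nat_eq0. Qed.

(** The case eta = 0, n = 4, lambda^2 = -4, with i halved: the quaternion group of order 8. *)
Lemma schur_quat_m1m1 (A : falgType K) : central_simple A ->
  alg_isom A (quat (-1 : K) (-1)) -> schur_algebra A.
Proof.
move=> hA iso; have l0 : (0 : K) ^+ 2 - 4 != 0 by rewrite expr0n sub0r neg_neq0.
apply: (@schur_quat_dihedral _ _ 0 4 isT hA); last first.
  by apply: dihedral_unity => //=; congr pair; ring.
apply: alg_isom_trans iso _; apply: alg_isom_sym.
apply: (alg_isom_quat (I := 2^-1 *: qi _ _) (J := qj _ _)).
- by rewrite nf_nat_eq0.
- exact: (neg_neq0 0).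
- exact: (neg_neq0 0).
- exact: dim_quat.
- have n2 : 2 != 0 :> K by rewrite nf_nat_eq0.
  by congr Quat; rewrite /=; field.
- exact: qj_sqr.
by rewrite -scalerAr -scalerAl qji scalerN.
Qed.

(** The case eta = 1, n = 6, lambda^2 = -3: the dicyclic group of order 12. *)
Lemma schur_quat_m1m3 (A : falgType K) : central_simple A ->
  alg_isom A (quat (-1 : K) (-3%:R)) -> schur_algebra A.
Proof.
move=> hA iso; have e : (1 : K) ^+ 2 - 4 = - 3%:R by ring.
apply: (@schur_quat_dihedral _ _ 1 6 isT hA); last first.
  by apply: dihedral_unity; rewrite ?e ?neg_neq0 //=; congr pair; ring.
rewrite e; apply: alg_isom_trans iso _; apply: quat_swap; first by rewrite nf_nat_eq0.
  exact: (neg_neq0 0).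
exact: neg_neq0.
Qed.
End Sufficiency.

(** * Matrix algebras of Kleinian type *)

Section Pigeonhole.
Variable R : realType.

Lemma finite_collision (X Y : finType) (g : X -> Y) : (#|Y| < #|X|)%N ->
  exists x x', x != x' /\ g x = g x'.
Proof.
move=> lt; have [h|/injectivePn [x [x' ne e]]] := boolP (injectiveb g); last by exists x, x'.
by have := leq_card g (injectiveP _ h); rewrite leqNgt lt.
Qed.

Definition cell (B : R) (q : nat) (v : R) : 'I_q.+1 :=
  inord (Num.truncn ((v + B) * q%:R / (B *+ 2))).

Lemma cellP (B : R) q v v' : 0 < B -> (0 < q)%N -> `|v| <= B -> `|v'| <= B ->
  cell B q v = cell B q v' -> `|v - v'| <= B *+ 2 / q%:R.
Proof.
move=> B0 q0 hv hv' /(congr1 (fun i : 'I__ => i : nat)).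
have B2 : 0 < B *+ 2 by rewrite pmulrn_lgt0.
have qR : 0 < q%:R :> R by rewrite ltr0n.
have lo (w : R) : `|w| <= B -> 0 <= (w + B) * q%:R / (B *+ 2).
  rewrite ler_norml => /andP[h1 h2]; apply: divr_ge0; last exact: ltW.
  by apply: mulr_ge0; [rewrite -lerBlDr sub0r | exact: ltW].
have hi (w : R) : `|w| <= B -> (w + B) * q%:R / (B *+ 2) <= q%:R.
  rewrite ler_norml => /andP[h1 h2]; rewrite ler_pdivrMr // mulrC ler_pM2l // mulr2n.
  by rewrite lerD2r.
have lt (w : R) : `|w| <= B -> (Num.truncn ((w + B) * q%:R / (B *+ 2)) < q.+1)%N.
  move=> hw; rewrite ltnS -(ler_nat R); apply: le_trans (hi w hw).
  by have /andP[] := truncn_itv (lo w hw).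
rewrite /cell !inordK ?lt // => e.
have /andP[a1 a2] := truncn_itv (lo v hv); have /andP[b1 b2] := truncn_itv (lo v' hv').
rewrite -e in b1 b2.
have : `|(v + B) * q%:R / (B *+ 2) - (v' + B) * q%:R / (B *+ 2)| <= 1.
  rewrite ler_norml; move: a1 a2 b1 b2; rewrite -!natr1.
  set x := _ / _; set y := _ / _; set t := _%:R.
  by move=> *; apply/andP; split; lra.
rewrite (_ : _ - _ = (v - v') * (q%:R / (B *+ 2))); last by field; rewrite lt0r_neq0.
rewrite normrM [X in _ * X]gtr0_norm ?divr_gt0 // mulrA ler_pdivrMr // mul1r => h.
by rewrite ler_pdivlMr.
Qed.

(** Siegel's box argument, with q k + 1 labels for the values of the k-th form. The value q k = 0
    leaves that form unconstrained, which lets a caller select the forms to be made small. *)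
Lemma pigeonhole_linear (D M : finType) (l : M -> D -> R) (H : nat) (q : M -> nat) :
  (\prod_k (q k).+1 < H.+1 ^ #|D|)%N ->
  exists c : D -> int, [/\ exists i, c i != 0, forall i, `|c i| <= H%:Z &
    forall k, (0 < q k)%N ->
      `|\sum_i l k i * (c i)%:~R| <= ((1 + \sum_i `|l k i|) * H%:R) *+ 2 / (q k)%:R].
Proof.
move=> lt.
have H0 : (0 < H)%N.
  case: H lt => //; rewrite exp1n ltnS leqn0 => /eqP e.
  have : (0 < \prod_k (q k).+1)%N by apply: prodn_gt0.
  by rewrite e.
pose B k : R := (1 + \sum_i `|l k i|) * H%:R.
have B0 k : 0 < B k.
  by rewrite mulr_gt0 ?ltr0n // ltr_pwDl ?ltr01 // sumr_ge0.
pose v (c : {ffun D -> 'I_H.+1}) k : R := \sum_i l k i * (c i : nat)%:R.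
have hv c k : `|v c k| <= B k.
  apply: le_trans (ler_norm_sum _ _ _) _; rewrite /B mulrDl mul1r mulr_suml.
  apply: (@le_trans _ _ (\sum_i `|l k i| * H%:R)); last by rewrite lerDr.
  apply: ler_sum => i _; rewrite normrM normr_nat ler_wpM2l // ler_nat.
  by rewrite -ltnS ltn_ord.
pose g (c : {ffun D -> 'I_H.+1}) : {dffun forall k : M, 'I_(q k).+1} :=
  [ffun k => cell (B k) (q k) (v c k)].
have [|c [c' [ne eg]]] := @finite_collision _ _ g.
  rewrite card_ffun card_ord card_dep_ffun; move: lt; congr (_ < _)%N.
  by rewrite foldrE big_map big_enum; apply: eq_bigr => k _; rewrite card_ord.
exists (fun i => (c i : nat)%:Z - (c' i : nat)%:Z); split.
  apply: boolp.contrapT => no; move/eqP: ne; apply; apply/ffunP => i; apply: val_inj.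
  apply/eqP; rewrite -eqz_nat -subr_eq0; apply/negP => /negP h; apply: no; by exists i.
  move=> i; have := ltn_ord (c i); have := ltn_ord (c' i).
  by move: (val (c i)) (val (c' i)) => p p'; clear; lia.
move=> k qk; have /ffunP /(_ k) := eg; rewrite !ffunE => /(cellP (B0 k) qk (hv _ _) (hv _ _)).
rewrite (_ : v c k - v c' k = \sum_i l k i * ((c i : nat)%:Z - (c' i : nat)%:Z)%:~R) //.
by rewrite /v -sumrB; apply: eq_bigr => i _; rewrite intrB mulrBr.
Qed.

End Pigeonhole.

Section OrderPigeonhole.
Variables (R : realType) (K : fieldExtType rat) (theta : K) (F : {poly int}).
Hypothesis gen : integral_generator theta F.
Local Notation C := R[i].
Local Notation n := (\dim {:K}).
Local Notation Re := complex.Re.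
Local Notation Im := complex.Im.

Lemma ReD (x y : C) : Re (x + y) = Re x + Re y. Proof. by case: x; case: y. Qed.
Lemma ImD (x y : C) : Im (x + y) = Im x + Im y. Proof. by case: x; case: y. Qed.
Lemma Re_sum (I : finType) (G : I -> C) : Re (\sum_i G i) = \sum_i Re (G i).
Proof. exact: (big_morph _ ReD). Qed.
Lemma Im_sum (I : finType) (G : I -> C) : Im (\sum_i G i) = \sum_i Im (G i).
Proof. exact: (big_morph _ ImD). Qed.
Lemma ReMz (x : C) (z : int) : Re (z%:~R * x) = Re x * z%:~R.
Proof. by case: x => a b; rewrite -(rmorph_int (real_complex R)) /=; simpc; rewrite mulrC. Qed.
Lemma ImMz (x : C) (z : int) : Im (z%:~R * x) = Im x * z%:~R.
Proof. by case: x => a b; rewrite -(rmorph_int (real_complex R)) /=; simpc; rewrite mulrC. Qed.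

Lemma norm_ReIm (z : C) (e : R) : `|Re z| <= e -> `|Im z| <= e -> `|z| <= (e *+ 2)%:C%C.
Proof.
move=> hx hy; have e0 : 0 <= e by apply: le_trans hx.
rewrite normc_def lecR -[leRHS]ger0_norm ?mulrn_wge0 // -sqrtr_sqr ler_sqrt ?sqr_ge0 //.
rewrite -(real_normK (num_real (Re z))) -(real_normK (num_real (Im z))).
have := normr_ge0 (Re z); have := normr_ge0 (Im z); rewrite mulr2n.
by move: hx hy e0; set x := `|_|; set y := `|_|; clearbody x y; clear => *; nra.
Qed.

Lemma order_emb_coords (s : {rmorphism K -> C}) (c : 'I_n -> int) :
  s (\sum_(i < n) (c i)%:~R * theta ^+ i) = \sum_(i < n) (c i)%:~R * s theta ^+ i.
Proof.
by rewrite rmorph_sum; apply: eq_bigr => i _; rewrite rmorphM rmorph_int rmorphXn.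
Qed.

Lemma gen_free (c : 'I_n -> int) : \sum_(i < n) (c i)%:~R * theta ^+ i = 0 -> forall i, c i = 0.
Proof.
move=> e j; pose P := \poly_(i < n) oapp (fun j => (c j)%:~R : rat) 0 (insub i).
have cP (i : 'I_n) : P`_i = (c i)%:~R by rewrite coef_poly ltn_ord valK.
have : map_poly intr F %| P.
  apply: (generator_dvd gen); rewrite -[RHS]e (@horner_coef_wide _ n); last first.
    by rewrite size_map_poly size_poly.
  by apply: eq_bigr => i _; rewrite coef_map cP; congr (_ * _); exact: in_alg_int.
move/dvdp_leq => h; have P0 : P = 0.
  apply/eqP; apply: contraT => /h; rewrite size_map_inj_poly //; last exact: intr_inj.
  have [_ -> _ _] := gen => /leq_trans /(_ (size_poly _ _)).
  by rewrite ltnn.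
by apply: (@intr_inj rat); rewrite -cP P0 coef0.
Qed.

Lemma order_small_form (M : finType) (l : M -> 'I_n -> R) (H t : nat) (q : M -> nat) :
  (0 < t)%N -> (forall k, (0 < q k)%N -> (H * t <= 2 * q k)%N) ->
  (\prod_k (q k).+1 < H.+1 ^ n)%N ->
  exists c : 'I_n -> int, \sum_(i < n) (c i)%:~R * theta ^+ i != 0 /\
    forall k, (0 < q k)%N -> `|\sum_i l k i * (c i)%:~R| <= (1 + \sum_i `|l k i|) *+ 4 / t%:R.
Proof.
move=> t0 hq; rewrite -[n in (_ ^ n)%N]card_ord => /(@pigeonhole_linear R) h.
have [c [[i ci] _ hc]] := h l; exists c; split.
  by apply: contra_neq ci => /gen_free.
move=> k qk; apply: le_trans (hc k qk) _; have := hq k qk.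
set B : R := \sum_i _ => le; have B0 : 0 <= B by apply: sumr_ge0.
have qR : 0 < (q k)%:R :> R by rewrite ltr0n.
have tR : 0 < t%:R :> R by rewrite ltr0n.
rewrite ler_pdivrMr // mulrAC ler_pdivlMr //.
have leR : H%:R * t%:R <= 2 * (q k)%:R :> R by rewrite -!natrM ler_nat.
have : (1 + B) * (H%:R * t%:R) <= (1 + B) * (2 * (q k)%:R) by rewrite ler_wpM2l // addr_ge0.
have -> : (1 + B) * H%:R *+ 2 * t%:R = ((1 + B) * (H%:R * t%:R)) *+ 2 by ring.
have -> : (1 + B) *+ 4 * (q k)%:R = ((1 + B) * (2 * (q k)%:R)) *+ 2 by ring.
by rewrite lerMn2r.
Qed.

(** A discrete subgroup of C has rank at most 2, and one inside R has rank at most 1, whereas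
    Z[theta] has rank n. *)
Lemma order_discrete_dim (s : {rmorphism K -> C}) (d : R) : 0 < d ->
  (forall x, in_order theta x -> `|s x| < d%:C%C -> x = 0) ->
  (n <= 2)%N /\ (n = 2 -> nonreal_embedding s).
Proof.
move=> d0 hd.
pose lr (i : 'I_n) := Re (s theta ^+ i); pose li (i : 'I_n) := Im (s theta ^+ i).
pose B : R := (1 + \sum_(i < n) `|lr i|) + (1 + \sum_(i < n) `|li i|).
have B1 : 1 + \sum_(i < n) `|lr i| <= B by rewrite lerDl addr_ge0 // sumr_ge0.
have B2 : 1 + \sum_(i < n) `|li i| <= B by rewrite lerDr addr_ge0 // sumr_ge0.
have B0 : 0 < B by apply: lt_le_trans B1; rewrite ltr_pwDl // sumr_ge0.
pose t := (Num.truncn (B *+ 8 / d)).+2.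
have tR : 0 < t%:R :> R by rewrite ltr0n.
have ht : B *+ 4 / t%:R *+ 2 < d.
  rewrite -mulrnAl -mulrnA ltr_pdivrMr // -ltr_pdivrMl // mulrC.
  have /andP[_ h] := truncn_itv (divr_ge0 (mulrn_wge0 8 (ltW B0)) (ltW d0)).
  by apply: lt_trans h _; rewrite ltr_nat.
have t2 : (2 <= t)%N by [].
have t0 : (0 < t)%N by [].
clearbody t.
have conc (c : 'I_n -> int) : \sum_(i < n) (c i)%:~R * theta ^+ i != 0 ->
   `|\sum_i lr i * (c i)%:~R| <= B *+ 4 / t%:R ->
   `|\sum_i li i * (c i)%:~R| <= B *+ 4 / t%:R -> False.
  move=> nz h1 h2; move/eqP: nz; apply; apply: hd; first exact: in_order_of_coords.
  apply: (@le_lt_trans _ _ (B *+ 4 / t%:R *+ 2)%:C%C); last by rewrite ltcR.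
  rewrite order_emb_coords; apply: norm_ReIm; rewrite ?Re_sum ?Im_sum.
    by under eq_bigr => i _ do rewrite ReMz.
  by under eq_bigr => i _ do rewrite ImMz.
have le4 x : x <= B -> x *+ 4 / t%:R <= B *+ 4 / t%:R.
  by move=> h; rewrite ler_pM2r ?invr_gt0 // lerMn2r.
split.
  rewrite leqNgt; apply/negP => n3.
  (* With t^2 values per coefficient and t^3 - 1 labels for each of the two forms, (t^3 - 1)^2 <
     (t^2)^3 <= (t^2)^n forces a collision at scale 1/t. *)
  have [||c [nz hc]] := @order_small_form bool (fun b => if b then lr else li) (t ^ 2).-1 t
      (fun=> t ^ 3 - 2)%N t0.
  - by move=> _ _; move: (t) t2; clear => u hu; nia.
  - rewrite big_const card_bool /= muln1 prednK ?expn_gt0 ?t0 //.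
    apply: (@leq_trans ((t ^ 2) ^ 3)); last by rewrite leq_pexp2l ?expn_gt0 ?t0.
    by move: (t) t2; clear => u hu; nia.
  have q0 : (0 < t ^ 3 - 2)%N by move: (t) t2; clear => u hu; nia.
  apply: (conc c nz).
    by apply: le_trans (hc true q0) _; exact: le4.
  by apply: le_trans (hc false q0) _; exact: le4.
move=> n2; apply: boolp.contrapT => nr.
have sr x : Im (s x) = 0.
  have : s x \is Num.real by apply/negP => /negP h; apply: nr; exists x.
  by move=> /complex_realP [k ->].
have [||c [nz hc]] := @order_small_form unit (fun _ => lr) t.-1 t (fun=> t ^ 2 - 2)%N t0.
- by move=> _ _; move: (t) t2; clear => u hu; nia.
- rewrite big_const card_unit /= muln1 prednK //.
  by rewrite n2; move: (t) t2; clear => u hu; nia.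
have q0 : (0 < t ^ 2 - 2)%N by move: (t) t2; clear => u hu; nia.
apply: (conc c nz).
  by apply: le_trans (hc tt q0) _; exact: le4.
rewrite big1 ?normr0 => [|i _]; last by rewrite /li -rmorphXn sr mul0r.
by rewrite divr_ge0 ?mulrn_wge0 // ltW.
Qed.

End OrderPigeonhole.

Section SmallDegree.
Variables (R : realType) (K : fieldExtType rat).
Local Notation C := R[i].
Local Notation n := (\dim {:K}).

Lemma rational_of_dim : (n <= 1)%N -> is_rational_field K.
Proof.
move=> h; apply/eqP; rewrite eq_sym eqEdim sub1v /=.
by rewrite dimv1.
Qed.

(** The element 2 theta + f_1 is a square root of the discriminant of f; square factors are then
    removed by descent on its absolute value. *)
Lemma quadratic_of_dim : n = 2 -> exists d, squarefree d /\ is_quadratic_field K d.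
Proof.
move=> n2; have [theta [f gen]] := integral_generator_exists K; have [mf sf rf sur] := gen.
pose irr (s : K) := forall p : rat, s <> p%:A.
have irr_full s : irr s -> <<1; s>>%VS = {:K}%VS.
  move=> hs; apply/eqP; rewrite eqEdim subvf /= n2.
  have : s \notin 1%VS by apply/negP => /vlineP [p e]; apply: (hs p).
  rewrite -adjoin_deg_eq1 => h1; rewrite dim_Fadjoin dimv1 muln1.
  by move: h1; rewrite /adjoin_degree; case: _.-1.
pose P k := exists D : int, [/\ absz D = k, D != 0 & exists s, irr s /\ s ^+ 2 = D%:~R].
have [k Pk] : exists k, P k.
  pose s := 2 * theta + (f`_1)%:~R; pose D := f`_1 ^+ 2 - 4 * f`_0.
  have ft : theta ^+ 2 + (f`_1)%:~R * theta + (f`_0)%:~R = 0.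
    have sz : size (map_poly intr f : {poly K}) = 3%N.
      rewrite -map_intr_in_alg size_map_poly size_map_inj_poly ?sf ?n2 //; exact: intr_inj.
    have := rootP rf; rewrite (@horner_coef_wide _ 3) ?sz //.
    rewrite !big_ord_recl big_ord0 !coef_map /= /bump /= => <-.
    have -> : f`_2 = 1 by move/monicP: mf; rewrite /lead_coef sf n2.
    by rewrite rmorph1; ring.
  have sD : s ^+ 2 = D%:~R.
    have -> : D%:~R = (f`_1)%:~R ^+ 2 - 4 * (f`_0)%:~R :> K.
      by rewrite /D rmorphB /= rmorphXn rmorphM.
    set u : K := (f`_1)%:~R; set v : K := (f`_0)%:~R.
    transitivity (u ^+ 2 - 4 * v + 4 * (theta ^+ 2 + u * theta + v)); first by rewrite /s -/u; ring.
    by rewrite ft mulr0 addr0.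
  have irs : irr s.
    move=> p es; have tr : theta = ((p - (f`_1)%:~R) / 2)%:A.
      have n0 : 2 != 0 :> K by rewrite nf_nat_eq0.
      apply: (mulfI n0); rewrite -[LHS](addrK (f`_1)%:~R) -/s es -in_alg_int.
      rewrite -[_%:A - _]/(in_alg K _ - in_alg K _) -rmorphB /= mulr_algr -scaler_nat scalerA.
      by rewrite divfK.
    have : (\dim {:K} <= \dim (1%VS : {vspace K}))%N.
      apply/dimvS/subvP => x _; have [q ->] := sur x; apply/vlineP; exists q.[(p - (f`_1)%:~R) / 2].
      by rewrite tr -[_%:A in LHS]/(in_alg K _) horner_map.
    by rewrite dimv1 n2.
  exists (absz D), D; split=> //; last by exists s.
  apply/eqP => D0; apply: (irs 0); rewrite scale0r; apply/eqP.
  by rewrite -sqrf_eq0 sD D0.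
elim/ltn_ind: k Pk => k IH [D [eD D0 [s [irs hs]]]].
have [sq|nsq] := boolp.EM (squarefree D).
  by exists D; split=> //; exists s; split=> //; exact: irr_full.
have [m [hm um]] : exists m : int, (m ^+ 2 %| D)%Z /\ m \isn't a GRing.unit.
  apply: boolp.contrapT => no; apply: nsq => m hm; apply: contraT => um; case: no.
  by exists m.
have /dvdzP [q eq] := hm.
have [q0 m0] : q != 0 /\ m != 0.
  by split; apply: contraNneq D0 => z0; rewrite eq z0 ?mul0r ?expr0n ?mulr0.
have m2 : (2 <= absz m)%N.
  move: um m0; rewrite unfold_in /=; clear; lia.
apply: (IH (absz q)).
  rewrite -eD eq abszM abszX -[X in (X < _)%N]muln1 ltn_pmul2l ?absz_gt0 //.
  by move: m2; clear; nia.
exists q; split=> //; exists (s / m%:~R); have mK : m%:~R != 0 :> K by rewrite nf_int_eq0.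
split.
  move=> p e; apply: (irs (p * m%:~R)).
  by rewrite -[LHS](divfK mK) e -in_alg_int /= -scalerAl mul1r scalerA.
rewrite expr_div_n hs eq intrM rmorphXn /= mulfK // expf_neq0 //.
Qed.
End SmallDegree.

Section OrderScale.
Variables (K : fieldExtType rat) (A : falgType K) (O : set A) (theta : K) (F : {poly int}).
Hypotheses (gen : integral_generator theta F) (hO : Z_order O).
Local Notation n := (\dim {:K}).

Lemma Z_orderB x y : O x -> O y -> O (x - y).
Proof. by case: hO => _ h _ _ hx hy; case: (h x y). Qed.
Lemma Z_orderM x y : O x -> O y -> O (x * y).
Proof. by case: hO => _ h _ _ hx hy; case: (h x y). Qed.
Lemma Z_order1 : O 1. Proof. by case: hO. Qed.
Lemma Z_order0 : O 0. Proof. by rewrite -(subrr 1); apply: Z_orderB; exact: Z_order1. Qed.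
Lemma Z_orderN x : O x -> O (- x).
Proof. by move=> h; rewrite -sub0r; apply: Z_orderB => //; exact: Z_order0. Qed.
Lemma Z_orderD x y : O x -> O y -> O (x + y).
Proof. by move=> hx hy; rewrite -[y]opprK; apply: Z_orderB => //; exact: Z_orderN. Qed.
Lemma Z_orderMz x (z : int) : O x -> O (x *~ z).
Proof.
move=> hx; have h (m : nat) : O (x *+ m).
  elim: m => [|m IH]; first exact: Z_order0.
  by rewrite mulrS; exact: Z_orderD.
by case: z => m; [exact: h | rewrite NegzE mulrNz; exact/Z_orderN/h].
Qed.
Lemma Z_order_sum (I : finType) (G : I -> A) : (forall i, O (G i)) -> O (\sum_i G i).
Proof. by move=> h; apply: (big_ind O) => //; [exact: Z_order0 | exact: Z_orderD]. Qed.

Lemma Z_order_scale (E : A) : exists2 N : nat, (0 < N)%N &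
  forall k, in_order theta k -> O ((N%:R * k) *: E).
Proof.
have h (i : 'I_n) : exists m : nat, (0 < m)%N /\ O ((theta ^+ i *: E) *+ m).
  by case: hO => _ _ _; apply.
have [m hm] := fin_all_exists h.
exists (\prod_i m i)%N; first by apply: prodn_gt0 => i; case: (hm i).
move=> k /(in_order_coords gen) [c ->].
rewrite mulr_sumr scaler_suml; apply: Z_order_sum => i.
have [_ hi] := hm i.
have -> : ((\prod_i m i)%:R * ((c i)%:~R * theta ^+ i)) *: E =
    ((theta ^+ i *: E) *+ m i) *~ ((\prod_(j | j != i) m j)%N%:Z * c i).
  rewrite -(@scaler_int K A) -(@scaler_nat K A) !scalerA; congr (_ *: _).
  by rewrite (bigD1 i) //= natrM intrM; ring.
exact: Z_orderMz.
Qed.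
End OrderScale.

Section Unipotent.
Variables (R : realType) (K : fieldExtType rat) (A : falgType K) (a b : K).
Variables (f : {lrmorphism A -> quat a b}) (sigma : {rmorphism K -> R[i]}).
Variable (phi : {rmorphism A -> 'M[R[i]]_2}).
Hypotheses (bf : bijective f) (a0 : a != 0) (b0 : b != 0).
Hypothesis (ext : extends_embedding sigma phi).
Variable O : set A.
Hypotheses (hO : Z_order O) (disc : discrete_set (phi @` norm1_units 2 O)%classic).
Local Notation n := (\dim {:K}).

Lemma qnorm_unipotent (y : quat a b) : y * y = 0 -> qnorm (1 + y) = 1.
Proof.
move=> yy; have n0 : qnorm y = 0.
  by apply/eqP; rewrite -sqrf_eq0 expr2 -qnormM yy /qnorm /= !expr0n /= !mulr0 !addr0 !subrr.
have : (qcoef0 y *+ 2) *: y = 0 by have := qsqr y; rewrite yy n0 scale0r subr0.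
move/(congr1 (fun q => qcoef0 q)); case: y n0 {yy} => y0 y1 y2 y3; rewrite /qnorm /= => n0 e0.
have /eqP : 2 * y0 ^+ 2 = 0 by rewrite -[RHS]e0; ring.
rewrite mulf_eq0 nf_nat_eq0 sqrf_eq0 /= => /eqP e.
transitivity (1 + 2 * y0 + (y0 ^+ 2 - a * y1 ^+ 2 - b * y2 ^+ 2 + a * b * y3 ^+ 2)); first by ring.
by rewrite n0 e mulr0 !addr0.
Qed.

(** The elements 1 + N k E with k in Z[theta] are norm one units, so discreteness bounds |sigma(k)|
    from below for k nonzero. The companion E' guarantees that phi(E) is nonzero. *)
Lemma unipotent_discrete (E E' : A) : E * E = 0 -> E * E' + E' * E = 1 -> (n <= 2)%N /\
  (n = 2 -> nonreal_embedding sigma).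
Proof.
move=> EE hE'; have [theta [F gen]] := integral_generator_exists K.
have [N N0 hN] := Z_order_scale gen hO E.
have [e e0 he] := discrete_near_one bf a0 b0 ext hO disc.
pose B : R[i] := 1 + \sum_i \sum_j `|phi E i j|.
have B0 : 0 < B by rewrite ltr_pwDl // sumr_ge0 // => i _; rewrite sumr_ge0.
have leB i j : `|phi E i j| <= B.
  apply: (le_trans (sum_ge_term (F := fun k => `|phi E i k|) j _)) => //.
  apply: ler_wpDl => //; apply: (sum_ge_term (F := fun k => \sum_l `|phi E k l|) i).
  by move=> k; apply: sumr_ge0.
have NC : 0 < N%:R :> R[i] by rewrite ltr0n.
have phiE : phi E != 0.
  apply/eqP => h; have := rmorph1 phi; rewrite -hE' rmorphD !rmorphM h mulr0 mul0r addr0.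
  by move/eqP; rewrite eq_sym oner_eq0.
have dR : e / (N%:R * B) \is Num.real by rewrite gtr0_real // divr_gt0 // mulr_gt0.
have [d ed] := complex_realP _ dR.
have d0 : 0 < d by rewrite -ltcR -ed divr_gt0 // mulr_gt0.
apply: (@order_discrete_dim _ _ _ _ gen sigma d d0) => k ok; rewrite -ed => hk.
set y := (N%:R * k) *: E.
have yy : y * y = 0 by rewrite -scalerAl -scalerAr EE !scaler0.
have oy : O y by exact: hN.
have inv : (1 + y)^-1 = 1 - y /\ 1 + y \is a GRing.unit.
  have h1 : (1 + y) * (1 - y) = 1 by rewrite mulrDl mul1r mulrBr yy subr0 mulr1 subrK.
  have h2 : (1 - y) * (1 + y) = 1 by rewrite mulrBl mul1r mulrDr yy addr0 mulr1 addrK.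
  have u : 1 + y \is a GRing.unit by apply/unitrP; exists (1 - y).
  by split=> //; apply: (mulrI u); rewrite divrr.
have hx : norm1_units 2 O (1 + y).
  apply/(norm1_unitsP bf a0 b0 ext); split.
  - by apply: (Z_orderD hO) => //; exact: Z_order1.
  - by rewrite rmorphD rmorph1; apply: qnorm_unipotent; rewrite -rmorphM yy rmorph0.
  by rewrite (proj1 inv); apply: (Z_orderB hO) => //; exact: Z_order1.
have phiy : phi (1 + y) = 1 + sigma (N%:R * k) *: phi E.
  by rewrite rmorphD rmorph1 (phi_scale ext).
have : phi (1 + y) = 1.
  apply: he => // i j; rewrite phiy [X in X - _]mxE addrAC subrr add0r mxE normrM rmorphM rmorph_nat.
  rewrite normrM normr_nat; move: hk; rewrite ltr_pdivlMr ?mulr_gt0 // => hk.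
  apply: le_lt_trans hk; rewrite mulrA [N%:R * _]mulrC; apply: ler_wpM2l => //.
  by rewrite mulr_ge0 // ler0n.
rewrite phiy => /eqP; rewrite -subr_eq0 addrAC subrr add0r scaler_eq0 (negPf phiE) orbF.
rewrite fmorph_eq0 mulf_eq0 => /orP [|/eqP //].
by rewrite nf_nat_eq0 eqn0Ngt N0.
Qed.
End Unipotent.

Section MatrixCase.
Variables (R : realType) (K : fieldExtType rat).

Lemma noncomm_kleinian (A : falgType K) : (exists x y : A, x * y <> y * x) ->
  kleinian_type R A ->
  exists (a b : K) (O : set A) (f : {lrmorphism A -> quat a b}) (sigma : {rmorphism K -> R[i]})
     (phi : {rmorphism A -> 'M[R[i]]_2}),
  [/\ a != 0, b != 0 & bijective f] /\
  [/\ Z_order O, extends_embedding sigma phi &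
     discrete_set (phi @` norm1_units 2 O)%classic].
Proof.
move=> [x [y nc]] [full|[[a [b [a0 b0 [f bf]]]] [O [s [phi h]]]]].
  have /vlineP [u eu] : x \in 1%VS by rewrite -full memvf.
  have /vlineP [v ev] : y \in 1%VS by rewrite -full memvf.
  by case: nc; rewrite eu ev !mulr_algl !scalerA mulrC.
by exists a, b, O, f, s, phi.
Qed.

Lemma imaginary_negative d (s : {rmorphism K -> R[i]}) : squarefree d -> is_quadratic_field K d ->
  nonreal_embedding s -> d < 0.
Proof.
move=> sq /quadratic_coords [r hr crd] [x hx]; rewrite ltNge; apply/negP => d0.
have rr : s r \is Num.real.
  have : 0 <= s r ^+ 2 by rewrite -rmorphXn hr rmorph_int ler0z.
  by rewrite realEsqr.
have [p [q ex]] := crd x; move/negP: hx; apply.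
rewrite ex rmorphD -[q *: r]mulr_algl rmorphM !emb_rat.
have ratrR (t : rat) : (ratr t : R[i]) \is Num.real.
  by rewrite /ratr rpred_div // realz.
by rewrite rpredD // rpredM.
Qed.

Lemma matrix_kleinian (A : falgType K) : (exists x y : A, x * y <> y * x) ->
  alg_isom A 'M[K]_2 -> kleinian_type R A ->
  is_rational_field K \/ exists d : int, [/\ d < 0, squarefree d & is_quadratic_field K d].
Proof.
move=> nc /alg_isom_sym [h bh] /(noncomm_kleinian nc).
move=> [a [b [O [f [s [phi [[a0 b0 bf] [hO ext disc]]]]]]]].
have [] := @unipotent_discrete _ _ _ _ _ f s phi bf a0 b0 ext O hO disc
   (h (delta_mx 0 1)) (h (delta_mx 1 0)).
- by rewrite -rmorphM -[_ * _]/(_ *m _) mul_delta_mx_0 // rmorph0.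
- rewrite -!rmorphM -rmorphD -(rmorph1 h); congr (h _).
  by apply: mx2_eq; rewrite !mxE !big_ord_recl !big_ord0 !mxE /=; ring.
move=> n2 hn; have [e2|ne2] := eqVneq (\dim {:K}) 2%N; last first.
  by left; apply: rational_of_dim; rewrite -ltnS ltn_neqAle ne2.
right; have [d [sq hq]] := quadratic_of_dim e2; exists d; split=> //.
exact: imaginary_negative sq hq (hn e2).
Qed.
End MatrixCase.

(** * Units of quaternion division algebras *)

Section RealNorm.
Variable R : realType.
Local Notation C := R[i].

(** The absolute value as an element of R, so that estimates take place in a totally ordered
    field. *)
Definition nc (z : C) : R := Normc.normc z.

Lemma ncE (z : C) : `|z| = (nc z)%:C%C. Proof. by []. Qed.
Lemma ncM (x y : C) : nc (x * y) = nc x * nc y. Proof. exact: Normc.normcM. Qed.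
Lemma ncV (x : C) : nc x^-1 = (nc x)^-1. Proof. exact: Normc.normcV. Qed.
Lemma nc_ge0 (x : C) : 0 <= nc x. Proof. by rewrite -ler0c -ncE. Qed.
Lemma nc_eq0 (x : C) : (nc x == 0) = (x == 0).
Proof. by rewrite -(inj_eq (@complexI R)) -ncE normr_eq0. Qed.
Lemma nc_gt0 (x : C) : (0 < nc x) = (x != 0).
Proof. by rewrite lt_def nc_ge0 andbT nc_eq0. Qed.
Lemma ncD (x y : C) : nc (x + y) <= nc x + nc y.
Proof. by rewrite -lecR rmorphD /= -!ncE ler_normD. Qed.
Lemma ncN (x : C) : nc (- x) = nc x.
Proof. by apply: (@complexI R); rewrite -!ncE normrN. Qed.
Lemma ncB (x y : C) : nc (x - y) <= nc x + nc y.
Proof. by rewrite -(ncN y) ncD. Qed.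
Lemma nc_conj (x : C) : nc x^*%C = nc x.
Proof. by apply: (@complexI R); rewrite -!ncE normcJ. Qed.
Lemma nc_nat (k : nat) : nc k%:R = k%:R.
Proof. by apply: (@complexI R); rewrite -ncE normr_nat rmorph_nat. Qed.
Lemma nc_int (k : int) : nc k%:~R = `|k%:~R|.
Proof. by apply: (@complexI R); rewrite -ncE -(rmorph_int (real_complex R)) normc_def /= expr0n addr0 sqrtr_sqr. Qed.
Lemma nc_sum (I : finType) (G : I -> C) : nc (\sum_i G i) <= \sum_i nc (G i).
Proof.
elim/big_ind2: _ => [|x y z t h1 h2|//]; first by rewrite (eqP (_ : nc 0 == 0)) ?nc_eq0.
exact: le_trans (ncD _ _) (lerD h1 h2).
Qed.

Lemma ncX (x : C) k : nc (x ^+ k) = nc x ^+ k.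
Proof.
elim: k => [|k IH]; first by rewrite !expr0 (nc_nat 1).
by rewrite !exprS ncM IH.
Qed.

Lemma bounded_cells (B d : R) : 0 < B -> 0 < d -> exists (T : finType) (r : C -> T),
  forall z z', nc z <= B -> nc z' <= B -> r z = r z' -> nc (z - z') < d.
Proof.
move=> B0 d0; pose q := (Num.truncn (B *+ 4 / d)).+1.
exists ('I_q.+1 * 'I_q.+1)%type.
exists (fun z => (cell B q (complex.Re z), cell B q (complex.Im z))) => z z' hz hz' [e1 e2].
have re (x : C) : `|complex.Re x| <= nc x /\ `|complex.Im x| <= nc x.
  case: x => x y; rewrite /nc /=; split; rewrite -sqrtr_sqr ler_wsqrtr //.
    by rewrite lerDl sqr_ge0.
  by rewrite lerDr sqr_ge0.
have [r1 i1] := re z; have [r2 i2] := re z'.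
have h1 := cellP B0 (isT : 0 < q)%N (le_trans r1 hz) (le_trans r2 hz') e1.
have h2 := cellP B0 (isT : 0 < q)%N (le_trans i1 hz) (le_trans i2 hz') e2.
have : nc (z - z') <= (B *+ 2 / q%:R) *+ 2.
  by rewrite -lecR -ncE; apply: norm_ReIm; move: h1 h2; case: (z) => ? ?; case: (z').
move=> h; apply: le_lt_trans h _.
rewrite -mulrnAl -mulrnA ltr_pdivrMr ?ltr0n // -ltr_pdivrMl // mulrC.
by have /andP[_] := truncn_itv (divr_ge0 (mulrn_wge0 4 (ltW B0)) (ltW d0)).
Qed.

End RealNorm.

Section Residues.
Variables (K : fieldExtType rat) (theta : K) (F : {poly int}).
Hypothesis gen : integral_generator theta F.
Local Notation n := (\dim {:K}).

Lemma order_residues (M : nat) : (0 < M)%N -> exists (T : finType) (r : K -> T),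
  forall x y, in_order theta x -> in_order theta y -> r x = r y ->
  exists2 z, in_order theta z & x - y = M%:R * z.
Proof.
move=> M0.
have h (x : K) : exists c : 'I_n -> int, in_order theta x -> x = \sum_(i < n) (c i)%:~R * theta ^+ i.
  have [ox|nox] := boolp.EM (in_order theta x); last by exists (fun=> 0) => /nox.
  by have [c hc] := in_order_coords gen ox; exists c.
have [c hc] := boolp.choice h.
exists {ffun 'I_n -> 'I_M.+1}, (fun x => [ffun i => inord (absz (c x i %% M)%Z)]).
move=> x y ox oy /ffunP e.
exists (\sum_(i < n) (((c x i - c y i) %/ M)%Z)%:~R * theta ^+ i); first exact: in_order_of_coords.
rewrite {1}(hc x ox) {1}(hc y oy) -sumrB mulr_sumr; apply: eq_bigr => i _.
have lt z : (absz (z %% M)%Z < M.+1)%N by move: M0; clear; lia.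
have := e i; rewrite !ffunE => /(congr1 (fun u : 'I__ => u : nat)); rewrite !inordK // => ei.
have M0' : M%:Z != 0 by rewrite -lt0n.
have dv : (M %| c x i - c y i)%Z.
  rewrite -eqz_mod_dvd; apply/eqP.
  by rewrite -(gez0_abs (modz_ge0 (c x i) M0')) ei gez0_abs // modz_ge0.
by rewrite -mulrBl -intrB -[in LHS](divzK dv) intrM mulrAC mulrC.
Qed.
End Residues.

Lemma big_pair (T : Type) (idx : T) (op : Monoid.com_law idx) (I J : finType) (G : I * J -> T) :
  \big[op/idx]_p G p = \big[op/idx]_i \big[op/idx]_j G (i, j).
Proof. by rewrite pair_bigA; apply: eq_bigr => -[]. Qed.

Section Box.
Variables (R : realType) (K : fieldExtType rat) (theta : K) (F : {poly int}).
Hypothesis gen : integral_generator theta F.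
Local Notation C := R[i].
Local Notation n := (\dim {:K}).
Variable tau1 : {rmorphism K -> C}.
Hypothesis nr : nonreal_embedding tau1.
Local Notation Re := complex.Re.
Local Notation Im := complex.Im.

(* The real and imaginary parts of the embeddings other than tau1 and its conjugate form
   n - 2 real linear forms; each conjugate pair contributes one of each kind. *)
Lemma unbalanced_box (s : C) : exists2 B : R, 0 < B & forall H : nat, (0 < H)%N ->
  exists x0 x1 : K, [/\ in_order theta x0, in_order theta x1, (x0 != 0) || (x1 != 0) &
    [/\ forall t : {rmorphism K -> C}, [\/ t =1 tau1, forall x, t x = (tau1 x)^*%C |
          nc (t x0) <= B /\ nc (t x1) <= B],
        nc (tau1 x0 - s * tau1 x1) * H%:R <= B &
        nc (tau1 x0 + s * tau1 x1) <= B * H%:R]].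
Proof.
have [tau [inj_tau all_tau]] := generator_embeddings gen C.
have tau_eq i j : tau i =1 tau j -> i = j by move=> e; apply: inj_tau; exact: e.
have [j1 ej1] := all_tau tau1.
have hstar j : exists k, forall x, tau k x = (tau j x)^*%C.
  have [k hk] := all_tau (Num.conj \o tau j).
  by exists k => x; rewrite -hk.
have [star hs] := fin_all_exists hstar.
have starK j : star (star j) = j.
  by apply: tau_eq => x; rewrite !hs; exact: conjcK.
have j1s : star j1 != j1.
  apply/eqP => e; have [x /negP] := nr; apply; apply/CrealP.
  by rewrite ej1; have := hs j1 x; rewrite e; exact: esym.
pose S := [pred j | (j == j1) || (j == star j1)].
have starS j : star j \in S = (j \in S).
  rewrite !inE -{1}(inj_eq (can_inj starK)) starK orbC; congr orb.
  exact: (inj_eq (can_inj starK)).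
(* In a conjugate pair the smaller index keeps the real part and the larger one the imaginary part;
   a real embedding, being its own partner, keeps the real part. *)
pose r (j : 'I_n) (z : K) : R := if (j <= star j)%N then Re (tau j z) else Im (tau j z).
have tau_re j z : Re (tau j z) = r j z \/ Re (tau j z) = r (star j) z.
  rewrite /r starK; case: leqP => h; first by left.
  by right; rewrite (ltnW h) hs; case: (tau j z).
have tau_im j z : [\/ Im (tau j z) = r j z, Im (tau j z) = - r (star j) z | Im (tau j z) = 0].
  rewrite /r starK; case: ltngtP => h.
  - by constructor 2; rewrite hs; case: (tau j z) => u v /=; rewrite opprK.
  - by constructor 1.
  constructor 3; have e : star j = j by apply: val_inj.
  by have := hs j z; rewrite e; case: (tau j z) => u v [] /=; lra.
pose c0 (b : bool) : C := if b then - s else 1.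
pose l (k : ('I_n * bool) + bool) (d : bool * 'I_n) : R := match k with
  | inl (j, b) => if b == d.1 then r j (theta ^+ d.2) else 0
  | inr b => let z := c0 d.1 * tau1 (theta ^+ d.2) in if b then Re z else Im z end.
pose B0 : R := \sum_k (1 + \sum_d `|l k d|).
pose B1 : R := \sum_(d : bool * 'I_n) (1 + nc s) * nc (tau1 (theta ^+ d.2)).
have term0 k : 0 <= 1 + \sum_d `|l k d| by rewrite addr_ge0 // sumr_ge0.
have B0k k : 1 + \sum_d `|l k d| <= B0.
  by rewrite /B0 (bigD1 k) //= lerDl sumr_ge0.
have B00 : 0 <= B0 by apply: sumr_ge0.
have B10 : 0 <= B1 by apply: sumr_ge0 => d _; rewrite mulr_ge0 ?addr_ge0 ?nc_ge0.
exists (B0 *+ 4 + B1 + 1); first by rewrite ltr_wpDl // addr_ge0 // mulrn_wge0.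
move=> H H0; have HR : 0 < H%:R :> R by rewrite ltr0n.
(* The forms at tau1 and its conjugate are left free, and the saving goes into the two parts of x0 -
   s x1: the labels number (H+1)^(2(n-2)) ((H+1)^2 - 1)^2, less than (H+1)^(2n). *)
pose q (k : ('I_n * bool) + bool) : nat := match k with
  | inl (j, b) => if j \in S then 0 else H | inr b => (H.+1 ^ 2 - 2)%N end.
have [|c [nzc bc hc]] := @pigeonhole_linear R _ _ l H q.
  rewrite card_prod card_bool card_ord.
  have -> : (\prod_k (q k).+1 = (H.+1 ^ #|[predC S]|) ^ 2 * ((H.+1 ^ 2 - 2).+1 * (H.+1 ^ 2 - 2).+1))%N.
    rewrite big_sumType /= big_bool /= big_pair /=.
    congr (_ * _)%N.
    under eq_bigr => j _ do rewrite big_bool.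
    rewrite big_split /= mulnn; congr (_ ^ 2)%N.
    rewrite (bigID (mem S)) /= big1 ?mul1n => [|j ->] //.
    rewrite -prod_nat_const; apply: eq_big => [j|j]; rewrite !inE // => /negPf.
    by move=> ->.
  have cS : (2 + #|[predC S]| = n)%N.
    rewrite -[RHS]card_ord -(cardC S); congr (_ + _)%N.
    by rewrite -[LHS]/(true.+1) -[in LHS]j1s eq_sym -card2; apply: eq_card => j; rewrite !inE.
  move: cS; move: #|_| => m <-.
  rewrite mulnDr expnD -expnM mulnC [(m * 2)%N]mulnC ltn_pmul2r ?expn_gt0 //.
  by move: H0; clear; nia.
pose x b := \sum_(i < n) (c (b, i))%:~R * theta ^+ i.
exists (x false), (x true).
have ox b : in_order theta (x b) by exact: in_order_of_coords.
have rx j b : \sum_d l (inl (j, b)) d * (c d)%:~R = r j (x b).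
  rewrite big_pair /=.
  rewrite (bigD1 b) //= [X in _ + X]big1 ?addr0 => [|b' /negPf nb]; last first.
    by apply: big1 => i _; rewrite eq_sym nb mul0r.
  rewrite /r order_emb_coords Re_sum Im_sum; case: ifP => h; apply: eq_bigr => i _.
    by rewrite eqxx ReMz rmorphXn.
  by rewrite eqxx ImMz rmorphXn.
have psiE : \sum_d (c d)%:~R * (c0 d.1 * tau1 (theta ^+ d.2)) = tau1 (x false) - s * tau1 (x true).
  rewrite big_pair big_bool /=.
  rewrite addrC !order_emb_coords mulr_sumr -sumrN; congr (_ + _); apply: eq_bigr => i _.
    by rewrite mul1r rmorphXn.
  by rewrite rmorphXn mulNr mulrN; congr (- _); rewrite mulrCA.
split=> //.
  case: nzc => -[b i]; apply: contraNT; rewrite negb_or !negbK => /andP[/eqP e0 /eqP e1].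
  have e : x b = 0 by case: b.
  by apply/eqP; apply: (gen_free gen e).
have rb j b : j \notin S -> `|r j (x b)| <= B0 *+ 2.
  move=> /negPf jS; have qj : q (inl (j, b)) = H by rewrite /q jS.
  rewrite -rx; apply: le_trans (hc (inl (j, b)) _) _; first by rewrite qj.
  by rewrite qj -mulrnAl mulfK ?lt0r_neq0 // lerMn2r B0k.
have B2 : 0 <= B0 *+ 2 by rewrite mulrn_wge0.
split.
- move=> t; have [j hj] := all_tau t.
  have [|jS] := boolP (j \in S).
    rewrite !inE => /orP [] /eqP ej; [constructor 1|constructor 2] => y; rewrite hj ej.
      by rewrite ej1.
    by rewrite hs -ej1.
  constructor 3; have bd b : nc (t (x b)) <= B0 *+ 4 + B1 + 1.
    apply: (@le_trans _ _ (B0 *+ 2 *+ 2)); last by rewrite -mulrnA -addrA lerDl addr_ge0.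
    rewrite -lecR -ncE hj; apply: norm_ReIm.
      by case: (tau_re j (x b)) => ->; apply: rb; rewrite ?starS.
    case: (tau_im j (x b)) => ->; rewrite ?normrN ?normr0 //; apply: rb; by rewrite ?starS.
  by split; apply: bd.
- rewrite -psiE; apply: (@le_trans _ _ (B0 *+ 4)); last by rewrite -addrA lerDl addr_ge0.
  have q0 : (0 < H.+1 ^ 2 - 2)%N by move: H0; clear; nia.
  have qb : H%:R * H%:R <= (H.+1 ^ 2 - 2)%:R :> R.
    by rewrite -natrM ler_nat; move: H0; clear; nia.
  have bnd b : `|\sum_d l (inr b) d * (c d)%:~R| <= B0 *+ 2 / H%:R.
    apply: le_trans (hc (inr b) q0) _.
    rewrite ler_pdivrMr ?ltr0n // mulrAC ler_pdivlMr // -mulrnAl -mulrA.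
    apply: (@le_trans _ _ ((1 + \sum_d `|l (inr b) d|) *+ 2 * (H.+1 ^ 2 - 2)%:R)).
      by apply: ler_wpM2l; [exact: mulrn_wge0 | exact: qb].
    by rewrite ler_wpM2r // lerMn2r B0k.
  have : nc (\sum_d (c d)%:~R * (c0 d.1 * tau1 (theta ^+ d.2))) <= B0 *+ 2 / H%:R *+ 2.
    rewrite -lecR -ncE; apply: norm_ReIm; rewrite ?Re_sum ?Im_sum.
      by under eq_bigr => d _ do rewrite ReMz; exact: (bnd true).
    by under eq_bigr => d _ do rewrite ImMz; exact: (bnd false).
  by rewrite -mulrnAl -mulrnA ler_pdivlMr.
apply: (@le_trans _ _ (B1 * H%:R)); last first.
  by apply: ler_wpM2r; [exact: ltW | rewrite addrAC lerDr addr_ge0 // mulrn_wge0].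
have cb d : nc (c d)%:~R <= H%:R.
  by rewrite nc_int -intr_norm -[leRHS]/((H%:Z)%:~R) ler_int.
have xb b : nc (tau1 (x b)) <= (\sum_(i < n) nc (tau1 (theta ^+ i))) * H%:R.
  rewrite order_emb_coords; apply: le_trans (nc_sum _) _; rewrite mulr_suml.
  apply: ler_sum => i _; rewrite ncM mulrC rmorphXn; apply: ler_wpM2l; [exact: nc_ge0|exact: cb].
apply: le_trans (ncD _ _) _; rewrite ncM.
have -> : B1 = (\sum_(i < n) nc (tau1 (theta ^+ i))) *+ 2 * (1 + nc s).
  rewrite /B1 big_pair big_bool /=.
  by rewrite -mulr_sumr -mulr2n mulrC mulrnAl.
have := xb false; have := xb true; have : 0 <= \sum_(i < n) nc (tau1 (theta ^+ i)).
  by apply: sumr_ge0 => i _; exact: nc_ge0.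
have := nc_ge0 (tau1 (x true)); have := nc_ge0 s; have := nc_ge0 (tau1 (x false)).
move: (nc (tau1 (x true))) (nc (tau1 (x false))) (nc s) HR.
set S1 := \sum_(i < n) _; clearbody S1; move: H%:R; clear => *; nra.
Qed.
End Box.

Section UnitsArgument.
Variables (R : realType) (K : fieldExtType rat) (A : falgType K) (a b : K).
Variables (f : {lrmorphism A -> quat a b}) (sigma : {rmorphism K -> R[i]}).
Variable (phi : {rmorphism A -> 'M[R[i]]_2}).
Hypotheses (bf : bijective f) (a0 : a != 0) (b0 : b != 0).
Hypothesis (ext : extends_embedding sigma phi).
Variable O : set A.
Hypotheses (hO : Z_order O) (disc : discrete_set (phi @` norm1_units 2 O)%classic).
Hypothesis aniso : forall x : quat a b, qnorm x = 0 -> x = 0.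
Variables (theta : K) (F : {poly int}).
Hypothesis gen : integral_generator theta F.
Local Notation C := R[i].
Local Notation n := (\dim {:K}).

Lemma emb_bound (x : K) : exists2 B : R, 0 < B & forall t : {rmorphism K -> C}, nc (t x) <= B.
Proof.
have [tau [_ all_tau]] := generator_embeddings gen C.
have h0 j : 0 <= nc (tau j x) by exact: nc_ge0.
exists (1 + \sum_j nc (tau j x)); first by rewrite ltr_pwDl // sumr_ge0.
move=> t; have [j ->] := all_tau t; apply: ler_wpDl => //.
by rewrite (bigD1 j) //= lerDl sumr_ge0.
Qed.

Lemma order_norm_lower (B : R) y : 1 <= B -> in_order theta y -> y != 0 ->
  (forall t : {rmorphism K -> C}, nc (t y) <= B) ->
  forall t : {rmorphism K -> C}, 1 <= nc (t y) * B ^+ n.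
Proof.
move=> B1 oy y0 hB t; rewrite leNgt; apply: contra_neqN y0 => lt.
apply: (@in_order_small_eq0 R K theta F gen t B%:C%C (nc (t y))%:C%C) => //.
- by rewrite -(rmorph1 (real_complex R)) lecR.
- by rewrite -rmorphXn -rmorphM /= -(rmorph1 (real_complex R)) ltcR.
by move=> t'; rewrite ncE lecR.
Qed.

(** The norm of y has absolute value at most B^n and so divides the factorial: a single integer,
    depending only on B and n, is a multiple of all such y. *)
Lemma order_norm_dvd (B : R) y : in_order theta y -> y != 0 ->
  (forall t : {rmorphism K -> C}, nc (t y) <= B) ->
  exists2 z, in_order theta z & y * z = ((Num.truncn (B ^+ n))`!)%:R.
Proof.
move=> oy y0 hB; have [tau [inj_tau _]] := generator_embeddings gen C.
have [N [hN hz]] := in_order_norm gen inj_tau oy.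
have NB : `|N%:~R : R| <= B ^+ n.
  rewrite -nc_int hN.
  have -> : nc (\prod_j tau j y) = \prod_j nc (tau j y).
    by apply: (big_morph _ (@ncM R)); rewrite (nc_nat R 1).
  rewrite -[n in leRHS]card_ord -prodr_const; apply: ler_prod => j _.
  by rewrite nc_ge0 hB.
have N0 : N != 0.
  apply: contraNneq y0 => e; move/eqP: hN; rewrite e eq_sym => /prodf_eq0 [j _].
  by rewrite fmorph_eq0.
have /dvdnP [k hk] : (absz N %| (Num.truncn (B ^+ n))`!)%N.
  apply: dvdn_fact; rewrite absz_gt0 N0 /= truncn_ge_nat; last exact: le_trans NB.
  by apply: le_trans NB; rewrite -intr_norm -abszE.
have [z oz ez] := hz ((sgz N)%:~R * k%:R) (in_orderM (in_order_int _ _) (in_order_int _ k%:Z)).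
exists z => //; rewrite ez hk natrM mulrA mulrC -rmorphM /=; congr (_ * _).
by rewrite mulrC -[RHS]/((absz N)%:Z%:~R) abszE; congr (_%:~R); rewrite [RHS]numEsg sgz_def mulrC;
  move: (N); clear; case=> m //=; lia.
Qed.

Variables (al : K) (I : A).
Hypotheses (oal : in_order theta al) (al0 : al != 0).
Hypothesis hII : I * I = al%:A.
Hypothesis qnI : forall p q : K, qnorm (f (p%:A + q *: I)) = p ^+ 2 - al * q ^+ 2.

Let e (p q : K) : A := p%:A + q *: I.

Lemma quad_mul p q p' q' : e p q * e p' q' = e (p * p' + al * (q * q')) (p * q' + q * p').
Proof.
rewrite /e mulrDl !mulrDr !mulr_algl -!scalerAl -!scalerAr !scalerA hII !scalerA.
rewrite mulr1 !scalerDl -!addrA; congr (_ + _); rewrite addrC -!addrA [(al * _)]mulrC.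
by rewrite addrCA; congr (_ + _); exact: addrC.
Qed.

Lemma quad_norm_eq0 p q : p ^+ 2 - al * q ^+ 2 = 0 -> p = 0 /\ q = 0.
Proof.
move=> h; have e0 : f (e p q) = 0 by apply: aniso; rewrite qnI.
have ee0 : e p q = 0 by apply: (bij_inj bf); rewrite rmorph0.
have q0 : q = 0.
  apply/eqP; apply: contraT => q0.
  have eI : I = (- (q^-1 * p))%:A.
    apply: (scalerI q0); rewrite scalerA mulrN mulVKf // scaleNr.
    by apply/eqP; rewrite -subr_eq0 opprK addrC; apply/eqP.
  have : al = (q^-1 * p) ^+ 2.
    have := hII; rewrite eI mulr_algl scalerA mulrNN -expr2 => /eqP.
    by rewrite -subr_eq0 -scalerBl scaler_eq0 oner_eq0 orbF subr_eq0 => /eqP.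
  move=> hal; have := qnI (q^-1 * p) 1; rewrite scale1r eI scaleNr subrr rmorph0.
  have := qnI (q^-1 * p) (-1); rewrite scaleN1r eI scaleNr opprK -scalerDl.
  rewrite linearZ rmorph1 qnorm_alg -hal sqrrN expr1n mulr1 subrr => h2 _.
  have /eqP : 4 * (q^-1 * p) ^+ 2 = 0 by rewrite -[RHS]h2; ring.
  by rewrite -hal mulf_eq0 nf_nat_eq0 (negPf al0).
split=> //; move: h; rewrite q0 expr0n mulr0 subr0 => /eqP.
by rewrite sqrf_eq0 => /eqP.
Qed.

Lemma quad_phi_inj p q : phi (e p q) = 0 -> p = 0 /\ q = 0.
Proof.
move=> h; apply: quad_norm_eq0; rewrite -qnI; apply: (fmorph_inj sigma).
rewrite -(phi_det bf _ a0 b0 ext) ?pnatr_eq0 // -/(e p q) h rmorph0 det_mx2 !mxE.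
by rewrite !mul0r subrr.
Qed.

Section Pair.
Variables (N0 M1 : nat).
Hypotheses (N0O : forall k, in_order theta k -> O ((N0%:R * k) *: 1) /\ O ((N0%:R * k) *: I)).

Let nu (x : K * K) := x.1 ^+ 2 - al * x.2 ^+ 2.
Let P (x y : K * K) := x.1 * y.1 - al * (x.2 * y.2).
Let Q (x y : K * K) := x.2 * y.1 - x.1 * y.2.

(** P + Q I is x times the conjugate of y, so this element is x / y for sg = 1 and its conjugate for
    sg = -1. As nu y divides M1 and x = y modulo M1 N0, it lies in 1 + N0 (Z[theta] + Z[theta]
    I). *)
Lemma congruent_ratio_in_order (x y z : K * K) t (sg : K) : (sg == 1) || (sg == -1) ->
  in_order theta y.1 -> in_order theta y.2 ->
  in_order theta z.1 -> in_order theta z.2 -> in_order theta t ->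
  x.1 - y.1 = (M1 * N0)%:R * z.1 -> x.2 - y.2 = (M1 * N0)%:R * z.2 ->
  nu y != 0 -> nu y * t = M1%:R -> O (e (P x y / nu y) (sg * Q x y / nu y)).
Proof.
move=> hs oy1 oy2 oz1 oz2 ot h1 h2 ny hM.
pose p := t * (z.1 * y.1 - al * (z.2 * y.2)); pose q := sg * (t * (z.2 * y.1 - z.1 * y.2)).
have op : in_order theta p.
  by apply: in_orderM => //; apply: in_orderB; [exact: in_orderM | apply: in_orderM => //; exact: in_orderM].
have oq : in_order theta q.
  apply: in_orderM; first by case/orP: hs => /eqP ->; [exact: (in_order_int _ 1) | exact: (in_order_int _ (-1))].
  by apply: in_orderM => //; apply: in_orderB; exact: in_orderM.
have x1 : x.1 = y.1 + (nu y * t * N0%:R) * z.1 by rewrite hM -natrM -h1 addrC subrK.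
have x2 : x.2 = y.2 + (nu y * t * N0%:R) * z.2 by rewrite hM -natrM -h2 addrC subrK.
have -> : P x y / nu y = 1 + N0%:R * p.
  by rewrite /P x1 x2 /p; move: ny; rewrite /nu => ny; field.
have -> : sg * Q x y / nu y = N0%:R * q.
  by rewrite /Q x1 x2 /q; move: ny; rewrite /nu => ny; field.
rewrite /e scalerDl scale1r; apply: (Z_orderD hO); last by case: (N0O oq).
by apply: (Z_orderD hO); [exact: Z_order1 | case: (N0O op)].
Qed.

(** For u = x / y the four elements u, conj(u) and their inverses lie in O, so w = u / conj(u) is a
    norm one unit with inverse w'. Closeness at sigma and discreteness give w = 1, hence u lies in
    K. *)
Lemma close_pair_ratio (x y : K * K) (eps : R) :
  (forall w, norm1_units 2 O w -> near_one eps%:C%C (phi w) -> phi w = 1) ->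
  (forall s : K, (s == 1) || (s == -1) -> O (e (P x y / nu y) (s * Q x y / nu y)) /\
     O (e (P x y / nu x) (s * Q x y / nu x))) ->
  nu x != 0 -> nu y != 0 ->
  (forall i j, nc (sigma (al * (2 * Q x y ^+ 2) / (nu x * nu y))) +
     nc (sigma (2 * (P x y * Q x y) / (nu x * nu y))) * nc (phi I i j) < eps) ->
  Q x y = 0.
Proof.
move=> he hOO nx ny small.
set D := nu x * nu y; have D0 : D != 0 by rewrite mulf_neq0.
have PQ : P x y ^+ 2 - al * Q x y ^+ 2 = D by rewrite /P /Q /D /nu; ring.
pose w := e (P x y / nu y) (Q x y / nu y) * e (P x y / nu x) (Q x y / nu x).
pose w' := e (P x y / nu y) (- Q x y / nu y) * e (P x y / nu x) (- Q x y / nu x).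
have e10 : e 1 0 = 1 by rewrite /e scale1r scale0r addr0.
have wE : w = e (1 + al * (2 * Q x y ^+ 2) / D) (2 * (P x y * Q x y) / D).
  rewrite /w quad_mul; congr e; last by rewrite /D; field; rewrite nx ny.
  transitivity ((P x y ^+ 2 + al * Q x y ^+ 2) / D); first by rewrite /D; field; rewrite nx ny.
  rewrite (_ : P x y ^+ 2 + al * Q x y ^+ 2 = D + al * (2 * Q x y ^+ 2)); last by rewrite -PQ; ring.
  by rewrite mulrDl divff.
have w'E : w' = e (1 + al * (2 * Q x y ^+ 2) / D) (- (2 * (P x y * Q x y) / D)).
  rewrite /w' quad_mul; congr e; last by rewrite /D; field; rewrite nx ny.
  transitivity ((P x y ^+ 2 + al * Q x y ^+ 2) / D); first by rewrite /D; field; rewrite nx ny.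
  rewrite (_ : P x y ^+ 2 + al * Q x y ^+ 2 = D + al * (2 * Q x y ^+ 2)); last by rewrite -PQ; ring.
  by rewrite mulrDl divff.
have ww' : w * w' = 1.
  rewrite wE w'E quad_mul -e10; congr e; last by ring.
  transitivity (((D + al * (2 * Q x y ^+ 2)) ^+ 2 - al * (2 * (P x y * Q x y)) ^+ 2) / D ^+ 2).
    by field.
  rewrite (_ : _ - _ = D ^+ 2) ?divff ?expf_neq0 //.
  by rewrite -PQ; ring.
have w'w : w' * w = 1.
  by rewrite -ww' wE w'E !quad_mul; congr e; ring.

have uw : w \is a GRing.unit by apply/unitrP; exists w'.
have wV : w^-1 = w' by apply: (mulrI uw); rewrite divrr.
have hw : norm1_units 2 O w.
  have [|o1 o2] := hOO 1; first by rewrite eqxx.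
  have [|o3 o4] := hOO (-1); first by rewrite eqxx orbT.
  apply/(norm1_unitsP bf a0 b0 ext); split.
  - by move: o1 o2; rewrite !mul1r => o1 o2; exact: (Z_orderM hO).
  - rewrite rmorphM qnormM !qnI.
    transitivity (((P x y ^+ 2 - al * Q x y ^+ 2) / D) ^+ 2); last by rewrite PQ divff ?expr1n.
    by rewrite /D; field; rewrite nx ny.
  by rewrite wV; move: o3 o4; rewrite !mulN1r => o3 o4; exact: (Z_orderM hO).
have pw : phi w - 1 = phi (e (al * (2 * Q x y ^+ 2) / D) (2 * (P x y * Q x y) / D)).
  rewrite wE -(rmorph1 phi) -rmorphB; congr (phi _).
  by rewrite /e scalerDl scale1r [1 + _]addrC addrAC addrK.
have : phi w = 1.
  apply: he; first exact: hw.
  move=> i j.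
  have -> : (phi w) i j - (1 : 'M[C]_2) i j = (phi w - 1) i j by rewrite !mxE.
  rewrite pw ncE ltcR rmorphD !(phi_scale ext) rmorph1 !mxE.
  apply: le_lt_trans (ncD _ _) _; rewrite !ncM.
  apply: le_lt_trans (small i j); apply: lerD => //.
  rewrite -[leRHS]mulr1 -/D; apply: ler_wpM2l; first exact: nc_ge0.
  by rewrite nc_nat; case: eqP.
move=> h1; have : phi (e (al * (2 * Q x y ^+ 2) / D) (2 * (P x y * Q x y) / D)) = 0.
  by rewrite -pw h1 subrr.
case/quad_phi_inj => /eqP; rewrite !mulf_eq0 invr_eq0 (negPf D0) (negPf al0) orbF /=.
by rewrite nf_nat_eq0 /= orbb => /eqP.
Qed.
End Pair.

(** At a further complex place tau, [unbalanced_box] provides infinitely many x in K(I), bounded at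
    the other places of K and with strictly decreasing ratio rho of their two absolute values above
    tau. Two of them are congruent modulo M1 N0 and close at sigma; then x / y lies in K and rho x =
    rho y, a contradiction. *)
Lemma nonreal_unique (tau : {rmorphism K -> C}) : nonreal_embedding tau ->
  ~ (sigma =1 tau) -> ~ (forall x, sigma x = (tau x)^*%C) -> False.
Proof.
move=> nr ns1 ns2.
pose s := sqrtC (tau al); have hs : s ^+ 2 = tau al by rewrite sqrtCK.
have [B B0 box] := unbalanced_box gen nr s.
have [Bal Bal0 hBal] := emb_bound al.
pose nu (x : K * K) := x.1 ^+ 2 - al * x.2 ^+ 2.
pose pm (x : K * K) := tau x.1 - s * tau x.2; pose pp (x : K * K) := tau x.1 + s * tau x.2.
have tau_nu x : tau (nu x) = pm x * pp x.
  by rewrite /nu rmorphB rmorphXn rmorphM rmorphXn -hs /pm /pp; ring.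
(* C2 bounds all conjugates of nu x, and E = C2^n turns this into the lower bound 1 / E, because the
   norm of nu x is a nonzero integer. *)
pose C2 := 1 + B ^+ 2 * (1 + Bal).
have C21 : 1 <= C2 by rewrite lerDl mulr_ge0 ?addr_ge0 ?sqr_ge0 // ltW.
pose E := C2 ^+ n; have E1 : 1 <= E by rewrite exprn_ege1.
pose good (x : K * K) := [/\ in_order theta x.1, in_order theta x.2, nu x != 0,
  nc (sigma x.1) <= B /\ nc (sigma x.2) <= B &
  forall t : {rmorphism K -> C}, nc (t (nu x)) <= C2].
have onu x : in_order theta x.1 -> in_order theta x.2 -> in_order theta (nu x).
  move=> o1 o2; rewrite /nu !expr2; apply: in_orderB; first exact: in_orderM.
  by apply: in_orderM => //; exact: in_orderM.
have low x : good x -> forall t : {rmorphism K -> C}, 1 <= nc (t (nu x)) * E.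
  by move=> [o1 o2 n0 _ h]; apply: order_norm_lower => //; exact: onu.
pose rho x := nc (pm x) / nc (pp x).
have pos x : good x -> 0 < nc (pm x) /\ 0 < nc (pp x).
  move=> [_ _ n0 _ _]; have : tau (nu x) != 0 by rewrite fmorph_eq0.
  by rewrite tau_nu mulf_eq0 negb_or => /andP[h1 h2]; rewrite !nc_gt0.
have small (eta : R) : 0 < eta -> exists x, good x /\ rho x < eta.
  move=> eta0; pose H := (Num.truncn (B ^+ 2 * E / eta)).+1.
  have [x0 [x1 [o0 o1 nz [hb hm hp]]]] := box H isT.
  have H1 : 1 <= H%:R :> R by rewrite ler1n.
  have HR : 0 < H%:R :> R by rewrite ltr0n.
  have n0 : nu (x0, x1) != 0.
    by apply: contraTneq nz => /quad_norm_eq0 [/= -> ->]; rewrite eqxx.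
  have hmp : nc (pm (x0, x1)) * nc (pp (x0, x1)) <= B ^+ 2.
    rewrite /pm /pp /=; move: hm hp; set u := nc _; set v := nc _ => hm hp.
    rewrite -(ler_pM2r HR) mulrAC expr2 -[leRHS]mulrA; apply: ler_pM => //; last exact: nc_ge0.
    by rewrite mulr_ge0 ?nc_ge0 // ltW.
  have g : good (x0, x1).
    split=> //=.
      by case: (hb sigma).
    have Bp : 0 <= B ^+ 2 by rewrite sqr_ge0.
    have BB : B ^+ 2 <= C2.
      by rewrite /C2 mulrDr mulr1 addrCA lerDl addr_ge0 // mulr_ge0 // ltW.
    move=> t; case: (hb t) => [->|->|[h0 h1]].
    - by rewrite tau_nu ncM; exact: le_trans hmp BB.
    - by rewrite nc_conj tau_nu ncM; exact: le_trans hmp BB.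
    rewrite /nu /= rmorphB rmorphXn rmorphM rmorphXn; apply: le_trans (ncB _ _) _.
    rewrite ncX ncM ncX /C2 mulrDr mulr1 addrCA -[leLHS]addr0 [X in _ <= _ + X]addrC addrA.
    have q0 : nc (t x0) ^+ 2 <= B ^+ 2 by rewrite ler_sqr ?nnegrE ?nc_ge0 // ltW.
    have q1 : nc (t x1) ^+ 2 <= B ^+ 2 by rewrite ler_sqr ?nnegrE ?nc_ge0 // ltW.
    apply: lerD; last exact: ler01.
    apply: lerD => //; rewrite mulrC; apply: ler_pM => //; rewrite ?sqr_ge0 ?nc_ge0 //.
  exists (x0, x1); split=> //; have [p1 p2] := pos _ g.
  have hE := low _ g tau; rewrite tau_nu ncM in hE.
  rewrite /rho; apply: (@le_lt_trans _ _ (B ^+ 2 * E / H%:R)); last first.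
    rewrite ltr_pdivrMr // [eta * _]mulrC -ltr_pdivrMr //.
    by have /andP[_] := truncn_itv (divr_ge0 (mulr_ge0 (sqr_ge0 B) (le_trans ler01 E1)) (ltW eta0)).
  rewrite ler_pdivrMr //; move: hm; rewrite -/(pm (x0, x1)) => hm.
  rewrite mulrAC ler_pdivlMr //.
  have : nc (pm (x0, x1)) * H%:R * 1 <= B * (nc (pm (x0, x1)) * nc (pp (x0, x1)) * E).
    by apply: ler_pM => //; rewrite mulr_ge0 ?nc_ge0 // ltW.
  have : nc (pm (x0, x1)) <= B.
    by apply: le_trans hm; rewrite -[leLHS]mulr1 ler_wpM2l ?nc_ge0.
  move: (nc (pm (x0, x1))) (nc (pp (x0, x1))) p1 p2 => u v p1 p2 uB h.
  rewrite mulr1 in h; apply: le_trans h _.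
  have vE : 0 <= v * E by rewrite mulr_ge0 ?ltW // (lt_le_trans ltr01).
  have : B * (u * (v * E)) <= B * (B * (v * E)) by rewrite !ler_wpM2l ?ler_wpM2r // ltW.
  have -> : B * (u * v * E) = B * (u * (v * E)) by ring.
  by have -> : B ^+ 2 * E * v = B * (B * (v * E)) by ring.
have [x0 [g0 _]] := small 1 ltr01.
have nxt x : exists y, good x -> good y /\ rho y < rho x.
  have [g|ng] := boolp.EM (good x); last by exists x => /ng.
  have [p1 p2] := pos _ g.
  by have [|y hy] := small (rho x); [exact: divr_gt0 | exists y].
have [next hnext] := boolp.choice nxt.
pose sq k := iter k next x0.
have gs k : good (sq k).
  by elim: k => [|k IH] //=; case: (hnext _ IH).
have dec k l : (k < l)%N -> rho (sq l) < rho (sq k).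
  elim: l => // l IH; rewrite ltnS leq_eqVlt => /orP [/eqP ->|/IH h].
    by case: (hnext _ (gs l)).
  by apply: lt_trans h; case: (hnext _ (gs l)).
have [NA NA0 hNA] := Z_order_scale gen hO 1.
have [NI NI0 hNI] := Z_order_scale gen hO I.
pose N0 := (NA * NI)%N; pose M1 := (Num.truncn E)`!.
have N0O k : in_order theta k -> O ((N0%:R * k) *: 1) /\ O ((N0%:R * k) *: I).
  move=> ok; rewrite /N0 natrM; split.
    by rewrite -mulrA; apply: hNA; apply: in_orderM => //; exact: (in_order_int _ NI%:Z).
  by rewrite [_%:R * _]mulrC -mulrA; apply: hNI; apply: in_orderM => //; exact: (in_order_int _ NA%:Z).
have [ec ec0 hec] := discrete_near_one bf a0 b0 ext hO disc.
have [eps eeps] := complex_realP _ (gtr0_real ec0).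
have eps0 : 0 < eps by rewrite -ltcR -eeps.
pose BI := \sum_i \sum_j nc (phi I i j).
have BI0 : 0 <= BI by do 2![apply: sumr_ge0 => ? _]; exact: nc_ge0.
have hBI i j : nc (phi I i j) <= BI.
  rewrite /BI (bigD1 i) //= (bigD1 j) //= -addrA lerDl addr_ge0 //.
    by apply: sumr_ge0 => ? _; exact: nc_ge0.
  by do 2![apply: sumr_ge0 => ? _]; exact: nc_ge0.
pose ca := nc (sigma al); have ca0 : 0 <= ca by exact: nc_ge0.
(* The quantities tested by [close_pair_ratio] are at most d C5 when the coordinates of x and y
   differ by less than d <= 1 at sigma. *)
pose C5 := 8 * (ca * B ^+ 2 * E ^+ 2) + 4 * (B ^+ 3 * (1 + ca) * E ^+ 2) * BI.
have E0 : 0 <= E by exact: le_trans ler01 E1.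
have C50 : 0 <= C5.
  have B3 : 0 <= B ^+ 3 by rewrite exprn_ge0 // ltW.
  have q1 : 0 <= ca * B ^+ 2 * E ^+ 2 by rewrite mulr_ge0 ?sqr_ge0 // mulr_ge0 ?sqr_ge0.
  have q2 : 0 <= B ^+ 3 * (1 + ca) * E ^+ 2.
    by rewrite mulr_ge0 ?sqr_ge0 // mulr_ge0 // addr_ge0.
  by apply: addr_ge0; [exact: mulr_ge0 | apply: mulr_ge0 => //; exact: mulr_ge0].
pose d := eps / (C5 + eps).
have den0 : 0 < C5 + eps by rewrite ltr_wpDl.
have d0 : 0 < d by rewrite divr_gt0.
have d1 : d <= 1 by rewrite ler_pdivrMr // mul1r lerDr.
have dC5 : d * C5 < eps.
  by rewrite mulrAC ltr_pdivrMr // ltr_pM2l // ltrDl.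
have MN0 : (0 < M1 * N0)%N by rewrite !muln_gt0 fact_gt0 NA0 NI0.
have [T [r hr]] := order_residues gen MN0.
have [Tc [rc hrc]] := bounded_cells B0 d0.
pose bucket (k : 'I_(#|{: T * T * (Tc * Tc)}|.+1)) : T * T * (Tc * Tc) :=
  (r (sq k).1, r (sq k).2, (rc (sigma (sq k).1), rc (sigma (sq k).2))).
have [|k [l [kl [e1 e2 e3 e4]]]] := @finite_collision _ _ bucket; first by rewrite card_ord.
have [ox1 ox2 nx [bx1 bx2] hx] := gs k; have [oy1 oy2 ny [by1 by2] hy] := gs l.
set x := sq k in e1 e2 e3 e4 ox1 ox2 nx bx1 bx2 hx; set y := sq l in e1 e2 e3 e4 oy1 oy2 ny by1 by2 hy.
have [z1 oz1 ez1] := hr _ _ ox1 oy1 e1; have [z2 oz2 ez2] := hr _ _ ox2 oy2 e2.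
have cl1 := hrc _ _ bx1 by1 e3; have cl2 := hrc _ _ bx2 by2 e4.
have [ty oty hty] := order_norm_dvd (onu _ oy1 oy2) ny hy.
have [tx otx htx] := order_norm_dvd (onu _ ox1 ox2) nx hx.
have Q0 : x.2 * y.1 - x.1 * y.2 = 0.
  apply: (@close_pair_ratio x y eps) => //.
  - by move=> w; rewrite -eeps; exact: hec.
  - move=> sg hsg; split.
      exact: (@congruent_ratio_in_order N0 M1 N0O x y (z1, z2) ty).
    have hsg' : (- sg == 1) || (- sg == -1) by rewrite eqr_opp eqr_oppLR orbC.
    have := @congruent_ratio_in_order N0 M1 N0O y x (- z1, - z2) tx (- sg) hsg' ox1 ox2
      (in_orderN oz1) (in_orderN oz2) otx.
    rewrite /= !mulrN -ez1 -ez2 !opprB => /(_ erefl erefl nx htx).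
    congr (O (e _ _)); congr (_ / _); ring.
  move=> i j.
  set q := x.2 * y.1 - x.1 * y.2; set p := x.1 * y.1 - al * (x.2 * y.2).
  have hq : nc (sigma q) <= 2 * B * d.
    rewrite (_ : q = (x.2 - y.2) * y.1 - (x.1 - y.1) * y.2); last by rewrite /q; ring.
    rewrite rmorphB !rmorphM !rmorphB; apply: le_trans (ncB _ _) _; rewrite !ncM.
    have h1 := ler_pM (nc_ge0 _) (nc_ge0 _) (ltW cl2) by1.
    have h2 := ler_pM (nc_ge0 _) (nc_ge0 _) (ltW cl1) by2.
    apply: le_trans (lerD h1 h2) _; rewrite -mulrA mulr_natl mulr2n.
    by rewrite mulrC.
  have hp : nc (sigma p) <= B ^+ 2 * (1 + ca).
    rewrite /p rmorphB !rmorphM; apply: le_trans (ncB _ _) _; rewrite !ncM.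
    rewrite mulrDr mulr1 expr2; apply: lerD; first by apply: ler_pM => //; exact: nc_ge0.
    rewrite mulrC; apply: ler_wpM2r => //; by apply: ler_pM => //; exact: nc_ge0.
  have hD : (nc (sigma (nu x * nu y)))^-1 <= E ^+ 2.
    rewrite rmorphM ncM invfM expr2; apply: ler_pM; rewrite ?invr_ge0 ?nc_ge0 //.
      by rewrite -div1r ler_pdivrMr ?nc_gt0 ?fmorph_eq0 // mulrC; exact: low (gs k) sigma.
    by rewrite -div1r ler_pdivrMr ?nc_gt0 ?fmorph_eq0 // mulrC; exact: low (gs l) sigma.
  have cN2 : nc (sigma 2) = 2 by rewrite rmorph_nat nc_nat.
  have Bd : 0 <= 2 * B * d by apply: mulr_ge0; [apply: mulr_ge0 => //; exact: ltW | exact: ltW].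
  have iD0 : 0 <= (nc (sigma (nu x * nu y)))^-1 by rewrite invr_ge0 nc_ge0.
  move: hD iD0; rewrite -/(nu x) -/(nu y); move: (nu x * nu y) => D hD iD0.
  clearbody p q.
  apply: le_lt_trans dC5; rewrite /C5 [leRHS]mulrDr.
  apply: lerD.
    rewrite expr2 !rmorphM fmorphV !ncM ncV cN2 -/ca -expr2.
    have h : ca * (2 * nc (sigma q) ^+ 2) <= ca * (2 * (2 * B * d) ^+ 2).
      by rewrite !ler_wpM2l // ler_sqr ?nnegrE ?nc_ge0.
    apply: le_trans (ler_pM _ iD0 h hD) _.
      by apply: mulr_ge0 => //; apply: mulr_ge0 => //; exact: sqr_ge0.
    have : d * (8 * (ca * B ^+ 2 * E ^+ 2)) * d <= d * (8 * (ca * B ^+ 2 * E ^+ 2)) * 1.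
      apply: ler_wpM2l => //; apply: mulr_ge0; first exact: ltW.
      by apply: mulr_ge0 => //; apply: mulr_ge0; rewrite ?sqr_ge0 // mulr_ge0 ?sqr_ge0.
    by rewrite mulr1; apply: le_trans; rewrite le_eqVlt; apply/orP; left; apply/eqP; ring.
  rewrite !rmorphM fmorphV !ncM ncV cN2.
  have h : 2 * (nc (sigma p) * nc (sigma q)) <= 2 * (B ^+ 2 * (1 + ca) * (2 * B * d)).
    by rewrite ler_wpM2l // ler_pM ?nc_ge0.
  apply: le_trans (ler_pM _ (nc_ge0 _) (ler_pM _ iD0 h hD) (hBI i j)) _.
  - by rewrite !mulr_ge0 ?nc_ge0.
  - by rewrite !mulr_ge0 ?nc_ge0.
  by rewrite le_eqVlt; apply/orP; left; apply/eqP; ring.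
have rr : rho x = rho y.
  have [px1 px2] := pos _ (gs k); have [py1 py2] := pos _ (gs l).
  have eq : pm x * pp y = pm y * pp x.
    apply/eqP; rewrite -subr_eq0 (_ : _ - _ = - (2 * s) * tau (x.2 * y.1 - x.1 * y.2)).
      by rewrite Q0 rmorph0 mulr0.
    by rewrite /pm /pp rmorphB !rmorphM; ring.
  have nx0 : nc (pp x) != 0 by exact: lt0r_neq0.
  have ny0 : nc (pp y) != 0 by exact: lt0r_neq0.
  by rewrite /rho; apply/eqP; rewrite eqr_div // -!ncM eq.
have [lt|lt|/val_inj kl'] := ltngtP k l.
- by have := dec _ _ lt; rewrite -/x -/y rr ltxx.
- by have := dec _ _ lt; rewrite -/x -/y rr ltxx.
by rewrite kl' eqxx in kl.
Qed.
End UnitsArgument.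

(** * Complex places of the centre *)

Section ComplexPairs.
Variables (R : realType) (K : fieldExtType rat).
Local Notation C := R[i].

Lemma division_at_most_one_pair (A : falgType K) (a b : K) (f : {lrmorphism A -> quat a b})
    (sigma : {rmorphism K -> C}) (phi : {rmorphism A -> 'M[C]_2}) (O : set A) :
  bijective f -> a != 0 -> b != 0 -> extends_embedding sigma phi -> Z_order O ->
  discrete_set (phi @` norm1_units 2 O)%classic ->
  (forall x : quat a b, qnorm x = 0 -> x = 0) -> at_most_one_complex_pair R K.
Proof.
move=> bf a0 b0 ext hO disc aniso.
have [theta [F gen]] := integral_generator_exists K.
have [M m0 oa] := in_order_scale gen a.
have M0 : M%:~R != 0 :> K by rewrite nf_int_eq0.
have [g fK gK] := bf.
pose al : K := M%:~R * (M%:~R * a); pose I := g (M%:~R *: qi a b).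
have oal : in_order theta al by apply: in_orderM => //; exact: in_order_int.
have al0 : al != 0 by rewrite !mulf_neq0.
have hII : I * I = al%:A.
  apply: (can_inj fK); rewrite rmorphM linearZ /= rmorph1 /I gK.
  by rewrite -scalerAl -scalerAr qi_sqr !scalerA -!mulrA.
have fZ c u : f (c *: u) = c *: f u by exact: linearZ.
have qnI p q : qnorm (f (p%:A + q *: I)) = p ^+ 2 - al * q ^+ 2.
  have -> : f (p%:A + q *: I) = p%:A + q *: (M%:~R *: qi a b).
    have fD u v : f (u + v) = f u + f v by exact: rmorphD.
    by rewrite fD !fZ rmorph1 /I gK.
  by rewrite /qnorm /al /=; ring.
have key (t : {rmorphism K -> C}) : nonreal_embedding t ->
    sigma =1 t \/ forall x, sigma x = (t x)^*%C.
  move=> nr; apply: boolp.contrapT => /boolp.not_orP [h1 h2].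
  exact: (nonreal_unique bf a0 b0 ext hO disc aniso gen oal al0 hII qnI nr h1 h2).
move=> s t hs ht; have [es|es] := key s hs; have [et|et] := key t ht.
- by left => x; rewrite -es et.
- by right => x; rewrite -es et.
- by right => x; rewrite -et es conjcK.
by left => x; apply: (can_inj (@conjcK R)); rewrite -es et.
Qed.

Lemma real_embedding_exists (t : {rmorphism K -> C}) : ~ nonreal_embedding t ->
  exists r : {rmorphism K -> R}, forall x, (r x)%:C%C = t x.
Proof.
move=> nr; pose h x := complex.Re (t x).
have hE x : (h x)%:C%C = t x.
  by apply: RRe_real; apply/negP => /negP hx; apply: nr; exists x.
have zm : zmod_morphism h.
  by move=> x y; apply: (@complexI R); rewrite rmorphB /= !hE rmorphB.
have mm : monoid_morphism h.
  by split=> [|x y]; apply: (@complexI R); rewrite ?rmorphM /= !hE ?rmorph1 // rmorphM.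
pose hZ := GRing.isZmodMorphism.Build _ _ _ zm.
pose hM := GRing.isMonoidMorphism.Build _ _ _ mm.
pose r : {rmorphism K -> R} := HB.pack h hZ hM.
by exists r.
Qed.

(** All embeddings are nonreal and hence form a single conjugate pair, so the degree is 2. *)
Lemma imaginary_of_no_real : at_most_one_complex_pair R K -> ~ has_real_embedding R K ->
  exists d : int, [/\ d < 0, squarefree d & is_quadratic_field K d].
Proof.
move=> amo nr; have [theta [F gen]] := integral_generator_exists K.
have [tau [inj_tau all_tau]] := generator_embeddings gen C.
have nrt (t : {rmorphism K -> C}) : nonreal_embedding t.
  by apply: boolp.contrapT => /real_embedding_exists [r _]; apply: nr; split.
have n0 : (0 < \dim {:K})%N := adim_gt0 (aspacef K).
pose j0 := Ordinal n0.
have [k hk] := all_tau (Num.conj \o tau j0).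
have le2 : (\dim {:K} <= 2)%N.
  rewrite -[X in (X <= _)%N]card_ord -cardsT; apply: (@leq_trans #|[set j0; k]|); last by rewrite cards2; case: (_ == _).
  apply: subset_leq_card; apply/fintype.subsetP => j _; rewrite !inE.
  have [e|e] := amo (tau j) (tau j0) (nrt _) (nrt _).
    by apply/orP; left; apply/eqP; apply: inj_tau; exact: e.
  apply/orP; right; apply/eqP; apply: inj_tau; rewrite /= e; exact: hk.
have n2 : \dim {:K} = 2%N.
  apply/eqP; rewrite eqn_leq le2 ltnNge; apply/negP => /rational_of_dim hK.
  have [x /negP] := nrt (tau j0); apply.
  have : x \in {:K}%VS by exact: memvf.
  rewrite hK => /vlineP [p ->]; rewrite emb_rat; apply/CrealP.
  exact: fmorph_rat.
have [d [sq hq]] := quadratic_of_dim n2; exists d; split=> //.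
exact: imaginary_negative sq hq (nrt (tau j0)).
Qed.
End ComplexPairs.

(** Turns the group into an abstract finite group, to which index and class counting apply. *)
Lemma finite_group_model (K : fieldType) (B : falgType K) (G : seq B) : finite_unit_subgroup G ->
  exists (gT : finGroupType) (v : gT -> B), [/\ injective v, v 1%g = 1,
    forall x y, v (x * y)%g = v x * v y & forall b, b \in G <-> exists x, v x = b].
Proof.
move=> [G1 GM GV]; pose T : finType := seq_sub G.
pose mk b (h : b \in G) : T := SeqSub h.
pose mul (x y : T) : T := mk _ (GM _ _ (ssvalP x) (ssvalP y)).
pose one : T := mk 1 G1.
pose inv (x : T) : T := mk _ (proj2 (GV _ (ssvalP x))).
have mulA : associative mul by move=> x y z; apply: val_inj; rewrite /= mulrA.
have mul1 : left_id one mul by move=> x; apply: val_inj; rewrite /= mul1r.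
have mulV : left_inverse one inv mul.
  by move=> x; apply: val_inj; rewrite /= mulVr //; case: (GV _ (ssvalP x)).
pose gM := Finite_isGroup.Build T mulA mul1 mulV.
pose gT : finGroupType := HB.pack T gM.
exists gT, (fun x => ssval (x : T)); split=> //.
  by move=> x y; exact: val_inj.
move=> b; split=> [h|[x <-]]; first by exists (mk b h).
exact: ssvalP.
Qed.

(** * Finite subgroups of quaternion division algebras *)

Section Centralizers.
Variables (K : fieldType) (a b : K).
Hypotheses (n2 : 2%:R != 0 :> K) (a0 : a != 0) (b0 : b != 0).
Local Notation Q := (quat a b).
Definition noncentral (x : Q) := forall c : K, x <> c%:A.

Lemma noncentralP (x : Q) : noncentral x \/ exists c, x = c%:A.
Proof.
have [h|h] := boolp.EM (exists c, x = c%:A); [by right|left=> c e].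
by apply: h; exists c.
Qed.

(** Commuting means that the vector parts have vanishing cross product, so that of u is a multiple
    of that of x. *)
Lemma quat_commute (x u : Q) : noncentral x -> u * x = x * u -> exists p q : K, u = p%:A + q *: x.
Proof.
case: x => x0 x1 x2 x3; case: u => u0 u1 u2 u3 nx [] _ e1 e2 e3.
have dbl (s t : K) : 2%:R * s = 2%:R * t -> s = t by move/(mulfI n2).
have c1 : u3 * x2 = u2 * x3.
  apply: dbl; apply: (mulfI b0); apply/eqP; rewrite -subr_eq0.
  by move/eqP: e1; rewrite -subr_eq0; congr (_ == _); ring.
have c2 : u1 * x3 = u3 * x1.
  apply: dbl; apply: (mulfI a0); apply/eqP; rewrite -subr_eq0.
  by move/eqP: e2; rewrite -subr_eq0; congr (_ == _); ring.
have c3 : u1 * x2 = u2 * x1.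
  apply: dbl; apply/eqP; rewrite -subr_eq0.
  by move/eqP: e3; rewrite -subr_eq0; congr (_ == _); ring.
have [z1|nz1] := eqVneq x1 0; last first.
  exists (u0 - u1 / x1 * x0), (u1 / x1); congr Quat => /=.
  - by field.
  - by field.
  - by apply: (mulIf nz1); rewrite -c3; field.
  by apply: (mulIf nz1); rewrite -c2; field.
have [z2|nz2] := eqVneq x2 0; last first.
  exists (u0 - u2 / x2 * x0), (u2 / x2); congr Quat => /=.
  - by field.
  - by apply: (mulIf nz2); rewrite c3 z1; field.
  - by field.
  by apply: (mulIf nz2); rewrite c1; field.
have [z3|nz3] := eqVneq x3 0; last first.
  exists (u0 - u3 / x3 * x0), (u3 / x3); congr Quat => /=.
  - by field.
  - by apply: (mulIf nz3); rewrite c2 z1; field.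
  - by apply: (mulIf nz3); rewrite -c1 z2; field.
  by field.
by case: (nx x0); rewrite z1 z2 z3; congr Quat => /=; ring.
Qed.

Lemma quat_commute_trans (x u w : Q) : noncentral x -> u * x = x * u -> w * x = x * w ->
  u * w = w * u.
Proof.
move=> nx /(quat_commute nx) [p [q ->]] hw.
by rewrite mulrDl mulrDr mulr_algl mulr_algr -scalerAl -scalerAr hw.
Qed.

Hypothesis aniso : forall x : Q, qnorm x = 0 -> x = 0.

Lemma quat_mulf_eq0 (x y : Q) : x * y = 0 -> x = 0 \/ y = 0.
Proof.
move/(congr1 (@qnorm _ _ _)); rewrite qnormM.
have -> : qnorm (0 : Q) = 0 by rewrite /qnorm /= !expr0n /=; ring.
by move/eqP; rewrite mulf_eq0 => /orP [] /eqP h; [left|right]; apply: aniso.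
Qed.

Lemma quat_unitP (x : Q) : x != 0 -> x \is a GRing.unit.
Proof.
move=> x0; apply: (proj1 (@quat_unit _ _ _ x _)).
by apply: contraNneq x0 => /aniso ->.
Qed.

(** As a conjugate of x, w has the same trace and norm; commuting with x, it satisfies (w - x)(w -
    conj x) = 0, and there are no zero divisors. *)
Lemma quat_conjugate_commute (x y w : Q) : y != 0 -> w * y = y * x -> w * x = x * w ->
  w = x \/ w = qconj x.
Proof.
move=> y0 hw cw; have uy := quat_unitP y0.
have wE : w = y * x * y^-1 by rewrite -hw mulrK.
have nw : qnorm w = qnorm x.
  have ny : qnorm y != 0 by apply: contraNneq y0 => /aniso ->.
  by apply: (mulIf ny); rewrite -qnormM hw qnormM mulrC.
have w2 : w * w = (qcoef0 x *+ 2) *: w - (qnorm x)%:A.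
  rewrite wE !mulrA -[y * x * y^-1 * y]mulrA mulVr // mulr1 -[y * x * x]mulrA qsqr.
  rewrite mulrBr mulrBl -scalerAr -scalerAl mulr_algr -scalerAl mulrV //.
have : (w - x) * (w - qconj x) = 0.
  rewrite mulrBl !mulrBr qmul_conj w2 qconjE mulrBr mulr_algr cw.
  by apply/eqP; rewrite subr_eq0 opprB addrC addrA subrK.
case/quat_mulf_eq0 => /eqP; rewrite subr_eq0 => /eqP; tauto.
Qed.

Lemma qconj_fixed (x : Q) : qconj x = x -> exists c, x = c%:A.
Proof.
case: x => x0 x1 x2 x3 [] h1 h2 h3; exists x0.
have z (s : K) : - s = s -> s = 0.
  move=> e; have /eqP : 2%:R * s = 0 by rewrite mulr_natl mulr2n -{1}e addNr.
  by rewrite mulf_eq0 (negPf n2) => /eqP.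
by rewrite (z _ h1) (z _ h2) (z _ h3); congr Quat => /=; ring.
Qed.

Section Inverting.
Variables (gT : finGroupType) (v : gT -> Q).
Hypotheses (vI : injective v) (v1 : v 1%g = 1) (vM : forall x y, v (x * y)%g = v x * v y).
Hypothesis nonab : exists x y, v x * v y <> v y * v x.

Lemma v_neq0 x : v x != 0.
Proof.
apply/eqP => e; have := vM x x^-1%g; rewrite mulgV v1 e mul0r => /eqP.
by rewrite oner_eq0.
Qed.

Lemma group_centralP x : (x \in 'Z([set: gT]))%g <-> exists c, v x = c%:A.
Proof.
split=> [/centerP [_ hx]|[c hc]].
  have [nx|//] := noncentralP (v x); case: nonab => y [w []].
  apply: (quat_commute_trans nx); rewrite -!vM; congr v; exact/esym/hx.
apply/centerP; split=> // y _; apply: vI; rewrite !vM hc.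
by rewrite mulr_algl mulr_algr.
Qed.

Lemma group_noncentral x : (x \notin 'Z([set: gT]))%g -> noncentral (v x).
Proof. by move/negP=> h c e; apply: h; apply/group_centralP; exists c. Qed.

Lemma group_commute x y w : (x \notin 'Z([set: gT]))%g -> commute y x -> commute w x -> commute y w.
Proof.
move=> /group_noncentral nx cy cw; apply: vI; rewrite !vM.
by apply: (quat_commute_trans nx); rewrite -!vM; [rewrite cy | rewrite cw].
Qed.

(* Otherwise the centralizers of noncentral elements would be self-normalizing, and two
   classes of their noncentral parts would already fill more than the whole group. *)
Lemma exists_inverting : exists x y, noncentral (v x) /\ v y * v x = qconj (v x) * v y.
Proof.
apply: boolp.contrapT => no.
have noinv x y : (x \notin 'Z([set: gT]))%g -> v y * v x <> qconj (v x) * v y.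
  by move=> /group_noncentral nx e; apply: no; exists x, y.
pose Z := ('Z([set: gT]))%g.
pose A x := ('C[x] :\: Z)%g.
(* If a conjugate of u under g stays in C[x], it commutes with u and so equals u or its quaternion
   conjugate; the latter is excluded by assumption, so g centralizes u and therefore x. *)
have ti x : x \notin Z -> normedTI (A x) [set: gT] 'C[x]%g.
  move=> nx; apply/normedTI_memJ_P; split.
  - by apply/finset.set0Pn; exists x; rewrite inE nx cent1id.
  - exact: finset.subsetT.
  move=> u g; rewrite inE => /andP[nu /cent1P cu] _; apply/idP/idP.
    rewrite inE => /andP[nug /cent1P cug].
    have cuu : commute (u ^ g) u by apply: (group_commute nx); [exact: esym | exact: esym].
    have [||e|e] := @quat_conjugate_commute (v u) (v g^-1%g) (v (u ^ g)%g) (v_neq0 _).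
    - by rewrite -!vM; congr v; rewrite conjgE -!mulgA mulgV mulg1.
    - by rewrite -!vM cuu.
    - have eu : (u ^ g)%g = u by exact: vI.
      have cgu : commute g u by rewrite /commute [RHS]conjgC eu.
      apply/cent1P; apply/esym; apply: (group_commute nu) => //; exact: esym.
    case: (noinv u g^-1%g nu); rewrite -e -!vM; congr v.
    by rewrite conjgE -!mulgA mulgV mulg1.
  move/cent1P => cg; have cgu : commute u g.
    by apply: (group_commute nx); [exact: esym | exact: esym].
  by rewrite conjgE cgu mulKg inE nu; apply/cent1P.
have cardA x : x \notin Z -> (#|A x| + #|Z| = #|'C[x]%g|)%N.
  move=> nx; rewrite -(cardsID Z 'C[x]%g) addnC; congr (_ + _)%N.
  congr #|pred_of_set _|; apply/esym/finset.setIidPr; apply/fintype.subsetP => z /centerP [_ hz].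
  by have h := hz x (finset.in_setT _); apply/cent1P; rewrite /commute h.
have cardS x : x \notin Z -> (#|class_support (A x) [set: gT]|%g = #|A x| * #|[set: gT] : 'C[x]|%g)%N.
  by move=> nx; exact: card_support_normedTI (ti x nx).
have sZ x : (Z \subset 'C[x])%g.
  apply/fintype.subsetP => z /centerP [_ hz].
  by have h := hz x (finset.in_setT _); apply/cent1P; rewrite /commute h.
have half x : x \notin Z -> (2 * #|Z| <= #|'C[x]%g|)%N.
  move=> nx; rewrite -(Lagrange (sZ x)) mulnC leq_pmul2l ?cardG_gt0 //.
  rewrite indexg_gt1; apply/negP => /fintype.subsetP /(_ x (cent1id x)) h.
  by rewrite h in nx.
have lag x : (#|'C[x]%g| * #|[set: gT] : 'C[x]|%g = #|[set: gT]|)%N.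
  exact: Lagrange (finset.subsetT _).
have Z0 : (0 < #|Z|)%N by exact: cardG_gt0.
pose S x := (class_support (A x) [set: gT])%g.
have inS x w : w \in S x -> exists u g, u \in A x /\ w = (u ^ g)%g.
  by case/imset2P => u g hu _ ->; exists u, g.
have supZ x w : w \in S x -> w \notin Z.
  move=> /inS [u [g [hu ->]]]; apply/negP => /centerP [_ hz].
  move: hu; rewrite inE => /andP[/negP nu _]; apply: nu; apply/centerP; split=> // y _.
  have := hz (y ^ g)%g (finset.in_setT _); rewrite /commute -!conjMg.
  by move/conjg_inj.
have SZ x : (#|S x :|: Z| = #|S x| + #|Z|)%N.
  rewrite cardsU (_ : S x :&: Z = finset.set0) ?cards0 ?subn0 //.
  apply/eqP; rewrite -finset.subset0; apply/fintype.subsetP => w; rewrite inE => /andP[/supZ h1 h2].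
  by rewrite h2 in h1.
have [x nx] : exists x, x \notin Z.
  have [y [w hyw]] := nonab; exists y; apply/negP => /centerP [_ h].
  by apply: hyw; rewrite -!vM; congr v; exact: h.
have [full|[x' hx']] : (S x :|: Z = [set: gT]) \/ exists x', x' \notin S x :|: Z.
  have [h|/set0Pn [x' hx']] := eqVneq (~: (S x :|: Z)) finset.set0.
    by left; rewrite -[LHS]finset.setCK h finset.setC0.
  by right; exists x'; rewrite -finset.in_setC.
  have cS := cardS x nx; have cA := cardA x nx; have l := lag x.
  have := SZ x; rewrite full /S cS -l -cA.
  rewrite mulnDl => /addnI /eqP; rewrite -[X in _ == X]muln1 eqn_pmul2l // indexg_eq1.
  move/fintype.subsetP => h; move/negP: nx; apply; apply/centerP; split=> // y _.
  by have /cent1P := h y (finset.in_setT _) => /esym.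
have nx' : x' \notin Z by move: hx'; rewrite inE negb_or => /andP[].
have dis w : w \in S x -> w \notin S x'.
  move=> /inS [u [g [hu ew]]]; apply/negP => /inS [u' [g' [hu' ew']]].
  move: hx'; rewrite inE negb_or => /andP[/negP nS _]; apply: nS.
  pose k := (g * g'^-1)%g; have ek : u' = (u ^ k)%g.
    by rewrite /k conjgM -ew ew' -conjgM mulgV conjg1.
  move: hu hu'; rewrite !finset.in_setD => /andP[nu /cent1P cu] /andP[nu' /cent1P cu'].
  have cx : commute x' (x ^ k)%g.
    apply: (group_commute nu'); first exact: esym.
    by rewrite ek /commute -!conjMg cu.
  apply/imset2P; exists (x' ^ k^-1)%g k; rewrite ?finset.in_setT //; last by rewrite -conjgM mulVg conjg1.
  rewrite finset.in_setD; apply/andP; split.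
    apply/negP => /centerP [_ hz]; move/negP: nx'; apply; apply/centerP; split=> // y _.
    have := hz (y ^ k^-1)%g (finset.in_setT _); rewrite /commute -!conjMg.
    by move/conjg_inj.
  have h : (x' ^ k^-1 * x)%g = (x * x' ^ k^-1)%g.
    have ez : ((x' ^ k^-1) ^ k)%g = x' by rewrite -conjgM mulVg conjg1.
    by apply: (@conjg_inj _ k); rewrite conjMg [RHS]conjMg ez cx.
  by apply/cent1P; rewrite /commute h.
have : (#|S x :|: Z| + #|S x'| <= #|[set: gT]|)%N.
  rewrite -cardsUI (_ : (S x :|: Z) :&: S x' = finset.set0).
    by rewrite cards0 addn0; exact: (subset_leq_card (finset.subsetT _)).
  apply/eqP; rewrite -finset.subset0; apply/fintype.subsetP => w; rewrite finset.in_setI finset.in_setU => /andP[/orP [] h1 h2].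
    by have := dis w h1; rewrite h2.
  by have := supZ _ _ h2; rewrite h1.
(* Each class support has |G| - |Z| [G : C] >= |G| / 2 elements because [C : Z] >= 2; adding the
   centre exceeds |G|. *)
rewrite SZ /S !cardS //.
have := cardA x nx; have := cardA x' nx'; have := lag x; have := lag x'.
have := half x nx; have := half x' nx'; move: Z0.
move: #|[set: gT]| #|A x| #|A x'| #|'C[x]%g| #|'C[x']%g| #|Z|.
move: #|[set: gT] : 'C[x]|%g #|[set: gT] : 'C[x']|%g; clear; nia.
Qed.
End Inverting.
End Centralizers.

Section SquareRoots.
Variables (K : fieldType) (a b : K).
Hypothesis aniso : forall x : quat a b, qnorm x = 0 -> x = 0.

Lemma quat_sqrt_central (x : quat a b) (s : K) : x * x = (s ^+ 2)%:A -> exists c, x = c%:A.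
Proof.
move=> e; have : (x - s%:A) * (x + s%:A) = 0.
  rewrite mulrBl !mulrDr e mulr_algr mulr_algl opprD addrA [X in X - _]addrAC.
  by rewrite subrK mulr_algl scalerA -expr2 subrr.
case/(quat_mulf_eq0 aniso) => /eqP; rewrite ?subr_eq0 ?addr_eq0 => /eqP ->; first by exists s.
by exists (- s); rewrite scaleNr.
Qed.

Lemma noncentral_alg_mul (x : quat a b) (c : K) : c != 0 -> noncentral x -> noncentral (c *: x).
Proof.
move=> c0 nx d e; apply: (nx (c^-1 * d)).
by rewrite -scalerA -e scalerA mulVf // scale1r.
Qed.
End SquareRoots.

(** * Normal form of an inverting pair *)

Section Reduction.
Variables (K : fieldExtType rat) (a b : K).
Hypotheses (a0 : a != 0) (b0 : b != 0).
Hypothesis aniso : forall x : quat a b, qnorm x = 0 -> x = 0.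
Local Notation Q := (quat a b).

Definition inverting_pair (N : nat) (x y : Q) : Prop :=
  [/\ (0 < N)%N, x ^+ N = 1, y ^+ N = 1, noncentral x & y * x = qconj x * y].

(** y^2 commutes with x, so y^2 = p + q x; it also commutes with y, which does not commute with x,
    so q = 0. *)
Lemma inverting_sqr N x y : inverting_pair N x y -> exists2 c : K, c ^+ N = 1 & y * y = c%:A.
Proof.
move=> [N0 xN yN nx yx].
have K2 : 2%:R != 0 :> K by rewrite nf_nat_eq0.
have yyx : (y * y) * x = x * (y * y).
  have yc : y * qconj x = x * y.
    rewrite qconjE mulrBr yx mulr_algr qconjE mulrBl mulr_algl opprB addrC subrK //.
  by rewrite -mulrA yx mulrA yc mulrA.
have [p [q e]] := quat_commute K2 a0 b0 nx yyx.
have q0 : q = 0.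
  apply/eqP; apply: contraT => q0.
  have : y * (y * y) = (y * y) * y by rewrite mulrA.
  rewrite e mulrDr mulrDl mulr_algr mulr_algl => /addrI.
  rewrite -scalerAr -scalerAl => /(scalerI q0); rewrite yx => /eqP.
  rewrite -subr_eq0 -mulrBl => /eqP /(quat_mulf_eq0 aniso) [] /eqP.
    by rewrite subr_eq0 => /eqP /(qconj_fixed K2) [c ec]; case: (nx c).
  move/eqP => y0; move: yN; rewrite y0 expr0n; case: (N) N0 => // m _ /= /eqP.
  by rewrite eq_sym oner_eq0.
have yy : y * y = p%:A by rewrite e q0 scale0r addr0.
exists p => //; have : (y ^+ 2) ^+ N = 1 by rewrite -exprM mulnC exprM yN expr1n.
have pw m : (p ^+ m)%:A = p%:A ^+ m :> Q.
  elim: m => [|m IH]; first by rewrite !expr0 scale1r.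
  by rewrite !exprS -IH mulr_algl scalerA.
rewrite expr2 yy => h; have : (p ^+ N)%:A = 1%:A :> Q by rewrite pw h scale1r.
move=> /eqP; rewrite -subr_eq0 -scalerBl scaler_eq0 oner_eq0 orbF subr_eq0 => /eqP.
by [].
Qed.

Lemma qnormX (x : Q) k : qnorm (x ^+ k) = qnorm x ^+ k.
Proof. by elim: k => [|k IH]; rewrite ?expr0 ?qnorm1 // !exprS qnormM IH. Qed.

(** The element I = 2x - t is the difference of x and its conjugate, so y anticommutes with it, and
    norm 1 gives I^2 = t^2 - 4. *)
Lemma inverting_quat_isom (x y : Q) : noncentral x -> y * x = qconj x * y -> y * y = (-1)%:A ->
  qnorm x = 1 -> let t := qcoef0 x *+ 2 in t ^+ 2 - 4 != 0 /\ alg_isom Q (quat (t ^+ 2 - 4) (-1)).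
Proof.
move=> nx yx yy n1 t; have K2 : 2%:R != 0 :> K by rewrite nf_nat_eq0.
pose I := 2%:R *: x - t%:A.
have II : I * I = (t ^+ 2 - 4)%:A.
  rewrite /I /t; case: (x) n1 => x0 x1 x2 x3; rewrite /qnorm /= => n1'.
  congr Quat; rewrite /=; try ring.
  transitivity ((x0 *+ 2) ^+ 2 - 4 * (x0 ^+ 2 - a * x1 ^+ 2 - b * x2 ^+ 2 + a * b * x3 ^+ 2)).
    by ring.
  by rewrite n1'; ring.
have cI : 2%:R *: qconj x - t%:A = - I.
  by rewrite /I /t; case: (x) => x0 x1 x2 x3; congr Quat; rewrite /=; ring.
have l0 : t ^+ 2 - 4 != 0.
  apply/eqP => l0; have : I * I = 0 by rewrite II l0 scale0r.
  case/(quat_mulf_eq0 aniso) => /eqP; rewrite /I subr_eq0 => /eqP e;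
    by apply: (nx (2%:R^-1 * t)); rewrite -scalerA -e scalerA mulVf // scale1r.
split=> //; apply: (alg_isom_quat (I := I) (J := y)) => //.
- by rewrite oppr_eq0 oner_eq0.
- exact: dim_quat.
have -> : y * I = (2%:R *: qconj x - t%:A) * y.
  by rewrite /I mulrBr mulrBl -scalerAr -scalerAl yx mulr_algr mulr_algl.
by rewrite cI mulNr.
Qed.

(** This condition on K allows y^2 and the norm of x to be normalized up to sign by scalars, while x
    and y remain of finite order. *)
Definition roots_of_unity_square : Prop := forall (c : K) (N : nat), (0 < N)%N -> c ^+ N = 1 ->
  exists s : K, c = s ^+ 2 \/ c = - s ^+ 2.

(** y^2 is not a square in K, as y would then be central; so y^2 = -s^2, and y / s has square -1.
    The norm of x is scaled to 1 or -1, and in the second case x is replaced by its square. *)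
Lemma inverting_normalize N x y : roots_of_unity_square -> inverting_pair N x y ->
  exists M x' y', [/\ inverting_pair M x' y', y' * y' = (-1)%:A & qnorm x' = 1].
Proof.
move=> RU ip; have [c cN yy] := inverting_sqr ip; have [N0 xN yN nx yx] := ip.
have K2 : 2%:R != 0 :> K by rewrite nf_nat_eq0.
have unit_neq0 (d : K) : d ^+ N = 1 -> d != 0.
  move=> dN; apply: contra_eq_neq dN => ->; rewrite expr0n.
  by case: (N) N0 => // m _; rewrite eq_sym oner_neq0.
have [s hs] := RU c N N0 cN.
have s0 : s != 0.
  have := unit_neq0 c cN; case: hs => ->; rewrite ?oppr_eq0 expf_eq0 //=.
have yx0 d : y <> d%:A.
  move=> ey; have y0 : y != 0.
    by apply/eqP => y0; move: yN; rewrite y0 expr0n; case: (N) N0 => // m _ /= /eqP; rewrite eq_sym oner_eq0.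
  have : (x - qconj x) * y = 0 by rewrite mulrBl -yx ey mulr_algl mulr_algr subrr.
  case/(quat_mulf_eq0 aniso) => /eqP; last by rewrite (negPf y0).
  by rewrite subr_eq0 => /eqP /esym /(qconj_fixed K2) [e he]; apply: (nx e).
have cs : c = - s ^+ 2.
  case: hs => // cs; rewrite cs in yy.
  by have [d /yx0] := quat_sqrt_central aniso yy.
pose y' := s^-1 *: y.
have y'y' : y' * y' = (-1)%:A.
  rewrite /y' -scalerAl -scalerAr scalerA yy scalerA cs; congr (_ *: _); field; exact: s0.
have y'4 : y' ^+ (4 * N) = 1.
  by rewrite exprM (exprM _ 2 2) [y' ^+ 2]y'y' [_ ^+ 2]mulr_algl scalerA mulrNN mulr1 scale1r expr1n.
have nuN : qnorm x ^+ N = 1 by rewrite -qnormX xN qnorm1.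
have [r hr] := RU _ N N0 nuN.
have r0 : r != 0.
  have := unit_neq0 _ nuN; case: hr => ->; rewrite ?oppr_eq0 expf_eq0 //=.
have r4 : r ^+ (4 * N) = 1.
  have e4 : r ^+ 4 = qnorm x ^+ 2 by case: hr => ->; ring.
  by rewrite exprM e4 -exprM mulnC exprM nuN expr1n.
pose x1 := r^-1 *: x.
have nx1 : noncentral x1 by apply: noncentral_alg_mul; rewrite // invr_eq0.
have qZ k (u : Q) : qconj (k *: u) = k *: qconj u.
  by case: u => u0 u1 u2 u3; congr Quat; rewrite /=; ring.
have nZ k (u : Q) : qnorm (k *: u) = k ^+ 2 * qnorm u.
  by case: u => u0 u1 u2 u3; rewrite /qnorm /=; ring.
have yx1 : y' * x1 = qconj x1 * y'.
  by rewrite /x1 /y' qZ -!scalerAl -!scalerAr yx !scalerA mulrC.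
have ZX k (u : Q) m : (k *: u) ^+ m = k ^+ m *: u ^+ m.
  elim: m => [|m IH]; first by rewrite !expr0 scale1r.
  by rewrite !exprS IH -scalerAl -scalerAr scalerA.
have x1N : x1 ^+ (4 * N) = 1.
  by rewrite ZX exprVn r4 invr1 scale1r mulnC exprM xN expr1n.
have N40 : (0 < 4 * N)%N by rewrite muln_gt0.
have [n1|n1] : qnorm x1 = 1 \/ qnorm x1 = -1.
  by rewrite nZ; case: hr => ->; [left|right]; field.
  by exists (4 * N)%N, x1, y'.
exists (4 * N)%N, (x1 * x1), y'; split=> //; last by rewrite qnormM n1 mulrNN mulr1.
split=> //.
- by rewrite -expr2 -exprM mulnC exprM x1N expr1n.
- move=> d e; have := qsqr x1; rewrite n1 scaleN1r opprK => e1.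
  have t0 : qcoef0 x1 *+ 2 = 0.
    apply/eqP; apply: contraT => t0; case: (nx1 ((qcoef0 x1 *+ 2)^-1 * (d - 1))).
    have e2 : (qcoef0 x1 *+ 2) *: x1 = (d - 1)%:A.
      by rewrite scalerBl scale1r -e e1 addrK.
    by rewrite -scalerA -e2 scalerA mulVf // scale1r.
  have : x1 * x1 = (1 ^+ 2)%:A by rewrite e1 t0 scale0r add0r expr1n scale1r.
  by case/(quat_sqrt_central aniso) => d' /nx1.
by rewrite mulrA yx1 -mulrA yx1 mulrA qconjM.
Qed.

(** The integer n is the order of a complex root z of the minimal polynomial of x; it exceeds 2,
    because x^2 = 1 would make x central. *)
Lemma lambda_of_inverting (R : realType) N (x y : Q) : inverting_pair N x y -> qnorm x = 1 ->
  (qcoef0 x *+ 2) ^+ 2 - 4 != 0 ->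
  exists n, (3 <= n)%N /\ lambda_sqr_in R n ((qcoef0 x *+ 2) ^+ 2 - 4).
Proof.
move=> [N0 xN yN nx yx] n1; set t := _ *+ 2 => l0.
have e : x * x = t *: x - 1 by have := qsqr x; rewrite n1 scale1r.
have [iota] := emb_exists R K; have [z [w [zw zpw]]] := quadratic_roots (iota t).
have el : iota (t ^+ 2 - 4) = (z - w) ^+ 2.
  rewrite rmorphB rmorphXn rmorph_nat /= -zpw (_ : 4 = 4 * (z * w)); first ring.
  by rewrite zw mulr1.
have znw : z != w.
  by rewrite -subr_eq0; apply: contraNneq l0 => e0; rewrite -(fmorph_eq0 iota) el e0 expr0n.
have ord k : (z ^+ k == 1) = (x ^+ k == 1).
  rewrite (cheb_unity _ zw zpw znw) (quat_unity _ e nx) cheb_morph.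
  rewrite [cheb t k]surjective_pairing /= !xpair_eqE fmorph_eq0 -(rmorphN1 iota).
  by rewrite (inj_eq (fmorph_inj iota)).
have zN : z ^+ N = 1 by apply/eqP; rewrite ord xN.
have [m pm _] := prim_order_exists N0 zN.
have z0 : z != 0 by apply: contra_eq_neq zw => ->; rewrite mul0r eq_sym oner_neq0.
have wE : w = z^-1 by apply: (mulfI z0); rewrite zw divff.
exists m; split; last by exists iota, z, t; split; rewrite -?wE.
rewrite leqNgt ltnS; apply/negP => m2.
have : x ^+ 2 == 1.
  rewrite -ord -(prim_order_dvd pm); move: m2 (prim_order_gt0 pm).
  by case: (m) => [|[|[|]]].
rewrite expr2 => /eqP x2; have : x * x = (1 ^+ 2)%:A by rewrite x2 expr1n scale1r.
by case/(quat_sqrt_central aniso) => d /nx.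
Qed.
End Reduction.

(** * Roots of unity in real and imaginary quadratic fields *)

Section RootsOfUnity.
Variables (R : realType) (K : fieldExtType rat).
Local Notation C := R[i].

Lemma real_roots_of_unity (r : {rmorphism K -> R}) : roots_of_unity_square K.
Proof.
move=> c N N0 cN; have : `|r c| == 1.
  by rewrite -(pexpr_eq1 N0) // -normrX -rmorphXn cN rmorph1 normr1.
rewrite eqr_norml ler01 andbT => /orP [] /eqP e; exists 1; rewrite expr1n.
  by left; apply: (fmorph_inj r); rewrite e rmorph1.
by right; apply: (fmorph_inj r); rewrite e rmorphN1.
Qed.

Section ImaginaryQuadratic.
Variable d : int.
Hypotheses (d0 : d < 0) (hK : is_quadratic_field K d).

Lemma imaginary_real_rational (s : {rmorphism K -> C}) (x : K) : s x \is Num.real ->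
  exists p : rat, x = p%:A.
Proof.
move=> /CrealP xr; have [r hr crd] := quadratic_coords hK; have [p [q ex]] := crd x.
have rr (y : rat) : (ratr y : C)^*%C = ratr y by exact: fmorph_rat.
have sr : s r ^+ 2 < 0 by rewrite -rmorphXn hr rmorph_int ltrz0.
have r0 : s r != 0 by apply: contraTneq sr => ->; rewrite expr0n ltxx.
have sx : s x = ratr p + ratr q * s r by rewrite ex rmorphD -[q *: r]mulr_algl rmorphM !emb_rat.
have : ratr q * s r = - (ratr q * s r).
  have : (s x)^*%C = s x by exact: xr.
  by rewrite sx conjcD [(ratr q * _)^*%C]conjcM !rr (conjC_sqr_neg sr) mulrN => /addrI e.
move/eqP; rewrite -addr_eq0 -mulr2n mulrn_eq0 /= mulf_eq0 (negPf r0) orbF fmorph_eq0 => /eqP q0.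
by exists p; rewrite ex q0 scale0r addr0.
Qed.

(** The trace is a sum of two roots of unity, hence a rational algebraic integer. The exponent 2N
    covers the case z = w, where z^2 = 1. *)
Lemma rational_unity_trace_int (p : rat) N : (0 < N)%N -> cheb p N = (0, -1) -> p \in Num.int.
Proof.
move=> N0 hch; have [z [w [zw zpw]]] := quadratic_roots (ratr p : algC).
have AP (x : algC) : x ^+ (2 * N) = 1 -> x \in Aint.
  by move=> h; apply: (@Aint_unity_root (2 * N)); [rewrite muln_gt0 | exact/unity_rootP].
have z1 : z ^+ (2 * N) = 1.
  have [e|ne] := eqVneq z w; first by rewrite exprM expr2 {2}e zw expr1n.
  rewrite mulnC exprM; have /eqP -> : z ^+ N == 1; last by rewrite expr1n.
  by rewrite (cheb_unity _ zw zpw ne) cheb_morph hch rmorph0 rmorphN1.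
have w1 : w ^+ (2 * N) = 1 by rewrite -[LHS]mul1r -z1 -exprMn zw expr1n.
rewrite -Cint_rat; apply: Cint_rat_Aint; first exact: Crat_rat.
by rewrite -zpw rpredD ?AP.
Qed.

(** In C the trace is z + conj(z) with |z| = 1, so it is real, and real elements of an imaginary
    quadratic field are rational. *)
Lemma unity_trace_int (t : K) N : (0 < N)%N -> cheb t N = (0, -1) ->
  exists m : int, t = m%:~R /\ -2 <= m <= 2.
Proof.
move=> N0 hch; have [s] := emb_exists R K; have [z [w [zw zpw]]] := quadratic_roots (s t).
have z1 : z ^+ (2 * N) = 1.
  have [e|ne] := eqVneq z w; first by rewrite exprM expr2 {2}e zw expr1n.
  rewrite mulnC exprM; have /eqP -> : z ^+ N == 1; last by rewrite expr1n.
  by rewrite (cheb_unity _ zw zpw ne) cheb_morph hch rmorph0 rmorphN1.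
have nz : `|z| = 1.
  by apply/eqP; rewrite -(@pexpr_eq1 _ _ (2 * N)) // ?muln_gt0 // -normrX z1 normr1.
have z0 : z != 0 by rewrite -normr_eq0 nz oner_neq0.
have wE : w = z^*%C by apply: (mulfI z0); rewrite zw -[RHS]normCK nz expr1n.
have tr : s t \is Num.real.
  apply/CrealP; rewrite -[LHS]/((s t)^*%C) -zpw wE conjcD [_^*%C^*%C]conjCK addrC.
  by [].
have [p tp] := imaginary_real_rational tr.
have pint : p \in Num.int.
  apply: (rational_unity_trace_int N0); move: hch; rewrite tp.
  rewrite -[p%:A]/(in_alg K p) cheb_morph; case: (cheb p N) => u v [] /eqP.
  rewrite scaler_eq0 oner_eq0 orbF => /eqP -> /eqP.
  rewrite -subr_eq0 opprK -[X in _ + X]scale1r -scalerDl scaler_eq0 oner_eq0 orbF addr_eq0.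
  by move=> /eqP ->.
have /intrP [m em] := pint; exists m; rewrite tp em; split; first by rewrite -in_alg_int.
have : `|s t| <= 2.
  by rewrite -zpw wE; apply: le_trans (ler_normD _ _) _; rewrite normcJ nz.
rewrite tp em -[_%:A]/(in_alg K _) in_alg_int rmorph_int -intr_norm -[2]/((2%:Z)%:~R) ler_int.
by clear; lia.
Qed.

Lemma imaginary_root_of_unity (c : K) N : (0 < N)%N -> c ^+ N = 1 ->
  [\/ c = 1 \/ c = -1, c ^+ 2 = -1, c ^+ 2 = c - 1 | c ^+ 2 = - c - 1].
Proof.
move=> N0 cN; have c0 : c != 0.
  by apply: contra_eq_neq cN => ->; rewrite expr0n; case: (N) N0 => // m _; rewrite eq_sym oner_neq0.
have cc : c * c^-1 = 1 by rewrite divff.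
have [e|ne] := eqVneq c c^-1.
  have : c ^+ 2 == 1 by rewrite expr2 {2}e cc.
  by rewrite sqrf_eq1 => /orP [] /eqP h; constructor 1; [left|right].
have [m [tm /andP[m1 m2]]] : exists m : int, c + c^-1 = m%:~R /\ -2 <= m <= 2.
  by apply: (unity_trace_int N0); apply/eqP; rewrite -(cheb_unity _ cc erefl ne) cN.
have c2 : c ^+ 2 = m%:~R * c - 1 by rewrite -tm mulrDl mulVf // expr2 addrK.
have [em|[em|[em|[em|em]]]] : m = 2 \/ m = 1 \/ m = 0 \/ m = -1 \/ m = -2.
  by move: m1 m2; clear; lia.
- constructor 1; left; apply/eqP; rewrite -subr_eq0 -sqrf_eq0; apply/eqP.
  rewrite em in c2; rewrite sqrrB1 c2 -[2%:~R]/(2%:R) -mulr_natl; ring.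
- by constructor 3; rewrite c2 em mul1r.
- by constructor 2; rewrite c2 em mul0r sub0r.
- by constructor 4; rewrite c2 em mulN1r.
constructor 1; right; apply/eqP; rewrite -addr_eq0 -sqrf_eq0; apply/eqP.
by rewrite em in c2; rewrite sqrrD1 c2 (_ : (-2)%:~R = - 2%:R) ?rmorphN // -mulr_natl; ring.
Qed.

(** The orders left are 1, 2, 3 and 6, and c^4 equals c in order 3 and -c in order 6. *)
Lemma imaginary_roots_of_unity : (forall u : K, u ^+ 2 <> -1) -> roots_of_unity_square K.
Proof.
move=> ni c N N0 cN; have [[->|->]|/ni //|e|e] := imaginary_root_of_unity N0 cN.
- by exists 1; left; rewrite expr1n.
- by exists 1; right; rewrite expr1n.
- exists (c ^+ 2); right; rewrite -exprM (exprM c 2 2) e.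
  have -> : (c - 1) ^+ 2 = c ^+ 2 - 2 * c + 1 by ring.
  by rewrite e; ring.
exists (c ^+ 2); left; rewrite -exprM (exprM c 2 2) e.
have -> : (- c - 1) ^+ 2 = c ^+ 2 + 2 * c + 1 by ring.
by rewrite e; ring.
Qed.

(** A square root of 3 is real at every embedding, hence rational. This keeps roots of unity of
    order 3 out of a field that contains i. *)
Lemma imaginary_no_sqrt3 (v : K) : v ^+ 2 <> 3.
Proof.
move=> hv; have [s] := emb_exists R K.
have : s v \is Num.real by rewrite realEsqr -rmorphXn hv rmorph_nat ler0n.
case/imaginary_real_rational => p ep.
have p2 : p ^+ 2 = 3.
  apply: (fmorph_inj (in_alg K)); rewrite rmorphXn /= -ep hv.
  by rewrite -[RHS]/(in_alg K 3%:R) rmorph_nat.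
have : numq p ^+ 2 = 3 * denq p ^+ 2.
  apply: (@intr_inj rat); rewrite rmorphXn rmorphM rmorphXn /= numqE exprMn p2.
  by [].
move/(congr1 absz); rewrite abszM !abszX => /(congr1 (logn 3)).
have n0 : (0 < absz (denq p))%N by rewrite absz_gt0 denq_neq0.
rewrite lognM ?expn_gt0 ?n0 // !lognX (_ : logn 3 (absz 3) = 1%N) //.
by clear; lia.
Qed.

(* With u^2 = -1 the roots of unity are the powers of u: either some product of x and y has a
   central square that is a square in K, or there are I, y with I^2 = -3, y^2 = 2 and
   yI = -Iy, and then (I + y)^2 = -1 = u^2. *)
Lemma imaginary_with_i (a b : K) (u : K) (x y : quat a b) N : a != 0 -> b != 0 ->
  (forall x : quat a b, qnorm x = 0 -> x = 0) -> u ^+ 2 = -1 -> inverting_pair N x y -> False.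
Proof.
move=> a0 b0 aniso u2 ip; have K2 : 2%:R != 0 :> K by rewrite nf_nat_eq0.
have [c cN yy] := inverting_sqr a0 b0 aniso ip; have [N0 xN yN nx yx] := ip.
have uu : u * u = -1 by rewrite -expr2.
have u0 : u != 0.
  by apply: contra_eq_neq u2 => ->; rewrite expr0n eq_sym oppr_eq0 oner_neq0.
have no3 (w : K) : w ^+ 2 <> -3%:R.
  move=> e; apply: (@imaginary_no_sqrt3 (u * w)).
  by rewrite exprMn u2 e mulrNN mul1r.
have roots (e : K) : e ^+ N = 1 -> (exists s, e = s ^+ 2) \/ exists2 s : K, s ^+ 2 = 1 & e = s * u.
  move=> eN; have [[->|->]|e2|e2|e2] := imaginary_root_of_unity N0 eN.
  - by left; exists 1; rewrite expr1n.
  - by left; exists u; rewrite u2.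
  - have : (e - u) * (e + u) = 0 by rewrite -subr_sqr e2 u2 subrr.
    move/eqP; rewrite mulf_eq0 subr_eq0 addr_eq0 => /orP [] /eqP ->; right.
      by exists 1; rewrite ?expr1n ?mul1r.
    by exists (-1); rewrite ?sqrrN ?expr1n ?mulN1r.
  - case: (no3 (2 * e - 1)).
    have -> : (2 * e - 1) ^+ 2 = 4 * e ^+ 2 - 4 * e + 1 by ring.
    by rewrite e2; ring.
  case: (no3 (2 * e + 1)).
  have -> : (2 * e + 1) ^+ 2 = 4 * e ^+ 2 + 4 * e + 1 by ring.
  by rewrite e2; ring.
have ynz : y != 0.
  by apply/eqP => y0; move: yN; rewrite y0 expr0n; case: (N) N0 => // m _ /= /eqP; rewrite eq_sym oner_eq0.
have yc e : y <> e%:A.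
  move=> ey; have : (x - qconj x) * y = 0 by rewrite mulrBl -yx ey mulr_algl mulr_algr subrr.
  case/(quat_mulf_eq0 aniso) => /eqP; last by rewrite (negPf ynz).
  by rewrite subr_eq0 => /eqP /esym /(qconj_fixed K2) [e' he]; apply: (nx e').
have [[s cs]|[s s2 cs]] := roots c cN.
  by rewrite cs in yy; have [e /yc] := quat_sqrt_central aniso yy.
have nuN : qnorm x ^+ N = 1 by rewrite -qnormX xN qnorm1.
have nu0 : qnorm x != 0 by apply: contra_notN (nx 0) => /eqP /aniso ->; rewrite scale0r.
(* If x^2 is central, then x^2 = -nu and (xy)^2 = nu c, where nu is the norm of x: the first is a
   square when nu is, and otherwise nu and c are both u up to sign, so the second is 1 or -1, again
   a square. *)
have [nxx|[e exx]] := noncentralP (x * x); last first.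
  have t0 : qcoef0 x *+ 2 = 0.
    apply/eqP; apply: contraT => t0; case: (nx ((qcoef0 x *+ 2)^-1 * (e + qnorm x))).
    have e2 : (qcoef0 x *+ 2) *: x = (e + qnorm x)%:A.
      by rewrite scalerDl -exx qsqr subrK.
    by rewrite -scalerA -e2 scalerA mulVf // scale1r.
  have xx : x * x = (- qnorm x)%:A by rewrite qsqr t0 scale0r sub0r scaleNr.
  have cx : qconj x = - x by rewrite qconjE t0 scale0r sub0r.
  have yx' : y * x = - (x * y) by rewrite yx cx mulNr.
  have xyxy : (x * y) * (x * y) = (qnorm x * c)%:A.
    rewrite -mulrA [y * _]mulrA yx' mulNr mulrN -mulrA yy mulr_algr -scalerAr xx scalerA.
    by rewrite mulrN scaleNr opprK mulrC.
  have [[r hr]|[r r2 hr]] := roots _ nuN.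
    have : x * x = ((u * r) ^+ 2)%:A by rewrite xx hr exprMn u2 mulN1r.
    by case/(quat_sqrt_central aniso) => f /nx.
  have xysq : exists q, (x * y) * (x * y) = (q ^+ 2)%:A.
    have ec : qnorm x * c = (u * u) * (r * s) by rewrite hr cs; ring.
    rewrite xyxy ec -expr2 u2.
    have : (r * s) ^+ 2 == 1 by rewrite exprMn r2 s2 mul1r.
    by rewrite sqrf_eq1 => /orP [] /eqP ->; [exists u | exists 1]; rewrite ?u2 ?expr1n ?mulr1 // mulrNN mulr1.
  case: xysq => q /(quat_sqrt_central aniso) [f hf].
  have yxf : y * x = (- f)%:A by rewrite yx' hf scaleNr.
  have : (2%:R * f) *: x = 0.
    have : x * (y * x) = (x * y) * x by rewrite mulrA.
    rewrite yxf hf mulr_algr mulr_algl => ef.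
    by rewrite mulr_natl mulr2n scalerDl -{1}ef scaleNr addNr.
  move/eqP; rewrite scaler_eq0 mulf_eq0 (negPf K2) /= => /orP [] /eqP h0.
    move: hf; rewrite h0 scale0r => /(quat_mulf_eq0 aniso) [] h1.
      by apply: (nx 0); rewrite h1 scale0r.
    by apply: (yc 0); rewrite h1 scale0r.
  by apply: (nx 0); rewrite h0 scale0r.
pose X := (qnorm x)^-1 *: (x * x).
have nX : noncentral X by apply: noncentral_alg_mul => //; rewrite invr_eq0.
have ZX k (w : quat a b) m : (k *: w) ^+ m = k ^+ m *: w ^+ m.
  elim: m => [|m IH]; first by rewrite !expr0 scale1r.
  by rewrite !exprS IH -scalerAl -scalerAr scalerA.
have XN : X ^+ N = 1.
  by rewrite ZX exprVn nuN invr1 scale1r -expr2 -exprM mulnC exprM xN expr1n.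
have n1 : qnorm X = 1.
  have -> : qnorm X = (qnorm x)^-1 ^+ 2 * qnorm (x * x).
    by rewrite /X; case: (x * x) => w0 w1 w2 w3; rewrite /qnorm /=; ring.
  by rewrite qnormM; field.
have qZ k (w : quat a b) : qconj (k *: w) = k *: qconj w.
  by case: w => w0 w1 w2 w3; congr Quat; rewrite /=; ring.
have yX : y * X = qconj X * y.
  by rewrite /X qZ -scalerAr -scalerAl mulrA yx -mulrA yx mulrA qconjM.
pose t := qcoef0 X *+ 2.
have eX : X * X = t *: X - 1 by have := qsqr X; rewrite n1 scale1r.
have hch : cheb t N = (0, -1) by apply/eqP; rewrite -(quat_unity _ eX nX) XN.
have [m [tm /andP[m1 m2]]] := unity_trace_int N0 hch.
pose I := 2%:R *: X - t%:A.
have nI e : I <> e%:A.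
  move=> h; apply: (nX (2%:R^-1 * (e + t))).
  by rewrite -scalerA scalerDl -h subrK scalerA mulVf // scale1r.
have II : I * I = (t ^+ 2 - 4)%:A.
  rewrite /I /t; case: (X) n1 => x0 x1 x2 x3; rewrite /qnorm /= => n1'.
  congr Quat; rewrite /=; try ring.
  transitivity ((x0 *+ 2) ^+ 2 - 4 * (x0 ^+ 2 - a * x1 ^+ 2 - b * x2 ^+ 2 + a * b * x3 ^+ 2)).
    by ring.
  by rewrite n1'; ring.
have cI : 2%:R *: qconj X - t%:A = - I.
  by rewrite /I /t; case: (X) => x0 x1 x2 x3; congr Quat; rewrite /=; ring.
have yI : y * I = - (I * y).
  have -> : y * I = (2%:R *: qconj X - t%:A) * y.
    by rewrite /I mulrBr mulrBl -scalerAr -scalerAl yX mulr_algr mulr_algl.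
  by rewrite cI mulNr.
have nsq (s' : K) : t ^+ 2 - 4 <> s' ^+ 2.
  by move=> h; rewrite h in II; have [e /nI] := quat_sqrt_central aniso II.
(* The traces 2, -2 and 0 would make t^2 - 4 a square, namely 0 or (2u)^2. *)
have t1 : t ^+ 2 = 1.
  have [em|[em|em]] : `|m| = 2 \/ `|m| = 1 \/ m = 0 by move: m1 m2; clear; lia.
  - case: (nsq 0); have : m ^+ 2 = 4 by rewrite -(real_normK (num_real m)) em.
    by rewrite tm -rmorphXn => e4; rewrite /= e4 expr0n subrr.
  - have : m ^+ 2 = 1 by rewrite -(real_normK (num_real m)) em.
    by rewrite tm -rmorphXn => ->.
  by case: (nsq (2 * u)); rewrite tm em exprMn u2; ring.
(* As s^2 = 1 and u^2 = -1, k^2 = -2 s u, and so y1^2 = -2 (s u)^2 = 2. *)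
pose k := 1 - s * u; pose y1 := k *: y.
have y1y1 : y1 * y1 = 2%:R%:A.
  rewrite /y1 -scalerAl -scalerAr yy !scalerA; congr (_ *: _); rewrite cs /k.
  transitivity (s * u - 2 * (s ^+ 2 * u ^+ 2) + s * u * (s ^+ 2 * u ^+ 2)); first by ring.
  by rewrite s2 u2; ring.
have y1I : y1 * I = - (I * y1) by rewrite /y1 -scalerAl -scalerAr yI scalerN.
have : (I + y1) * (I + y1) = (u ^+ 2)%:A.
  have -> : (I + y1) * (I + y1) = (t ^+ 2 - 4 + 2%:R)%:A + (I * y1 + y1 * I).
    have sq (p q : quat a b) : (p + q) * (p + q) = p * p + q * q + (p * q + q * p).
      by rewrite mulrDl !mulrDr -!addrA; congr (_ + _); rewrite addrA addrC.
    by rewrite sq II y1y1 -scalerDl.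
  rewrite y1I subrr addr0 t1 u2.
  by congr (_ *: _); ring.
case/(quat_sqrt_central aniso) => e he.
have y1E : y1 = e%:A - I by rewrite -he addrC addKr.
have cI1 : y1 * I = I * y1.
  have cm (p : quat a b) : (e%:A - p) * p = p * (e%:A - p).
    by rewrite mulrBl mulrBr mulr_algl mulr_algr.
  by rewrite y1E cm.
have z2 : I * y1 = 0.
  apply/eqP; have /eqP : 2%:R *: (I * y1) = 0 by rewrite scaler_nat mulr2n -{1}cI1 y1I addNr.
  by rewrite scaler_eq0 (negPf K2).
have [h0|h0] := quat_mulf_eq0 aniso z2; first by apply: (nI 0); rewrite h0 scale0r.
move: y1y1; rewrite h0 mul0r => /esym /eqP; rewrite scaler_eq0 (negPf K2) /=.
by rewrite oner_eq0.
Qed.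
End ImaginaryQuadratic.
End RootsOfUnity.

(** If G were commutative, the centralizer of each of its elements would contain G, hence be A; the
    same argument then makes every element of A central. *)
Lemma schur_noncommuting (K : fieldType) (A : falgType K) (G : seq A) :
  (<<1 & G>>)%VS = {:A}%VS -> (exists x y : A, x * y <> y * x) ->
  exists x y, [/\ x \in G, y \in G & x * y <> y * x].
Proof.
move=> full [x [y nc]]; apply: boolp.contrapT => no; apply: nc.
have sub (g : A) : {in G, forall h, g * h = h * g} -> forall z, g * z = z * g.
  move=> hg z; have : (<<1 & G>> <= 'C[g])%VS.
    have s1 : (1 <= 'C[g])%VS.
      by apply/subvP => _ /vlineP [k ->]; apply/cent1vP; rewrite mulr_algl mulr_algr.
    have sG : (1 + <<G>> <= 'C[g])%VS.
      rewrite subv_add s1 /=.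
      by apply/span_subvP => h hG; apply/cent1vP; rewrite hg.
    apply: agenv_sub_modr => //.
    by apply: subv_trans (prodvSr _ sG) _; exact: asubv.
  by rewrite full => /subvP /(_ z (memvf z)) /cent1vP.
apply: (sub) => h hG; apply/esym; apply: (sub) => g gG.
by apply: boolp.contrapT => ne; apply: no; exists h, g.
Qed.

Lemma squarefree_sqfree (d : int) : squarefree d -> sqfree (- d).
Proof.
move=> sq p pp; apply/negP; rewrite rpredN => /sq.
by case: p pp => [|[|p]].
Qed.

(** A quaternion of norm 0 multiplies its conjugate to 0, and having no zero divisors is invariant
    under isomorphism. *)
Lemma anisotropic_isom (K : fieldType) (a b a' b' : K) : alg_isom (quat a' b') (quat a b) ->
  (forall x : quat a b, qnorm x = 0 -> x = 0) -> forall x : quat a' b', qnorm x = 0 -> x = 0.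
Proof.
move=> [h bh] aniso x nx; have inj := bij_inj bh.
have : h x * h (qconj x) = 0 by rewrite -rmorphM qmul_conj nx scale0r rmorph0.
case/(quat_mulf_eq0 aniso); rewrite -(rmorph0 h) => /inj // cx.
by rewrite -[x]qconjK cx; congr Quat; rewrite /= oppr0.
Qed.

(** * Congruence conditions on d and the final classification *)

Section Necessity.
Variable K : fieldExtType rat.

Lemma quadratic_sqrt_neq0 (d : int) (r : K) : d < 0 -> r ^+ 2 = d%:~R -> r != 0.
Proof.
move=> d0 hr; apply/eqP => r0; move/eqP: hr.
by rewrite r0 expr0n eq_sym -(rmorph_int (in_alg K)) fmorph_eq0 intr_eq0 => /eqP d0'; rewrite d0' in d0.
Qed.

Lemma int_neq0 (w : int) : w != 0 -> w%:~R != 0 :> K.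
Proof. by move=> w0; rewrite -(rmorph_int (in_alg K)) fmorph_eq0 intr_eq0. Qed.

(** Otherwise -d w^2 = x^2 + y^2 + z^2 with w nonzero, and w sqrt(d) + x i + y j + z ij is a nonzero
    quaternion of norm 0. *)
Lemma anisotropic_m1m1_mod8 (d : int) : d < 0 -> squarefree d -> is_quadratic_field K d ->
  (forall x : quat (-1 : K) (-1), qnorm x = 0 -> x = 0) -> (d = 1 %[mod 8])%Z.
Proof.
move=> d0 /squarefree_sqfree sq [r [hr _]] aniso.
have [h|h] := boolP (8 %| - d + 1)%Z; first by move: h; clear; lia.
have [] := three_squares sq _ h; first by rewrite oppr_gt0.
move=> x [y [z [w [w0 e]]]].
have n0 : qnorm (Quat (-1 : K) (-1) (r * w%:~R) x%:~R y%:~R z%:~R) = 0.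
  rewrite /qnorm /= exprMn hr.
  transitivity ((d * w ^+ 2 + (x ^+ 2 + y ^+ 2 + z ^+ 2))%:~R : K).
    by rewrite !rmorphD rmorphM !rmorphXn /=; ring.
  by rewrite -e mulNr subrr.
case: (aniso _ n0) => /eqP; rewrite mulf_eq0 (negPf (int_neq0 w0)) orbF => /eqP r0.
by have := quadratic_sqrt_neq0 d0 hr; rewrite r0 eqxx.
Qed.

Lemma anisotropic_m1m3_mod3 (d : int) : d < 0 -> squarefree d -> is_quadratic_field K d ->
  (forall x : quat (-1 : K) (-3%:R), qnorm x = 0 -> x = 0) -> (d = 1 %[mod 3])%Z.
Proof.
move=> d0 /squarefree_sqfree sq [r [hr _]] aniso.
have [h|h] := boolP (3 %| - d + 1)%Z; first by move: h; clear; lia.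
have [] := one_three_three sq _ h; first by rewrite oppr_gt0.
move=> x [y [z [w [w0 e]]]].
have n0 : qnorm (Quat (-1 : K) (-3%:R) (r * w%:~R) x%:~R y%:~R z%:~R) = 0.
  rewrite /qnorm /= exprMn hr.
  transitivity ((d * w ^+ 2 + (x ^+ 2 + 3 * y ^+ 2 + 3 * z ^+ 2))%:~R : K).
    by rewrite !intrD (intrM _ d) !(intrM _ 3) !rmorphXn /=; ring.
  by rewrite -e mulNr subrr.
case: (aniso _ n0) => /eqP; rewrite mulf_eq0 (negPf (int_neq0 w0)) orbF => /eqP r0.
by have := quadratic_sqrt_neq0 d0 hr; rewrite r0 eqxx.
Qed.

Lemma schur_inverting_pair (A : falgType K) (a b : K) (f : {lrmorphism A -> quat a b}) :
  bijective f -> a != 0 -> b != 0 -> (forall x : quat a b, qnorm x = 0 -> x = 0) ->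
  schur_algebra A -> (exists x y : A, x * y <> y * x) ->
  exists N x y, @inverting_pair K a b N x y.
Proof.
move=> bf a0 b0 aniso [_ [G [hG full]]] nc.
have K2 : 2%:R != 0 :> K by rewrite nf_nat_eq0.
have [g [h [gG hG' ngh]]] := schur_noncommuting full nc.
have [gT [v [vI v1 vM vG]]] := finite_group_model hG.
have inj := bij_inj bf.
have [] := @exists_inverting K a b K2 a0 b0 aniso gT (f \o v) (inj_comp inj vI).
- by rewrite /= v1 rmorph1.
- by move=> x y /=; rewrite vM rmorphM.
- have [x hx] := (vG g).1 gG; have [y hy] := (vG h).1 hG'.
  by exists x, y; rewrite /= hx hy -!rmorphM => /inj.
move=> x [y [nx yx]].
have vX (z : gT) n : f (v z) ^+ n = f (v (z ^+ n)%g).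
  elim: n => [|n IH]; first by rewrite expr0 expg0 v1 rmorph1.
  by rewrite exprS expgS vM rmorphM IH.
have vT (z : gT) : f (v z) ^+ #|gT| = 1.
  rewrite vX -cardsT (_ : (z ^+ #|[set: gT]| = 1)%g) ?v1 ?rmorph1 //.
  by apply: expg_cardG; rewrite finset.in_setT.
exists #|gT|, (f (v x)), (f (v y)); split=> //.
- by apply/card_gt0P; exists x.
- exact: vT.
exact: vT.
Qed.

(** Since K does not contain i, the pair can be normalized. The trace of x is then an integer with
    |t| <= 2, and |t| = 2 is excluded because t^2 - 4 is nonzero. *)
Lemma inverting_no_real (R : realType) (A : falgType K) (a b : K) (d : int) N (x y : quat a b) :
  alg_isom A (quat a b) -> a != 0 -> b != 0 -> (forall x : quat a b, qnorm x = 0 -> x = 0) ->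
  inverting_pair N x y -> d < 0 -> squarefree d -> is_quadratic_field K d ->
  ((d = 1 %[mod 8])%Z /\ alg_isom A (quat (-1 : K) (-1))) \/
  ((d = 1 %[mod 3])%Z /\ alg_isom A (quat (-1 : K) (-3%:R))).
Proof.
move=> iso a0 b0 aniso ip d0 sq hK.
have K2 : 2%:R != 0 :> K by rewrite nf_nat_eq0.
have ni (u : K) : u ^+ 2 <> -1.
  by move=> hu; exact: (imaginary_with_i R d0 hK a0 b0 aniso hu ip).
have RU := imaginary_roots_of_unity R d0 hK ni.
have {ip x y N} [N [x [y [ip yy n1]]]] := inverting_normalize a0 b0 aniso RU ip.
have [N0 xN yN nx yx] := ip.
have [t0 {}iso'] := inverting_quat_isom aniso nx yx yy n1.
set t := qcoef0 x *+ 2 in t0 iso'.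
have e : x * x = t *: x - 1 by have := qsqr x; rewrite n1 scale1r.
have hch : cheb t N = (0, -1) by apply/eqP; rewrite -(quat_unity _ e nx) xN.
have [m [tm /andP [m1 m2]]] := unity_trace_int R d0 hK N0 hch.
have m10 : - 1 != 0 :> K by exact: (neg_neq0 K 0).
have [em|[em|em]] : `|m| = 2 \/ `|m| = 1 \/ m = 0 by move: m1 m2; clear; lia.
- have m4 : m ^+ 2 = 4 by rewrite -(real_normK (num_real m)) em.
  by case/eqP: t0; rewrite tm -rmorphXn /= m4 subrr.
- have m4 : m ^+ 2 = 1 by rewrite -(real_normK (num_real m)) em.
  have t2 : t ^+ 2 - 4 = - 3%:R by rewrite tm -rmorphXn /= m4; ring.
  rewrite t2 in iso'; right.
  have iso3 := alg_isom_trans iso' (quat_swap K2 (neg_neq0 K 2) m10).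
  split; last exact: alg_isom_trans iso iso3.
  apply: (anisotropic_m1m3_mod3 d0 sq hK).
  exact: anisotropic_isom (alg_isom_sym iso3) aniso.
have t2 : t ^+ 2 - 4 = (-1) * (2 ^+ 2 - (-1) * 0 ^+ 2) by rewrite tm em; ring.
rewrite t2 in iso'; left.
have n4 : 2 ^+ 2 - (-1) * 0 ^+ 2 != 0 :> K by rewrite expr0n mulr0 subr0 expf_neq0.
have iso1 : alg_isom (quat a b) (quat (-1 : K) (-1)).
  apply: alg_isom_trans iso' _; apply: alg_isom_trans (quat_swap K2 _ m10) _.
    by rewrite mulf_neq0.
  by apply: alg_isom_sym; apply: quat_scale_norm.
split; last exact: alg_isom_trans iso iso1.
apply: (anisotropic_m1m1_mod8 d0 sq hK).
exact: anisotropic_isom (alg_isom_sym iso1) aniso.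
Qed.
End Necessity.

Theorem theorem1p5 (R : realType) (K : fieldExtType rat) (A : falgType K)
    (hA : central_simple A)
    (hnc : exists x y : A, x * y <> y * x) :
  schur_algebra A /\ kleinian_type R A <->
  [\/ alg_isom A 'M[K]_2 /\
        (is_rational_field K \/
         exists d : int, [/\ d < 0, squarefree d & is_quadratic_field K d]),
      exists d : int,
        [/\ d < 0, squarefree d, (d = 1 %[mod 8])%Z, is_quadratic_field K d &
            alg_isom A (quat (-1 : K) (-1))],
      exists d : int,
        [/\ d < 0, squarefree d, (d = 1 %[mod 3])%Z, is_quadratic_field K d &
            alg_isom A (quat (-1 : K) (-3%:R))] |
      exists (n : nat) (l : K),
        [/\ (3 <= n)%N, lambda_sqr_in R n l, has_real_embedding R K,
            at_most_one_complex_pair R K & alg_isom A (quat l (-1))]].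
Proof.
have K2 : 2%:R != 0 :> K by rewrite nf_nat_eq0.
have m10 : - 1 != 0 :> K by exact: (neg_neq0 K 0).
split=> [[schur klein]|].
  have [a [b [O [f [s [phi [[a0 b0 bf] [hO ext disc]]]]]]]] := noncomm_kleinian hnc klein.
  have iso : alg_isom A (quat a b) by exists f.
  have [[x [/eqP x0 nx]]|no] := boolp.EM (exists x : quat a b, x <> 0 /\ qnorm x = 0).
    have isoM := alg_isom_trans iso (quat_isotropic_matrix K2 a0 b0 x0 nx).
    by constructor 1; split=> //; exact: matrix_kleinian klein.
  have aniso (x : quat a b) : qnorm x = 0 -> x = 0.
    by move=> nx; apply: boolp.contrapT => x0; apply: no; exists x.
  have amo := division_at_most_one_pair bf a0 b0 ext hO disc aniso.
  have [N [x [y ip]]] := schur_inverting_pair bf a0 b0 aniso schur hnc.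
  have [[r]|nr] := boolp.EM (has_real_embedding R K).
    have [M [x' [y' [ip' yy n1]]]] := inverting_normalize a0 b0 aniso (real_roots_of_unity r) ip.
    have [_ _ _ nx yx] := ip'.
    have [t0 iso'] := inverting_quat_isom aniso nx yx yy n1.
    have [n [n3 hl]] := lambda_of_inverting aniso R ip' n1 t0.
    constructor 4; exists n, ((qcoef0 x' *+ 2) ^+ 2 - 4); split=> //.
    exact: alg_isom_trans iso iso'.
  have [d [d0 sq hK]] := imaginary_of_no_real amo nr.
  have [[h i]|[h i]] := inverting_no_real R iso a0 b0 aniso ip d0 sq hK.
    by constructor 2; exists d.
  by constructor 3; exists d.
have n10 : 1 != 0 :> K by exact: oner_neq0.
case=> [[iso hK]|[d [d0 sq _ hK iso]]|[d [d0 sq _ hK iso]]|[n [l [n3 hl re amo iso]]]].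
(* M_2(K) is (1, 1 / K), where ij and j generate a dihedral group of order 8. *)
- have iso1 : alg_isom A (quat (1 : K) 1).
    apply: alg_isom_trans iso (alg_isom_sym _).
    by have := quat_sqr_matrix K2 n10 n10; rewrite expr1n.
  split; first exact: schur_quat11.
  case: hK => [hK|[d [d0 _ hK]]]; first exact: (kleinian_rational R hK n10 n10 iso1).
  exact: (kleinian_imaginary R d0 hK n10 n10 iso1).
- by split; [exact: schur_quat_m1m1 | exact: (kleinian_imaginary R d0 hK m10 m10 iso)].
- split; first exact: schur_quat_m1m3.
  exact: kleinian_imaginary d0 hK m10 (neg_neq0 K 2) iso.
exact: sufficiency_lambda hA n3 hl amo iso.
Qed.
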